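(* Let $m,\nu,\mu,\lambda\in\mathbb{R}$, $k\in\mathbb{Z}\setminus\{0\}$, and let $h$, $h^*$ be the radial Dirac operators defined in the context. Set $\delta:=(k+\lambda)^2+\mu^2-\nu^2$, assume $\delta<0$, and set $\gamma:=\sqrt{|\delta|}$. There is a one (real) parameter family $(t(\theta))_{\theta\in[0,\pi)}$ of self-adjoint extensions $h\subset t(\theta)=t(\theta)^*\subset h^*$. Moreover, $(f^+,f^-)\in\mathcal{D}(t(\theta))$ if and only if $(f^+,f^-)\in\mathcal{D}(h^* )$ and there exists $A\in\mathbb{C}$ such that $$\lim_{r\to0}\left|\begin{pmatrix} f^+(r)\\ f^-(r)\end{pmatrix}-D\begin{pmatrix} A\,e^{i\theta}\,r^{i\gamma}\\ A\sqrt{\frac{\nu+\mu}{\nu-\mu}}\;e^{-i\theta}\,r^{-i\gamma}\end{pmatrix}\right|r^{-1/2}=0,$$ where $D\in\mathbb{C}^{2\times2}$ is invertible and equals $$D:=\frac{1}{2i\gamma(\lambda+k-i\gamma)}\begin{pmatrix}\lambda+k-i\gamma & \nu-\mu\\ -(\nu+\mu) & -(\lambda+k-i\gamma)\end{pmatrix}.$$ Conversely, any self-adjoint extension $t$ of $h$ verifies $t=t(\theta)$ for some $\theta\in[0,\pi)$.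
   Context: All operators act in the Hilbert space $L^2(0,+\infty)^2=L^2((0,+\infty);\mathbb{C}^2)$ (Lebesgue measure $dr$); $\mathcal{D}(\cdot)$ denotes the domain, and $S\subset T$ for operators means that $T$ extends $S$. The integer $k$ is the index $k=k_j=\pm(j+1/2)$, $j\in\{1/2,3/2,\dots\}$, of a partial wave subspace; the operators below (written $h_{m_j,k_j}$ etc. in the paper) depend only on $k$ and on $m,\nu,\mu,\lambda$. Minimal operator: $\mathcal{D}(h)=C_c^\infty(0,+\infty)^2$ (with values in $\mathbb{C}^2$), and $$h\begin{pmatrix} f^+\\ f^-\end{pmatrix}=\begin{pmatrix} m+\frac{\nu+\mu}{r} & -\partial_r+\frac{k+\lambda}{r}\\ \partial_r+\frac{k+\lambda}{r} & -m+\frac{\nu-\mu}{r}\end{pmatrix}\begin{pmatrix} f^+\\ f^-\end{pmatrix}.$$ Maximal operator: $h^*$ is given by the same matrix differential expression, understood in the sense of distributions on $(0,+\infty)$, with domain $\mathcal{D}(h^* )=\{(f^+,f^-)\in L^2(0,+\infty)^2 : h^*(f^+,f^-)\in L^2(0,+\infty)^2\}$; it is the adjoint of $h$. Each $t(\theta)$ acts as the restriction of $h^*$ to $\mathcal{D}(t(\theta))$. Elements of $\mathcal{D}(h^* )$ are identified with their continuous representatives on $(0,+\infty)$ in pointwise statements. Here $r^{\pm i\gamma}=e^{\pm i\gamma\log r}$. *)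

(* Defs.v *)
From HB Require Import structures.
From mathcomp Require Import all_boot all_order all_algebra.
From mathcomp Require Import complex.
From mathcomp Require Import all_classical all_reals all_analysis.

Set Implicit Arguments.
Unset Strict Implicit.
Unset Printing Implicit Defensive.

Import Order.TTheory GRing.Theory Num.Theory.
Import numFieldNormedType.Exports.

Local Open Scope classical_set_scope.
Local Open Scope ring_scope.
Local Open Scope complex_scope.

Definition halfline (R : realType) : set R := `]0, +oo[%classic.

Definition vec2 (R : realType) (a b : R[i]) : 'cV[R[i]]_2 :=
  \col_(i < 2) [:: a; b]`_i.

Definition mat2 (R : realType) (a b c d : R[i]) : 'M[R[i]]_2 :=
  \matrix_(i < 2, j < 2) (nth [::] [:: [:: a; b]; [:: c; d]] i)`_j.

Definition cabs2 (R : realType) (z : R[i]) : R := complex.Re z ^+ 2 + complex.Im z ^+ 2.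

Definition vnorm (R : realType) (v : 'cV[R[i]]_2) : R :=
  Num.sqrt (\sum_(i < 2) cabs2 (v i 0)).

Definition cis (R : realType) (x : R) : R[i] := cos x +i* sin x.

(* Only the values on (0, +oo) of a spinor matter.  Elements of the Hilbert
   space L^2((0, +oo); C^2) are represented by Borel functions satisfying [L2],
   two of them being identified when [eqL2] holds. *)
Definition spinor (R : realType) : Type := R -> 'cV[R[i]]_2.

Section Hilbert.
Variable R : realType.
Local Notation leb := (@lebesgue_measure R).
Local Notation D := (@halfline R).
Implicit Types f g : spinor R.

Definition cmeasurable (u : R -> R[i]) : Prop :=
  measurable_fun D (fun x => complex.Re (u x)) /\ measurable_fun D (fun x => complex.Im (u x)).

Definition cintegral (u : R -> R[i]) : R[i] :=
  (\int[leb]_(x in D) complex.Re (u x)) +i* (\int[leb]_(x in D) complex.Im (u x)).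

Definition L2sqnorm f : \bar R := (\int[leb]_(x in D) (vnorm (f x) ^+ 2)%:E)%E.

Definition L2 f : Prop :=
  (forall i, cmeasurable (fun x => f x i 0)) /\ (L2sqnorm f < +oo)%E.

Definition eqL2 f g : Prop := ae_eq leb D f g.

Definition inner f g : R[i] :=
  cintegral (fun x => \sum_(i < 2) conjc (f x i 0) * g x i 0).

End Hilbert.

(* An unbounded operator is given by its graph.  Inclusion of graphs is
   extension of operators, and equality of graphs is equality of operators,
   since graphs are saturated for [eqL2]. *)
Definition graph (R : realType) : Type := set (spinor R * spinor R).

Section Operators.
Variable R : realType.
Implicit Types (f g : spinor R) (T : graph R).

Definition dom T : set (spinor R) := [set f | exists g, T (f, g)].

Record is_operator T : Prop := IsOperator {
  graph_L2 : forall f g, T (f, g) -> L2 f /\ L2 g;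
  graph_saturated : forall f g f' g', T (f, g) -> L2 f' -> L2 g' ->
    eqL2 f f' -> eqL2 g g' -> T (f', g');
  graph_zero : T (fun=> 0, fun=> 0);
  graph_linear : forall (a : R[i]) f g f' g', T (f, g) -> T (f', g') ->
    T (fun x => a *: f x + f' x, fun x => a *: g x + g' x);
  graph_functional : forall f g g', T (f, g) -> T (f, g') -> eqL2 g g' }.

Definition densely_defined T : Prop :=
  forall f, L2 f -> forall e : R, 0 < e ->
    exists2 g, dom T g & (L2sqnorm (fun x => f x - g x)%R < e%:E)%E.

Definition adjoint T : graph R :=
  [set p | [/\ L2 p.1, L2 p.2 &
    forall f g, T (f, g) -> inner g p.1 = inner f p.2]].

Definition selfadjoint T : Prop :=
  [/\ is_operator T, densely_defined T & T = adjoint T].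

End Operators.

Section Dirac.
Variable R : realType.

Definition smooth (u : R -> R) : Prop :=
  forall (n : nat) (x : R), derivable (derive1n n u) x 1.

(* C_c^oo(0, +oo; C), functions being extended by 0 to the whole line. *)
Definition test_function (phi : R -> R[i]) : Prop :=
  [/\ smooth (fun x => complex.Re (phi x)), smooth (fun x => complex.Im (phi x)) &
      exists a b : R, 0 < a /\ forall x, phi x != 0 -> a <= x <= b].

Definition cderive (u : R -> R[i]) (x : R) : R[i] :=
  derive1 (fun y => complex.Re (u y)) x +i* derive1 (fun y => complex.Im (u y)) x.

(* The matrix differential expression is  J f' + V(r) f. *)
Definition dirac_J : 'M[R[i]]_2 := mat2 0 (-1) 1 0.

Definition dirac_V (m nu mu lam : R) (k : int) (r : R) : 'M[R[i]]_2 :=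
  mat2 (m + (nu + mu) / r)%:C     ((k%:~R + lam) / r)%:C
       ((k%:~R + lam) / r)%:C     (- m + (nu - mu) / r)%:C.

Definition dirac_expr (m nu mu lam : R) (k : int) (f : spinor R) : spinor R :=
  fun r => dirac_J *m (\col_i cderive (fun x => f x i 0) r)
           + dirac_V m nu mu lam k r *m f r.

Definition dirac_min (m nu mu lam : R) (k : int) : graph R :=
  [set p | [/\ L2 p.1, L2 p.2 &
    exists phi : spinor R,
      [/\ forall i, test_function (fun x => phi x i 0),
          eqL2 p.1 phi & eqL2 p.2 (dirac_expr m nu mu lam k phi)]]].

(* J f' + V f = g in the sense of distributions on (0, +oo). *)
Definition dirac_weak (m nu mu lam : R) (k : int) (f g : spinor R) : Prop :=
  forall phi : R -> R[i], test_function phi -> forall i : 'I_2,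
    cintegral (fun r =>
      (- cderive phi r *: (dirac_J *m f r)
       + phi r *: (dirac_V m nu mu lam k r *m f r)) i 0)
    = cintegral (fun r => phi r * g r i 0).

Definition dirac_max (m nu mu lam : R) (k : int) : graph R :=
  [set p | [/\ L2 p.1, L2 p.2 & dirac_weak m nu mu lam k p.1 p.2]].

Definition dirac_delta (nu mu lam : R) (k : int) : R :=
  (k%:~R + lam) ^+ 2 + mu ^+ 2 - nu ^+ 2.

Definition dirac_gamma (nu mu lam : R) (k : int) : R :=
  Num.sqrt `|dirac_delta nu mu lam k|.

Definition dirac_D (nu mu lam : R) (k : int) : 'M[R[i]]_2 :=
  let g := dirac_gamma nu mu lam k in
  let a := (lam + k%:~R)%:C - 'i%C * g%:C in
  (2%:R * 'i%C * g%:C * a)^-1 *: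
    mat2 a                  (nu - mu)%:C
         (- (nu + mu))%:C   (- a).

Definition dirac_profile (nu mu lam : R) (k : int) (theta : R) (A : R[i]) (r : R) :
    'cV[R[i]]_2 :=
  let g := dirac_gamma nu mu lam k in
  vec2 (A * cis theta * cis (g * ln r))
       (A * (Num.sqrt ((nu + mu) / (nu - mu)))%:C
          * cis (- theta) * cis (- (g * ln r))).

Definition continuous_representative (f fc : spinor R) : Prop :=
  eqL2 f fc /\
  forall r : R, 0 < r -> vnorm (fc s - fc r) @[s --> r] --> (0 : R).

Definition boundary_condition (nu mu lam : R) (k : int) (theta : R)
    (f : spinor R) : Prop :=
  exists fc : spinor R, continuous_representative f fc /\
    exists A : R[i],
      vnorm (fc r - dirac_D nu mu lam k *m dirac_profile nu mu lam k theta A r)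
        * r `^ (- 2^-1) @[r --> 0^'+] --> (0 : R).

End Dirac.

(* Main.v *)
Require Import Defs.
From mathcomp Require Import all_boot all_order all_algebra.
From mathcomp Require Import complex ring lra.
From mathcomp Require Import all_classical all_reals all_analysis measurable_realfun.
Import Order.TTheory GRing.Theory Num.Theory.
Import numFieldNormedType.Exports.
Local Open Scope classical_set_scope.
Local Open Scope ring_scope.
Set Implicit Arguments.
Unset Strict Implicit.
Unset Printing Implicit Defensive.
Local Open Scope complex_scope.

(** Write p = nu + mu, q = nu - mu, kappa = k + lambda and a = kappa - i gamma,
so that p q = |a|^2. With the bounded mass term moved to the right-hand
side, the equation h^* f = g reads r f' = B f + r G near the origin, where G
is square integrable and B is a constant matrix with B^2 = - gamma^2. The
columns of D are eigenvectors of B for the eigenvalues i gamma and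
- i gamma. Hence the coordinates of f in the frame
D diag(r^(i gamma), r^(- i gamma)) have a square integrable derivative, and
by the Cauchy-Schwarz inequality they converge at 0 with an error o(sqrt r).
Every f in the domain of h^* therefore has a trace (c0, c1) in C^2
([trace_exists]); it is unique ([trace_unique]), every pair occurs
([trace_surjective]), and the traces of the minimal domain vanish
([dmin_trace]). The condition of parameter theta says that the trace lies on
the complex line spanned by (e^(i theta), rho e^(- i theta)), where
rho = sqrt (p / q).

Green's formula ([lagrange_identity]) identifies the defect of symmetry of
h^* with a nonzero multiple of p conj(c0) e0 - q conj(c1) e1, where (c0, c1)
and (e0, e1) are the two traces. Infinity does not contribute: the Wronskian
of two elements of the domain and its derivative are both integrable, so that
it tends to 0 there. An operator between h and h^* is thus self-adjoint when
its set of traces is its own orthogonal for this Hermitian form. Since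
p q > 0 the form is indefinite, and these sets are the complex lines on which
|c1| = rho |c0|; each is spanned by (e^(i theta), rho e^(- i theta)) for some
theta in [0, pi) ([isotropic_on_ray], [ext_adjoint], [selfadjoint_ext]). No
self-adjoint extension escapes, because the adjoint of any extension of h is
contained in h^* ([adjoint_max]).

The analysis rests on four facts. Indefinite integrals of locally integrable
functions obey the product rule, by Fubini's theorem on a triangle
([has_densityM]). The distributional domain consists of such indefinite
integrals ([weak_density], [weak_ac]): testing the equation against smoothed
indicators of intervals whose end points are Lebesgue points of f computes
the increments of f. A square integrable function orthogonal to the test
functions is null ([fundamental_lemma]), which makes h^* single-valued. The
test functions are dense, by truncation and mollification ([sqint_dense]). *)

Local Notation leb := (@lebesgue_measure _).
Local Notation D := (@halfline _).
Local Notation Re := (@complex.Re _).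
Local Notation Im := (@complex.Im _).
Local Notation intble E u := (leb.-integrable E (EFin \o u)).
Local Notation i0 := (ord0 : 'I_2).
Local Notation i1 := (ord_max : 'I_2).

(** * Real Lebesgue integrals *)

Section RealIntegral.
Variable R : realType.
Implicit Types (u v w z : R -> R) (E : set R).

Lemma intbleD E u v : measurable E -> intble E u -> intble E v ->
  intble E (fun x => u x + v x).
Proof.
by move=> mE iu iv; have := @integrableD _ _ _ leb E mE _ _ iu iv.
Qed.

Lemma intbleZ E (c : R) u : measurable E -> intble E u ->
  intble E (fun x => c * u x).
Proof.
by move=> mE iu; have := @integrableZl _ _ _ leb E mE c _ iu.
Qed.

Lemma intbleN E u : intble E u -> intble E (fun x => - u x).
Proof.
by move=> iu; have := @integrableN _ _ _ leb E _ iu.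
Qed.

Lemma intbleB E u v : measurable E -> intble E u -> intble E v ->
  intble E (fun x => u x - v x).
Proof. by move=> mE iu iv; apply: intbleD => //; exact: intbleN. Qed.

Lemma eq_intble E u v : measurable E -> (forall x, E x -> u x = v x) ->
  intble E u -> intble E v.
Proof.
move=> mE uv; apply: eq_integrable => // x /set_mem Ex.
by rewrite /= uv.
Qed.

Lemma intble_meas E u : intble E u -> measurable_fun E u.
Proof. by move=> /(measurable_int leb)/measurable_EFinP. Qed.

Lemma intble_le E u v : measurable E -> measurable_fun E u ->
  (forall x, E x -> `|u x| <= v x) -> intble E v -> intble E u.
Proof.
move=> mE mu uv; apply: le_integrable => //; first exact/measurable_EFinP.
move=> x Ex /=; rewrite lee_fin.
by apply: (le_trans (uv _ Ex)); exact: ler_norm.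
Qed.

Lemma intble_bounded E u v (c : R) : measurable E -> measurable_fun E v ->
  (forall x, E x -> `|v x| <= c) -> intble E u -> intble E (fun x => v x * u x).
Proof.
move=> mE mv vc iu; apply: (@intble_le _ _ (fun x => c * `|u x|)) => //.
- by apply: measurable_funM => //; exact: intble_meas.
- by move=> x Ex; rewrite normrM ler_wpM2r// vc.
- by apply: intbleZ => //; exact: (@integrable_norm _ _ _ leb).
Qed.

Lemma ae_mono (P Q : R -> Prop) : (forall x, P x -> Q x) ->
  {ae leb, forall x, P x} -> {ae leb, forall x, Q x}.
Proof.
by move=> PQ; apply: filterS => //; exact: (ae_filter_ringOfSetsType leb).
Qed.

Lemma ae_mono2 (P Q S : R -> Prop) : (forall x, P x -> Q x -> S x) ->
  {ae leb, forall x, P x} -> {ae leb, forall x, Q x} -> {ae leb, forall x, S x}.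
Proof.
by move=> PQ; apply: filterS2 => //; exact: (ae_filter_ringOfSetsType leb).
Qed.

Lemma eq_ae_Rintegral E u v : measurable E -> measurable_fun E u -> measurable_fun E v ->
  ae_eq leb E u v -> \int[leb]_(x in E) u x = \int[leb]_(x in E) v x.
Proof.
move=> mE mu mv uv; congr fine; apply: ae_eq_integral => //.
- exact/measurable_EFinP.
- exact/measurable_EFinP.
- by apply: filterS uv => x uv Ex; rewrite uv.
Qed.

Lemma intble_ae E u v : measurable E -> measurable_fun E v -> ae_eq leb E u v ->
  intble E u -> intble E v.
Proof.
move=> mE mv uv iu; have mu := intble_meas iu.
apply/integrableP; split; first exact/measurable_EFinP.
move/integrableP: iu => [_]; apply: le_lt_trans; rewrite le_eqVlt; apply/orP; left; apply/eqP.
apply: ae_eq_integral => //.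
- by apply: measurableT_comp => //; exact/measurable_EFinP.
- by apply: measurableT_comp => //; exact/measurable_EFinP.
- by apply: filterS uv => x uv Dx; rewrite /= uv.
Qed.

Lemma intble_norm E u : intble E u -> intble E (fun x => `|u x|).
Proof. by move=> iu; have := @integrable_norm _ _ _ leb E u iu. Qed.

Lemma normr_Rintegral_le E u : measurable E -> intble E u ->
  `|\int[leb]_(x in E) u x| <= \int[leb]_(x in E) `|u x|.
Proof. by move=> mE iu; exact: (le_normr_Rintegral _ iu). Qed.

Lemma intbleS E F u : measurable E -> measurable F -> F `<=` E ->
  intble E u -> intble F u.
Proof. by move=> mE mF FE; exact: (@integrableS _ _ _ leb E F). Qed.

Lemma intble_restrict E u : measurable E -> intble E u -> intble setT (u \_ E).
Proof.
move=> mE iu.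
by have := (@integrable_mkcond _ _ _ leb E (EFin \o u) mE).1 iu; rewrite restrict_EFin.
Qed.

Lemma leb_itv_cc (a b : R) : a <= b -> leb (`[a, b]%classic : set R) = (b - a)%:E.
Proof.
rewrite le_eqVlt => /predU1P[->|ab].
  by rewrite set_itv1 lebesgue_measure_set1 subrr.
by rewrite lebesgue_measure_itv /= lte_fin ab EFinN -EFinD.
Qed.

Lemma Rintegral_cst_itv (a b c : R) : a <= b ->
  \int[leb]_(x in `[a, b]) c = c * (b - a).
Proof.
move=> ab; rewrite Rintegral_cst; last exact: measurable_itv.
by congr (_ * _); exact: (congr1 fine (leb_itv_cc ab)).
Qed.

Lemma intble_cst_itv (a b c : R) : intble (`[a, b]%classic : set R) (fun=> c).
Proof.
apply: measurable_bounded_integrable; first exact: measurable_itv.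
- rewrite /= lebesgue_measure_itv/= lte_fin; case: ifP => // _.
  by rewrite EFinN -EFinD ltry.
- exact: measurable_cst.
- exact: bounded_cst.
Qed.

Lemma measurable_patch E F u : measurable F -> measurable_fun F u ->
  measurable_fun E (u \_ F).
Proof. by move=> mF mu; apply: measurable_funTS; apply/(measurable_restrictT _ _).1. Qed.

Lemma dominated_Rintegral E (u_ : nat -> R -> R) u v : measurable E ->
  (forall n, measurable_fun E (u_ n)) -> measurable_fun E u -> intble E v ->
  (forall n x, E x -> `|u_ n x| <= v x) ->
  {ae leb, forall x, E x -> u_ ^~ x @ \oo --> u x} ->
  \int[leb]_(x in E) u_ n x @[n --> \oo] --> \int[leb]_(x in E) u x.
Proof.
move=> mE mu_ mu iv uv cu.
have [||||| F1 _ F2] := @dominated_convergence _ _ _ leb E mE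
  (fun n x => (u_ n x)%:E) (fun x => (u x)%:E) (fun x => (v x)%:E).
- by move=> n; apply/measurable_EFinP; exact: mu_.
- by apply/measurable_EFinP; exact: mu.
- apply: ae_mono cu => x cu Ex; apply: cvg_EFin; first exact: nearW.
  exact: cu Ex.
- exact: iv.
- by apply/aeW => x n Ex; rewrite lee_fin uv.
have F1' : (\int[leb]_(x in E) (u x)%:E)%E \is a fin_num by exact: integrable_fin_num.
by move: F2; rewrite -{1}(fineK F1') => /fine_cvgP[_].
Qed.

Lemma measurable_halfline : measurable (@halfline R).
Proof. exact: measurable_itv. Qed.

Lemma halfline_gt0 (x : R) : D x -> 0 < x.
Proof. by rewrite /halfline /= in_itv /= andbT. Qed.

End RealIntegral.
Arguments measurable_halfline {R}.

(** * Iterated integrals over a triangle *)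

Section Triangle.
Variable R : realType.
Local Notation T := (measurableTypeR R).
Implicit Types (u v w z : R -> R) (E : set R).

(** Stated on [measurableTypeR R], the type on which the product measure and
    Fubini's theorem find their measurable structure. *)
Lemma intble_prod (w z : T -> R) : intble setT w -> intble setT z ->
  (leb \x leb)%E.-integrable setT (fun p : T * T => (w p.1 * z p.2)%:E).
Proof.
move=> iw iz.
have mw : measurable_fun setT w := intble_meas iw.
have mz : measurable_fun setT z := intble_meas iz.
have mwz : measurable_fun setT (fun p : T * T => (w p.1 * z p.2)%:E).
  apply/measurable_EFinP; apply: measurable_funM.
    exact: (measurableT_comp mw).
  exact: (measurableT_comp mz).
apply/(integrable12ltyP leb leb mwz) => /=.
have zfin : (\int[leb]_y `|(z y)%:E| < +oo)%E by case/integrableP: iz.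
under eq_integral => x _.
  under eq_integral => y _ do rewrite normrM EFinM.
  rewrite ge0_integralZl//; last first.
    by apply/measurable_EFinP; exact: measurableT_comp.
  over.
rewrite ge0_integralZr//; last first.
- exact: integral_ge0.
- by apply/measurable_EFinP; exact: measurableT_comp.
by apply: lte_mul_pinfty => //; [exact: integral_ge0|
  rewrite ge0_fin_numE//; [case/integrableP: iw|exact: integral_ge0]].
Qed.

Lemma measurable_bool_real d (U : measurableType d) (b : U -> bool) :
  measurable_fun setT b -> measurable_fun setT (fun x => (b x)%:R : R).
Proof.
move=> mb; have -> : (fun x => (b x)%:R : R) = (fun x => if b x then 1 else 0).
  by apply/funext => x; case: (b x).
exact: measurable_fun_ifT.
Qed.

Lemma integral_restrict_bool (E I : set T) (b : T -> bool) (z : T -> R) (c : R) :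
  measurable E -> measurable I -> measurable_fun setT b ->
  (forall y, (y \in I) = (y \in E) && b y) -> intble E z ->
  (\int[leb]_y (c * (z \_ E) y * (b y)%:R)%:E = (c * \int[leb]_(y in I) z y)%:E)%E.
Proof.
move=> mE mI mb Iy iE.
have IE : I `<=` E by move=> y /mem_set; rewrite Iy => /andP[/set_mem].
have iI : intble I z := intbleS mE mI IE iE.
have iZ := intble_restrict mE iE.
under eq_integral do rewrite -mulrA EFinM.
rewrite integralZl//; last first.
  apply: (le_integrable _ _ _ iZ) => //.
    apply/measurable_EFinP; apply: measurable_funM; first exact: intble_meas iZ.
    exact: measurable_bool_real.
  move=> y _; rewrite lee_fin normrM ler_piMr//.
  by case: (b y); rewrite ?normr1 ?normr0.
rewrite EFinM; congr (_ * _)%E.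
rewrite /Rintegral fineK; last exact: integrable_fin_num.
rewrite [RHS]integral_mkcond; apply: eq_integral => y _ /=.
by rewrite !patchE Iy; case: (y \in E) (b y) => [] []; rewrite /= ?mulr1 ?mulr0.
Qed.

(** Fubini's theorem on the triangle s <= y <= x <= r; it is the integration by
    parts formula for the two primitives of w and z. *)
Lemma Rintegral_triangle s r w z : intble `[s, r] w -> intble `[s, r] z ->
  \int[leb]_(x in `[s, r]) (w x * \int[leb]_(y in `[s, x]) z y)
  = \int[leb]_(y in `[s, r]) ((\int[leb]_(x in `[y, r]) w x) * z y).
Proof.
move=> iw iz.
pose E : set R := `[s, r]%classic.
pose W : T -> R := w \_ E; pose Z : T -> R := z \_ E.
have mE : measurable E by exact: measurable_itv.
have iW : intble setT W by exact: intble_restrict.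
have iZ : intble setT Z by exact: intble_restrict.
pose h := fun p : T * T => (W p.1 * Z p.2 * (p.2 <= p.1)%R%:R)%:E.
have ih : (leb \x leb)%E.-integrable setT h.
  apply: (le_integrable _ _ _ (intble_prod iW iZ)) => //.
    apply/measurable_EFinP; apply: measurable_funM.
      apply: measurable_funM.
        exact: (measurableT_comp (intble_meas iW)).
      exact: (measurableT_comp (intble_meas iZ)).
    apply: measurable_bool_real; exact: measurable_fun_ler.
  move=> p _; rewrite lee_fin normrM ler_piMr//.
  by case: (p.2 <= p.1); rewrite ?normr1 ?normr0.
have := Fubini ih; rewrite /h /=.
have F1 (x : T) : (\int[leb]_y (W x * Z y * (y <= x)%R%:R)%:E
    = (W x * \int[leb]_(y in `[s, x]) z y)%:E)%E.
  have [xE|xE] := boolP (x \in E); last first.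
    rewrite /W patchE (negbTE xE) mul0r.
    by under eq_integral do rewrite !mul0r; rewrite integral0.
  have xE' : s <= x <= r by move: xE; rewrite inE /E /= in_itv.
  apply: integral_restrict_bool => //.
    exact: measurable_fun_ler.
  by move=> y; rewrite !mem_setE !in_itv /=; apply/idP/idP; lra.
have F2 (y : T) : (\int[leb]_x (W x * Z y * (y <= x)%R%:R)%:E
    = ((\int[leb]_(x in `[y, r]) w x) * Z y)%:E)%E.
  have [yE|yE] := boolP (y \in E); last first.
    rewrite /Z patchE (negbTE yE) mulr0.
    by under eq_integral do rewrite mulr0 mul0r; rewrite integral0.
  have yE' : s <= y <= r by move: yE; rewrite inE /E /= in_itv.
  rewrite mulrC; under eq_integral do rewrite (mulrC (W _)).
  apply: integral_restrict_bool => //.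
    exact: measurable_fun_ler.
  by move=> x; rewrite !mem_setE !in_itv /=; apply/idP/idP; lra.
under eq_integral do rewrite F1.
under [in RHS]eq_integral do rewrite F2.
move=> H.
rewrite [LHS]/Rintegral [RHS]/Rintegral; congr fine.
rewrite [LHS]integral_mkcond [RHS]integral_mkcond.
transitivity (\int[leb]_x (W x * \int[leb]_(y in `[s, x]) z y)%:E)%E; last first.
  rewrite H; apply: eq_integral => y _; rewrite /Z !patchE.
  by case: ifP => //; rewrite mulr0.
apply: eq_integral => y _; rewrite /W !patchE.
by case: ifP => //; rewrite mul0r.
Qed.

End Triangle.

(** * Indefinite integrals *)

Section IndefiniteIntegral.
Variable R : realType.
Implicit Types (u v w z : R -> R) (E : set R).

(** Local absolute continuity on the open half-line: u is the indefinite
    integral of w there. Nothing is asked near 0, where w may fail to be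
    integrable. *)
Definition has_density u w : Prop := forall s r : R, 0 < s -> s <= r ->
  intble `[s, r] w /\ u r = u s + \int[leb]_(x in `[s, r]) w x.

Lemma Rintegral_itv_split u a b c : a <= b <= c -> intble `[a, c] u ->
  \int[leb]_(x in `[a, c]) u x =
  \int[leb]_(x in `[a, b]) u x + \int[leb]_(x in `[b, c]) u x.
Proof.
move=> /andP[ab bc] iu.
rewrite -[X in _ + X]Rintegral_itv_obnd_cbnd; last first.
  apply: (@integrableS _ _ _ leb `[a, c]%classic) => //.
  by move=> x /=; rewrite !in_itv /=; lra.
rewrite -(Rintegral_itvB iu) ?bnd_simp//.
by rewrite addrC subrK.
Qed.

Lemma has_density_continuous u w : has_density u w ->
  forall x, 0 < x -> {for x, continuous u}.
Proof.
move=> uw x x0.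
have x20 : 0 < x / 2 by rewrite divr_gt0.
have [iw _] := uw (x / 2) (2 * x) x20 ltac:(lra).
have /= C := @parameterized_integral_continuous _ (x/2) (2*x) w ltac:(lra) iw.
have C' : {within `[x / 2, 2 * x], continuous u}.
  apply: (@subspace_eq_continuous _ _ _ (fun y => u (x / 2) + parameterized_integral leb (x/2) y w)).
    move=> y /set_mem /=; rewrite in_itv /= => /andP[y1 y2].
    have [_ uy] := uw (x / 2) y x20 y1; exact: esym uy.
  by move=> y; apply: cvgD; [exact: cvg_cst|exact: C].
have x2x : x / 2 < 2 * x by lra.
move/(continuous_within_itvP u x2x) : C' => [C' _ _].
by apply: C'; rewrite in_itv /=; lra.
Qed.

Lemma has_density_measurable u w E : measurable E -> E `<=` @halfline R ->
  has_density u w -> measurable_fun E u.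
Proof.
move=> mE ED uw; apply: (@measurable_funS _ _ _ _ (@halfline R)) => //.
  exact: measurable_itv.
apply: open_continuous_measurable_fun; first exact: interval_open.
move=> x /set_mem; rewrite /halfline /= in_itv /= andbT.
exact: has_density_continuous uw x.
Qed.

Lemma itv_halfline (s r : R) : 0 < s -> `[s, r]%classic `<=` @halfline R.
Proof. by move=> s0 x /=; rewrite /halfline /= !in_itv /=; lra. Qed.

Lemma has_density_bounded u w s r : has_density u w -> 0 < s -> s <= r ->
  exists c, forall x, `[s, r]%classic x -> `|u x| <= c.
Proof.
move=> uw s0 sr; have [iw _] := uw s r s0 sr.
have inw : intble `[s, r] (fun x => `|w x|) by exact: (@integrable_norm _ _ _ leb).
exists (`|u s| + \int[leb]_(x in `[s, r]) `|w x|) => x /=.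
rewrite in_itv /= => /andP[sx xr].
have [iw' ->] := uw s x s0 sx.
apply: (le_trans (ler_normD _ _)); rewrite lerD2l.
apply: (le_trans (le_normr_Rintegral _ iw')) => //.
rewrite [leRHS](@Rintegral_itv_split _ s x r) ?sx ?xr// lerDl.
by apply: Rintegral_ge0.
Qed.

(** Both factors are expanded as initial value plus primitive. What remains is
    that the integrals of w Z and of W z add up to W(r) Z(r), where W and Z are
    the primitives from s; this is [Rintegral_triangle]. *)
Lemma has_densityM u v w z : has_density u w -> has_density v z ->
  has_density (fun x => u x * v x) (fun x => w x * v x + u x * z x).
Proof.
move=> uw vz s r s0 sr.
have [iw ur] := uw s r s0 sr.
have [iz vr] := vz s r s0 sr.
have sub := @itv_halfline s r s0.
have mi : measurable (`[s, r]%classic : set R) by exact: measurable_itv.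
have mu := has_density_measurable mi sub uw.
have mv := has_density_measurable mi sub vz.
have [cu bu] := has_density_bounded uw s0 sr.
have [cv bv] := has_density_bounded vz s0 sr.
have iwv : intble `[s, r] (fun x => w x * v x).
  by apply: eq_intble (intble_bounded mi mv bv iw) => // x _; rewrite mulrC.
have iuz : intble `[s, r] (fun x => u x * z x) by exact: intble_bounded bu iz.
split; first exact: intbleD.
rewrite RintegralD//.
pose Z x := \int[leb]_(y in `[s, x]) z y.
pose W x := \int[leb]_(y in `[s, x]) w y.
have iwZ : intble `[s, r] (fun x => w x * Z x).
  have := intbleB mi iwv (intbleZ (v s) mi iw).
  apply: eq_intble => // x /=; rewrite in_itv /= => /andP[sx xr].
  by have [_ ->] := vz s x s0 sx; rewrite /Z; ring.
have iWz : intble `[s, r] (fun x => W x * z x).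
  have := intbleB mi iuz (intbleZ (u s) mi iz).
  apply: eq_intble => // x /=; rewrite in_itv /= => /andP[sx xr].
  by have [_ ->] := uw s x s0 sx; rewrite /W; ring.
have -> : \int[leb]_(x in `[s, r]) (w x * v x) =
    v s * W r + \int[leb]_(x in `[s, r]) (w x * Z x).
  rewrite /W -RintegralZl// -RintegralD//; last exact: intbleZ.
  apply: eq_Rintegral => x /set_mem /=; rewrite in_itv /= => /andP[sx xr].
  by have [_ ->] := vz s x s0 sx; rewrite /Z; ring.
have -> : \int[leb]_(x in `[s, r]) (u x * z x) =
    u s * Z r + \int[leb]_(x in `[s, r]) (W x * z x).
  rewrite /Z -RintegralZl// -RintegralD//; last exact: intbleZ.
  apply: eq_Rintegral => x /set_mem /=; rewrite in_itv /= => /andP[sx xr].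
  by have [_ ->] := uw s x s0 sx; rewrite /W; ring.
(* After the triangle formula, the inner integral over [x, r] is W r - W x. *)
have -> : \int[leb]_(x in `[s, r]) (w x * Z x) = W r * Z r - \int[leb]_(x in `[s, r]) (W x * z x).
  rewrite Rintegral_triangle//.
  rewrite -[W r * Z r]RintegralZl// -RintegralB//; last exact: intbleZ.
  apply: eq_Rintegral => x /set_mem /=; rewrite in_itv /= => /andP[sx xr].
  by rewrite /W (@Rintegral_itv_split _ s x r) ?sx ?xr//; ring.
by rewrite ur vr -/(W r) -/(Z r); ring.
Qed.

Lemma has_densityD u v w z : has_density u w -> has_density v z ->
  has_density (fun x => u x + v x) (fun x => w x + z x).
Proof.
move=> uw vz s r s0 sr.
have [iw ->] := uw s r s0 sr; have [iz ->] := vz s r s0 sr.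
by split; [exact: intbleD|rewrite RintegralD//; ring].
Qed.

Lemma has_density_cst (c : R) : has_density (fun=> c) (fun=> 0).
Proof.
move=> s r s0 sr; split; last by rewrite Rintegral_cst//; ring.
exact: (@integrable0 _ _ _ leb).
Qed.

Lemma has_densityZ (c : R) u w : has_density u w ->
  has_density (fun x => c * u x) (fun x => c * w x).
Proof.
move=> uw; have := has_densityM (has_density_cst c) uw.
by congr has_density; apply/funext => x; rewrite mul0r add0r.
Qed.

Lemma has_density_derive u w :
  (forall x : R, 0 < x -> is_derive x 1 u (w x)) ->
  (forall x : R, 0 < x -> {for x, continuous w}) -> has_density u w.
Proof.
move=> du cw s r s0 sr.
have cu x : 0 < x -> {for x, continuous u}.
  move=> x0; have [dux _] := du x x0.
  exact/differentiable_continuous/derivable1_diffP.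
have cwi : {within `[s, r], continuous w}.
  apply: continuous_in_subspaceT => x /set_mem /=; rewrite in_itv /= => /andP[sx _].
  by apply: cw; lra.
have iw : intble `[s, r] w.
  by apply: continuous_compact_integrable => //; exact: segment_compact.
split => //.
move: sr; rewrite le_eqVlt => /predU1P[->|sr].
  by rewrite set_itv1 Rintegral_set1 addr0.
rewrite /Rintegral (@continuous_FTC2 _ w u s r sr cwi) /=.
- by ring.
- split.
  + by move=> x; rewrite in_itv /= => /andP[sx _]; case: (du x ltac:(lra)).
  + by apply: cvg_at_right_filter; apply: cu.
  + by apply: cvg_at_left_filter; apply: cu; lra.
- move=> x; rewrite in_itv /= => /andP[sx _].
  by rewrite derive1E; case: (du x ltac:(lra)).
Qed.

End IndefiniteIntegral.

(** * Smooth functions *)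

Section Smooth.
Variable R : realType.
Implicit Types (u v w z : R -> R) (E : set R).

(** Smoothness by coinduction: a class of differentiable functions that is
    closed under derivation consists of smooth functions. *)
Lemma smooth_class (C : (R -> R) -> Prop) :
  (forall u, C u -> (forall x : R, derivable u x 1) /\ C (derive1 u)) ->
  forall u, C u -> smooth u.
Proof.
move=> H u Cu n; have : C (derive1n n u).
  by elim: n => [//|n IH]; rewrite derive1nS; apply: (H _ IH).2.
by move=> /H[].
Qed.

Lemma smooth_derivable u : smooth u -> forall x : R, derivable u x 1.
Proof. by move=> su; exact: (su 0%N). Qed.

Lemma smooth_derive1 u : smooth u -> smooth (derive1 u).
Proof.
move=> su n x; have := su n.+1 x.
by rewrite /derive1n iterSr.
Qed.

Lemma smooth_is_derive u : smooth u -> forall x : R, is_derive x 1 u (derive1 u x).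
Proof. by move=> su x; rewrite derive1E; apply: derivableP; exact: smooth_derivable. Qed.

Lemma smooth_continuous u : smooth u -> continuous u.
Proof.
move=> su x; apply/differentiable_continuous/derivable1_diffP.
exact: smooth_derivable.
Qed.

Lemma smooth_step u w : (forall x : R, is_derive x 1 u (w x)) -> smooth w -> smooth u.
Proof.
move=> du sw; have u1 : derive1 u = w.
  by apply/funext => x; rewrite derive1E; case: (du x).
case=> [|n] x; first by case: (du x).
by rewrite /derive1n iterSr u1; exact: sw.
Qed.

Lemma smooth_linear (a : R) u v : smooth u -> smooth v ->
  smooth (fun x => a * u x + v x).
Proof.
move=> su sv.
apply: (@smooth_class (fun f => exists u v, [/\ smooth u, smooth v & f = (fun x => a * u x + v x)])); last by exists u, v.
move=> _ [{}u [{}v [{}su {}sv ->]]].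
have D (x : R) : is_derive x 1 (fun x : R => a * u x + v x) (a * derive1 u x + derive1 v x).
  have := smooth_is_derive su x; have := smooth_is_derive sv x => ? ?.
  exact: is_deriveD.
split; first by move=> x; case: (D x).
exists (derive1 u), (derive1 v); split; [exact: smooth_derive1|exact: smooth_derive1|].
by apply/funext => x; rewrite derive1E; case: (D x).
Qed.

Lemma smooth_cst (c : R) : smooth (fun=> c).
Proof.
apply: (@smooth_class (fun f => exists c : R, f = fun=> c)); last by exists c.
move=> _ [{}c ->]; split; first by move=> x; exact: derivable_cst.
by exists 0; apply/funext => x; rewrite derive1_cst.
Qed.

Lemma smooth_affine (a b : R) u : smooth u -> smooth (fun x => u (a * x + b)).
Proof.
move=> su.
apply: (@smooth_class (fun f => exists c u, smooth u /\ f = (fun x => c * u (a * x + b)))); last first.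
  by exists 1, u; split => //; apply/funext => x; rewrite mul1r.
move=> _ [c [{}u [{}su ->]]].
have D (x : R) : is_derive x 1 (fun x : R => c * u (a * x + b)) (c * a * derive1 u (a * x + b)).
  have D1 : is_derive x 1 (fun x : R => a * x + b) a.
    have -> : (fun x : R => a * x + b) = (a \*: (@id R)) + cst b by [].
    by apply: is_derive_eq; rewrite addr0 /GRing.scale /= mulr1.
  have D2 := @is_derive1_comp _ u (fun x : R => a * x + b) x _ _ (smooth_is_derive su (a * x + b)) D1.
  have D3 : is_derive x 1 (c \*: (u \o (fun x : R => a * x + b))) (c *: (a * derive1 u (a * x + b))).
    by apply: is_deriveZ; rewrite mulrC.
  by apply: (is_derive_eq D3); rewrite /GRing.scale /=; ring.
split; first by move=> x; case: (D x).
exists (c * a), (derive1 u); split; first exact: smooth_derive1.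
by apply/funext => x; rewrite derive1E; case: (D x).
Qed.

(** Products of smooth functions are not closed under derivation, but by
    Leibniz's rule their finite sums are. *)
Inductive smooth_alg : (R -> R) -> Prop :=
| SmoothMul u v : smooth u -> smooth v -> smooth_alg (fun x => u x * v x)
| SmoothAdd u v : smooth_alg u -> smooth_alg v -> smooth_alg (fun x => u x + v x).

Lemma smoothM u v : smooth u -> smooth v -> smooth (fun x => u x * v x).
Proof.
move=> su sv; apply: (@smooth_class smooth_alg); last exact: SmoothMul.
move=> {su sv u v} f sf.
suff [f' [sf' D]] : exists f', smooth_alg f' /\ forall x : R, is_derive x 1 f (f' x).
  split; first by move=> x; case: (D x).
  have -> // : derive1 f = f'.
  by apply/funext => x; rewrite derive1E; case: (D x).
elim: sf => [u v su sv|u v su [u' [su' Du]] sv [v' [sv' Dv]]].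
  exists (fun x => u x * derive1 v x + derive1 u x * v x); split.
    by apply: SmoothAdd; apply: SmoothMul => //; exact: smooth_derive1.
  move=> x; have := smooth_is_derive su x; have := smooth_is_derive sv x => ? ?.
  apply: is_derive_eq.
  by rewrite /GRing.scale /=; ring.
exists (fun x => u' x + v' x); split; first exact: SmoothAdd.
move=> x; have := Du x; have := Dv x => ? ?.
exact: is_deriveD.
Qed.

(** The growth estimate behind the smoothness of exp(-1/x) at 0. In the induction
    on the degree, half of the rate a bounds the polynomial of lower degree and
    the other half absorbs one factor t. *)
Lemma poly_expR_le (p : {poly R}) (a : R) : 0 < a ->
  exists c, 0 <= c /\ forall t, 0 <= t -> `|p.[t]| <= c * expR (a * t).
Proof.
elim/poly_ind: p a => [|p d IH] a a0.
  by exists 0; split => // t t0; rewrite horner0 normr0 mul0r.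
have a20 : 0 < a / 2 by rewrite divr_gt0.
have [c [c0 H]] := IH _ a20.
exists (2 / a * c + `|d|); split.
  by rewrite addr_ge0// mulr_ge0// divr_ge0// ltW.
move=> t t0; rewrite hornerMXaddC.
apply: (le_trans (ler_normD _ _)); rewrite mulrDl lerD//; last first.
  by rewrite ler_peMr// -expR0 ler_expR mulr_ge0// ltW.
rewrite normrM (ger0_norm t0).
have -> : a * t = a / 2 * t + a / 2 * t by field.
rewrite expRD.
have tb : t <= 2 / a * expR (a / 2 * t).
  rewrite -ler_pdivrMl ?divr_gt0// invf_div.
  by apply: le_trans (expR_ge1Dx _); rewrite lerDr.
rewrite (_ : 2 / a * c * _ = (c * expR (a / 2 * t)) * (2 / a * expR (a / 2 * t))); last by ring.
by apply: ler_pM => //; exact: H.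
Qed.

(** The functions p(1/x) exp(-1/x) extended by 0. Polynomials are allowed as
    coefficients because the family is then closed under derivation, which
    gives the smoothness of all its members at once. *)
Definition flat (p : {poly R}) (x : R) : R :=
  if 0 < x then p.[x^-1] * expR (- x^-1) else 0.

(** This is used for X p in place of p, and then bounds the difference quotient
    of [flat p] at 0. *)
Lemma flat_le (p : {poly R}) : exists c, 0 <= c /\ forall x, `|flat p x| <= c * `|x|.
Proof.
have [c [c0 H]] := @poly_expR_le p (2^-1) ltac:(by rewrite invr_gt0).
exists (2 * c); split; first by rewrite mulr_ge0.
move=> x; rewrite /flat; case: ifPn => x0; last by rewrite normr0 !mulr_ge0.
rewrite normrM (ger0_norm (expR_ge0 _)) (gtr0_norm x0).
have t0 : 0 < x^-1 by rewrite invr_gt0.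
have Hx := H _ (ltW t0).
have -> : expR (- x^-1) = expR (- (2^-1 * x^-1)) * expR (- (2^-1 * x^-1)).
  by rewrite -expRD; congr expR; field; rewrite gt_eqF.
set e := expR (- (2^-1 * x^-1)).
have e0 : 0 <= e by exact: expR_ge0.
have H1 : `|p.[x^-1]| * e <= c.
  rewrite -ler_pdivlMr ?expR_gt0//; apply: (le_trans Hx).
  by rewrite /e expRN invrK.
have H2 : e <= 2 * x.
  rewrite /e expRN -[leRHS]invrK lef_pV2 ?posrE ?expR_gt0 ?invr_gt0 ?mulr_gt0//.
  apply: le_trans (expR_ge1Dx _).
  by rewrite invfM lerDr.
rewrite [leLHS](_ : _ = (`|p.[x^-1]| * e) * e); last by ring.
rewrite [leRHS](_ : _ = c * (2 * x)); last by ring.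
by apply: ler_pM => //; apply: mulr_ge0.
Qed.

Lemma is_derive_flat (p : {poly R}) (x : R) :
  is_derive x 1 (flat p) (flat ('X ^+ 2 * (p - deriv p)) x).
Proof.
have [x0|x0|->] := ltgtP x 0.
- rewrite [X in is_derive _ _ _ X]/flat ltNge (ltW x0) /=.
  apply: (@near_eq_is_derive R R^o R^o (cst (0 : R))).
  near=> y; rewrite /flat ltNge (_ : y <= 0)//.
  by apply/ltW; near: y; exact: lt_nbhsl.
- rewrite [X in is_derive _ _ _ X]/flat x0.
  apply: (@near_eq_is_derive R R^o R^o (fun y : R => p.[y^-1] * expR (- y^-1))).
    near=> y; rewrite /flat (_ : 0 < y)//.
    by near: y; exact: lt_nbhsr.
  have xn0 : (id x : R) != 0 by rewrite /= gt_eqF.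
  have D1 := is_deriveV xn0 (is_derive_id (x : R^o) (1 : R^o)).
  have D2 := @is_derive1_comp _ (horner p) _ x _ _ (is_derive_poly p x^-1) D1.
  have D3 := is_deriveN D1.
  have D4 := @is_derive1_comp _ expR _ x _ _ (is_derive_expR (- x^-1)) D3.
  have D5 := is_deriveM D2 D4.
  apply: (is_derive_eq D5); rewrite /GRing.scale /= /comp !hornerE /=.
  by rewrite -exprVn; ring.
- rewrite [X in is_derive _ _ _ X]/flat ltxx.
  suff H : h^-1 *: ((flat p \o shift (0 : R)) (h *: (1 : R)) - flat p 0) @[h --> (0 : R)^'] --> (0 : R).
    by apply: DeriveDef; [apply/cvg_ex; exists 0|apply/cvg_lim].
  have [c [c0 H]] := flat_le ('X * p).
  apply/cvgr0Pnorm_le => e e0.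
  near=> h.
  have h0 : h != 0 by near: h; exact: nbhs_dnbhs_neq.
  rewrite /= /GRing.scale /= mulr1 addr0 {2}/flat ltxx subr0.
  have -> : h^-1 * flat p h = flat ('X * p) h.
    by rewrite /flat; case: ifP => _; [rewrite hornerM hornerX mulrA|rewrite mulr0].
  apply: (le_trans (H h)).
  have : `|h| <= e / (c + 1).
    by near: h; apply: dnbhs0_le; rewrite divr_gt0// ltr_wpDl.
  rewrite ler_pdivlMr ?ltr_wpDl//; apply: le_trans.
  by rewrite mulrC ler_wpM2l// lerDl.
Unshelve. all: by end_near. Qed.

End Smooth.

(** * A smooth bump and a smooth step *)

Section Bump.
Variable R : realType.
Implicit Types (u v w z : R -> R) (E : set R).

Lemma smooth_flat (p : {poly R}) : smooth (flat p).
Proof.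
apply: (@smooth_class _ (fun f => exists p, f = flat p)); last by exists p.
move=> _ [{}p ->]; split; first by move=> x; case: (is_derive_flat p x).
exists ('X ^+ 2 * (p - deriv p)); apply/funext => x.
by rewrite derive1E; case: (is_derive_flat p x).
Qed.

(** A smooth function supported in [0, 1], the product of exp(-1/x) and its
    reflection. Its integral [bump_mass] is kept as a constant instead of being
    normalised. *)
Definition bumpf (x : R) : R := flat 1 x * flat 1 (- 1 * x + 1).

Lemma smooth_bump : smooth bumpf.
Proof. by apply: smoothM; [|apply: smooth_affine]; exact: smooth_flat. Qed.

Lemma flat1_ge0 (x : R) : 0 <= flat 1 x.
Proof. by rewrite /flat; case: ifP => // _; rewrite hornerC mul1r expR_ge0. Qed.

Lemma flat1_le1 (x : R) : flat 1 x <= 1.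
Proof.
rewrite /flat; case: ifP => // x0; rewrite hornerC mul1r -expR0 ler_expR.
by rewrite oppr_le0 invr_ge0 ltW.
Qed.

Lemma bump_ge0 (x : R) : 0 <= bumpf x.
Proof. by rewrite mulr_ge0// flat1_ge0. Qed.

Lemma bump_le1 (x : R) : bumpf x <= 1.
Proof. by rewrite mulr_ile1// ?flat1_ge0 ?flat1_le1. Qed.

Lemma bump_out (x : R) : x \notin `]0, 1[ -> bumpf x = 0.
Proof.
rewrite in_itv /= /bumpf /flat mulN1r addrC subr_gt0.
by case: (0 < x) => /=; [case: (x < 1) => //= _; rewrite mulr0|rewrite mul0r].
Qed.

Lemma bump_continuous : continuous bumpf.
Proof. exact: smooth_continuous smooth_bump. Qed.

Lemma bump_measurable E : measurable_fun E bumpf.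
Proof. by apply: measurable_funTS; apply: continuous_measurable_fun; exact: bump_continuous. Qed.

Lemma bump_intble E : measurable E -> intble E bumpf.
Proof.
move=> mE; apply: (@integrableS _ _ _ leb setT) => //.
apply: (@intble_le _ _ _ (\1_`[0, 1])) => //.
- exact: bump_measurable.
- move=> x _; rewrite ger0_norm ?bump_ge0// indicE mem_setE.
  case: (boolP (x \in `[0, 1])) => /= x01; first exact: bump_le1.
  rewrite bump_out//; apply: contra x01.
  by rewrite !in_itv /= => /andP[/ltW -> /ltW ->].
- exact: integrable_indic_itv.
Qed.

Definition bump_mass : R := \int[leb]_(x in `[0, 1]) bumpf x.

Lemma bump_mass_gt0 : 0 < bump_mass.
Proof.
have i1 : intble (`[0, 1]%classic : set R) bumpf by apply: bump_intble; exact: measurable_itv.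
have i2 : intble (`[1/4, 1]%classic : set R) bumpf by apply: bump_intble; exact: measurable_itv.
rewrite /bump_mass (@Rintegral_itv_split _ bumpf 0 (1/4) 1)//; last by lra.
rewrite (@Rintegral_itv_split _ bumpf (1/4) (3/4) 1)//; last by lra.
suff H : 0 < \int[leb]_(x in `[1/4, 3/4]) bumpf x.
  have H1 : 0 <= \int[leb]_(x in `[(0:R), 1/4]) bumpf x by apply: Rintegral_ge0 => x _; exact: bump_ge0.
  have H2 : 0 <= \int[leb]_(x in `[(3/4:R), 1]) bumpf x by apply: Rintegral_ge0 => x _; exact: bump_ge0.
  by rewrite ltr_wpDl// ltr_wpDr.
(* On [1/4, 3/4] both x and 1 - x are at least 1/4. *)
pose d : R := expR (-4) * expR (-4).
have d0 : 0 < d by rewrite mulr_gt0// expR_gt0.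
apply: (@lt_le_trans _ _ (\int[leb]_(x in `[(1/4:R), 3/4]) d)).
  by rewrite Rintegral_cst_itv ?mulr_gt0//; lra.
have mI : measurable (`[1/4, 3/4]%classic : set R) by exact: measurable_itv.
apply: le_Rintegral => //.
- exact: intble_cst_itv.
- exact: bump_intble.
- move=> x /=; rewrite in_itv /= => /andP[x1 x2].
  rewrite /bumpf /flat (_ : 0 < x); last by lra.
  rewrite (_ : 0 < -1 * x + 1); last by lra.
  rewrite !hornerC !mul1r /d ler_pM ?expR_ge0// ler_expR lerN2.
    rewrite -[leRHS]invrK lef_pV2 ?posrE ?invr_gt0//; lra.
  rewrite -[leRHS]invrK lef_pV2 ?posrE ?invr_gt0//; lra.
Qed.

(** The smooth step from 0 to [bump_mass]. Differences of two rescaled steps are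
    test functions whose derivatives are differences of rescaled bumps. *)
Definition stepf (x : R) : R := \int[leb]_(t in `]-oo, x]) bumpf t.

Lemma is_derive_step (x : R) : is_derive x 1 stepf (bumpf x).
Proof.
have x1 : x < x + 1 by lra.
have i : intble (`]-oo, (x + 1)]%classic : set R) bumpf by apply: bump_intble; exact: measurable_itv.
have [D1 D2] := continuous_FTC1 x1 i (ltNyr x) (@bump_continuous x).
have D1' : derivable stepf x 1 := D1.
have D2' : derive1 stepf x = bumpf x := D2.
by rewrite -D2' derive1E; apply: derivableP.
Qed.

Lemma smooth_step_fun : smooth stepf.
Proof. exact: smooth_step is_derive_step smooth_bump. Qed.

Lemma step_le0 (x : R) : x <= 0 -> stepf x = 0.
Proof.
move=> x0; rewrite /stepf (@eq_Rintegral _ _ _ _ _ (fun=> 0)).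
  by rewrite Rintegral_cst ?mul0r.
move=> t; rewrite inE /= in_itv /= => tx; apply: bump_out.
by rewrite in_itv /= ltNge (le_trans tx).
Qed.

Lemma step_ge1 (x : R) : 1 <= x -> stepf x = bump_mass.
Proof.
move=> x1; rewrite /stepf /bump_mass Rintegral_mkcond [RHS]Rintegral_mkcond.
congr Rintegral; apply/funext => t; rewrite !patchE !mem_setE !in_itv /=.
case: ifPn => tx; case: ifPn => t01 //.
  by apply: bump_out; apply: contra t01; rewrite in_itv /= => /andP[/ltW -> /ltW ->].
by move: tx t01; lra.
Qed.

Lemma step_bound (x : R) : 0 <= stepf x <= bump_mass.
Proof.
apply/andP; split; first by apply: Rintegral_ge0 => t _; exact: bump_ge0.
rewrite /stepf /bump_mass Rintegral_mkcond [leRHS]Rintegral_mkcond.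
apply: le_Rintegral => //.
- have mI : measurable (`]-oo, x]%classic : set R) by exact: measurable_itv.
  exact: (intble_restrict mI (bump_intble mI)).
- have mI : measurable (`[0, 1]%classic : set R) by exact: measurable_itv.
  exact: (intble_restrict mI (bump_intble mI)).
- move=> t _; rewrite !patchE !mem_setE !in_itv /=.
  case: ifPn => tx; case: ifPn => t01 //; last by exact: bump_ge0.
  rewrite bump_out//; apply: contra t01.
  by rewrite in_itv /= => /andP[/ltW -> /ltW ->].
Qed.

End Bump.

(** * Mollification at Lebesgue points *)

Section Mollify.
Variable R : realType.
Implicit Types (u v w z : R -> R) (E : set R).

Lemma is_derive_step_affine (N x y : R) :
  is_derive y 1 (fun y : R => stepf (N * (y - x))) (N * bumpf (N * (y - x))).
Proof.
have D0 : is_derive y 1 (fun y : R => y - x) 1.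
  by apply: is_derive_eq; rewrite subr0.
have D1 : is_derive y 1 (fun y : R => N * (y - x) : R) (N : R).
  by apply: (is_derive_eq (is_deriveZ N D0)); rewrite /GRing.scale /= mulr1.
have := @is_derive1_comp _ (@stepf R) (fun y : R => N * (y - x)) y _ _ (is_derive_step _) D1.
by rewrite mulrC.
Qed.

Lemma smooth_bumpf_affine (N x : R) : smooth (fun y => N * bumpf (N * (y - x))).
Proof.
rewrite (_ : (fun y => _) = (fun y => N * bumpf (N * y + - (N * x)) + 0)).
  apply: smooth_linear; last exact: smooth_cst.
  by apply: smooth_affine; exact: smooth_bump.
by apply/funext => y; rewrite mulrBr addr0.
Qed.

Lemma has_density_step (N x : R) :
  has_density (fun y : R => stepf (N * (y - x))) (fun y => N * bumpf (N * (y - x))).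
Proof.
apply: has_density_derive => y _; first exact: is_derive_step_affine.
apply: smooth_continuous; exact: smooth_bumpf_affine.
Qed.

Lemma Rintegral_bumpf_mass (N x : R) : 0 < N -> 0 < x ->
  intble `[x, x + N^-1] (fun y => N * bumpf (N * (y - x))) /\
  bump_mass R = \int[leb]_(y in `[x, x + N^-1]) (N * bumpf (N * (y - x))).
Proof.
move=> N0 x0; have xs : x <= x + N^-1 by rewrite lerDl invr_ge0 ltW.
have [ib] := @has_density_step N x x (x + N^-1) x0 xs.
by rewrite (addrC x) addrK divff ?gt_eqF// step_ge1// subrr mulr0 step_le0// add0r (addrC _ x).
Qed.

Lemma lebesgue_pt_le u x : lebesgue_pt u x -> forall e : R, 0 < e ->
  exists2 r0, 0 < r0 & forall r, 0 < r < r0 -> (davg u x r <= e%:E)%E.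
Proof.
move=> /fine_cvgP[/= H1 H2] e e0.
have H2' := cvgr0_norm_le _ H2 _ e0.
have [r0 /= r00 H] := filterI H1 (H2' _).
exists r0 => // r /andP[rp rr0].
have [|//|F L] := H r.
  by rewrite /ball_ /= sub0r normrN gtr0_norm.
rewrite -(fineK F) lee_fin; exact: le_trans (ler_norm _) L.
Qed.

(** The mollifier is supported on the right of x only. Its size is at most N on
    an interval of length 1/N, which lies in the ball of radius 2/N; the error is
    therefore at most 4 times the mean of |u - u(x)| over that ball. *)
Lemma mollify_lebesgue_pt u (x : R) : 0 < x -> locally_integrable [set: R] u ->
  lebesgue_pt u x -> forall e : R, 0 < e ->
  exists2 r0 : R, 0 < r0 & forall N : R, 0 < N -> N^-1 < r0 ->
    `|\int[leb]_(y in `[x, x + N^-1]) ((N * bumpf (N * (y - x))) * u y)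
      - bump_mass R * u x| <= e.
Proof.
move=> x0 lu lx e e0.
have e40 : 0 < e / 4 by rewrite divr_gt0.
have [r0 r00 H] := lebesgue_pt_le lx e40.
exists (r0 / 2); first by rewrite divr_gt0.
move=> N N0 Nr.
have Ni0 : 0 < N^-1 by rewrite invr_gt0.
have xs : x <= x + N^-1 by lra.
set I : set R := `[x, x + N^-1]%classic.
have mI : measurable I by exact: measurable_itv.
have [ib mb] := Rintegral_bumpf_mass N0 x0.
have iu : intble I u.
  case: lu => mu _ /(_ I) lu; apply/integrableP; split.
    by apply/measurable_EFinP; exact: measurable_funS mu.
  by apply: lu => //; exact: segment_compact.
have bb y : I y -> `|N * bumpf (N * (y - x))| <= N.
  move=> _; rewrite normrM gtr0_norm// ger0_norm ?bump_ge0// ler_piMr ?bump_le1//.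
  exact: ltW.
have mbu := intble_meas ib.
have ibu : intble I (fun y => (N * bumpf (N * (y - x))) * u y) by exact: intble_bounded bb iu.
rewrite mb mulrC -RintegralZl// -RintegralB//; last exact: intbleZ.
have id : intble I (fun y => u y - u x) by apply: intbleB => //; exact: intble_cst_itv.
have ibd : intble I (fun y => (N * bumpf (N * (y - x))) * (u y - u x)).
  exact: intble_bounded bb id.
have -> : \int[leb]_(y in I) ((N * bumpf (N * (y - x))) * u y - u x * (N * bumpf (N * (y - x))))
   = \int[leb]_(y in I) ((N * bumpf (N * (y - x))) * (u y - u x)).
  by apply: eq_Rintegral => y _; ring.
apply: (le_trans (normr_Rintegral_le mI ibd)).
have iad : intble I (fun y => `|u y - u x|) by exact: intble_norm.
apply: (@le_trans _ _ (N * \int[leb]_(y in I) `|u y - u x|)).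
  rewrite -RintegralZl//; apply: le_Rintegral => //.
  - exact: intble_norm.
  - exact: intbleZ.
  - by move=> y Iy; rewrite normrM ler_wpM2r// bb.
have /H : 0 < 2 * N^-1 < r0 by apply/andP; split; lra.
rewrite /davg /iavg lebesgue_measure_ball; last by lra.
set B := ball x _.
set J := (\int[leb]_(y in B) _)%E.
have IB : I `<=` B.
  move=> y; rewrite /I /B /= in_itv /= /ball /= => /andP[xy yx].
  by rewrite ltr_distlC; lra.
have IJ : (\int[leb]_(y in I) `|u y - u x|%:E <= J)%E.
  rewrite /J; apply: ge0_subset_integral => //.
  - exact: measurable_ball.
  - apply/measurable_EFinP; apply: measurableT_comp => //.
    apply: measurable_funB => //.
    by case: lu => mu _ _; exact: measurable_funS mu.
rewrite inver ifF; last by apply/negbTE; rewrite mulrn_eq0 /= gt_eqF//; lra.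
move=> Je.
have Jfin : J \is a fin_num.
  rewrite ge0_fin_numE; last exact: integral_ge0.
  apply: contraTT Je; rewrite -leNgt leye_eq -ltNge => /eqP ->.
  by rewrite gt0_muley ?ltry// lte_fin invr_gt0; lra.
have Je' : fine J <= e / 4 * (4 * N^-1).
  move: Je; rewrite -(fineK Jfin) -EFinM lee_fin ler_pdivrMl; last by lra.
  by move/le_trans; apply; lra.
have : \int[leb]_(y in I) `|u y - u x| <= fine J.
  rewrite /Rintegral fine_le//.
  by apply: integrable_fin_num.
move=> /le_trans /(_ Je').
rewrite -(ler_pM2l N0) => /le_trans; apply.
by rewrite [leLHS](_ : _ = e)//; field; rewrite gt_eqF.
Qed.

End Mollify.

(** * Square integrable real functions *)

Section SquareIntegrable.
Variable R : realType.
Implicit Types (u v w z : R -> R) (E : set R).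

Let mD := @measurable_halfline R.
Local Hint Resolve mD : core.

Definition sqint u : Prop := measurable_fun D u /\ intble D (fun x => u x ^+ 2).

Lemma sqintM u v : sqint u -> sqint v -> intble D (fun x => u x * v x).
Proof.
move=> [mu iu] [mv iv].
apply: (@intble_le _ _ _ (fun x => u x ^+ 2 + v x ^+ 2)) => //.
- exact: measurable_funM.
- move=> x _; rewrite normrM.
  have := sqr_ge0 (`|u x| - `|v x|).
  rewrite -(real_normK (num_real (u x))) -(real_normK (num_real (v x))).
  have := normr_ge0 (u x); have := normr_ge0 (v x); nra.
- exact: intbleD.
Qed.

Lemma sqint_le u v : measurable_fun D u -> (forall x, D x -> `|u x| <= `|v x|) ->
  sqint v -> sqint u.
Proof.
move=> mu uv [mv iv]; split => //.
apply: (@intble_le _ _ _ (fun x => v x ^+ 2)) => //.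
  exact: measurable_funX.
move=> x Dx; rewrite normrX -(real_normK (num_real (v x))).
by rewrite ler_pXn2r ?nnegrE// uv.
Qed.

Lemma sqintD u v : sqint u -> sqint v -> sqint (fun x => u x + v x).
Proof.
move=> su sv; have [[mu iu] [mv iv]] := (su, sv); split.
  exact: measurable_funD.
have := intbleD measurable_halfline (intbleD measurable_halfline iu iv)
  (intbleZ 2 measurable_halfline (sqintM su sv)).
by apply: eq_intble => // x _; ring.
Qed.

Lemma sqint_bounded u v (c : R) : measurable_fun D v ->
  (forall x, D x -> `|v x| <= c) -> sqint u -> sqint (fun x => v x * u x).
Proof.
move=> mv vc [mu iu]; split; first exact: measurable_funM.
have := @intble_bounded _ D _ (fun x => v x ^+ 2) (c ^+ 2) measurable_halfline _ _ iu.
move=> H; apply: eq_intble (H _ _) => //.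
- by move=> x _; rewrite exprMn.
- exact: measurable_funX.
- move=> x Dx; rewrite normrX ler_pXn2r ?nnegrE// ?vc//.
  by apply: le_trans (vc x Dx).
Qed.

Lemma sqintZ (c : R) u : sqint u -> sqint (fun x => c * u x).
Proof. by move=> su; apply: (@sqint_bounded _ _ `|c|). Qed.

Lemma sqintN u : sqint u -> sqint (fun x => - u x).
Proof.
move=> su; have := sqintZ (-1) su; congr sqint.
by apply/funext => x; rewrite mulN1r.
Qed.

Lemma sqintB u v : sqint u -> sqint v -> sqint (fun x => u x - v x).
Proof. by move=> su sv; apply: sqintD => //; exact: sqintN. Qed.

Lemma sqint0 : sqint (fun=> 0).
Proof.
split => //; rewrite (_ : (fun=> _) = fun=> 0); last by apply/funext => x; rewrite expr0n.
exact: (@integrable0 _ _ _ leb).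
Qed.

Lemma sqint_support u (a b c : R) : measurable_fun D u ->
  (forall x, D x -> `|u x| <= c) -> (forall x, D x -> u x != 0 -> a <= x <= b) -> sqint u.
Proof.
move=> mu uc us; split => //.
apply: (@intble_le _ _ _ (fun x => c ^+ 2 * (\1_`[a, b]%classic x))) => //.
- exact: measurable_funX.
- move=> x Dx; rewrite normrX indicE mem_setE in_itv /=.
  have [->|ux] := eqVneq (u x) 0.
    by rewrite normr0 expr0n /= mulr_ge0// sqr_ge0.
  rewrite us// mulr1 ler_pXn2r ?nnegrE// ?uc//.
  by apply: le_trans (uc x Dx).
- apply: intbleZ => //; apply: (@intbleS _ setT) => //.
  exact: integrable_indic_itv.
Qed.

Lemma sqint_ae u v : measurable_fun D v -> ae_eq leb D u v -> sqint u -> sqint v.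
Proof.
move=> mv uv [mu iu]; split => //; apply: (intble_ae mD _ _ iu).
  exact: measurable_funX.
by apply: filterS uv => x uv Dx; rewrite uv.
Qed.

(** On a bounded interval |u| <= 1 + u^2; the interval may start at 0. *)
Lemma sqint_intble_itv u s r : 0 <= s -> sqint u -> intble `]s, r] u.
Proof.
move=> s0 [mu iu].
have mI : measurable (`]s, r]%classic : set R) by exact: measurable_itv.
have ID : `]s, r]%classic `<=` D.
  by move=> x; rewrite /halfline /= !in_itv /= => /andP[sx _]; rewrite andbT; lra.
apply: (@intble_le _ _ _ (fun x => 1 + u x ^+ 2)) => //.
- exact: measurable_funS mu.
- move=> x _; have := sqr_ge0 (`|u x| - 1).
  rewrite -(real_normK (num_real (u x))).
  have := normr_ge0 (u x); nra.
- apply: intbleD => //; last exact: (intbleS _ _ ID iu).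
  apply: (@intbleS _ `[s, r]%classic) => //; last exact: intble_cst_itv.
  by move=> x /=; rewrite !in_itv /= => /andP[/ltW -> ->].
Qed.

Lemma ae_lebesgue_pt_sqint u : sqint u -> {ae leb, forall x, forall n : nat,
  lebesgue_pt (u \_ `]0, n%:R]) x}.
Proof.
move=> su; apply/ae_foralln => n.
apply: lebesgue_differentiation; apply: integrable_locally_restrict.
  exact: measurable_itv.
exact: sqint_intble_itv.
Qed.

End SquareIntegrable.

(** * Test functions against square integrable functions *)

Section TestFunctions.
Variable R : realType.
Implicit Types (u v w z phi : R -> R) (E : set R).

Definition rtest phi : Prop := smooth phi /\
  exists a b : R, 0 < a /\ forall x, phi x != 0 -> a <= x <= b.

Lemma smooth_stepf_affine (N x : R) : smooth (fun y => stepf (N * (y - x))).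
Proof.
rewrite (_ : (fun y => _) = (fun y => stepf (N * y + - (N * x)))).
  by apply: smooth_affine; exact: smooth_step_fun.
by apply/funext => y; rewrite mulrBr.
Qed.

Lemma bumpf_affine_out (N x y : R) : 0 < N -> ~~ (x <= y <= x + N^-1) ->
  N * bumpf (N * (y - x)) = 0.
Proof.
move=> N0 H; rewrite bump_out ?mulr0//; apply: contra H.
rewrite in_itv /= => /andP[h1 h2]; apply/andP; split.
  by move: h1; rewrite pmulr_rgt0// subr_gt0 => /ltW.
by move: h2; rewrite -ltr_pdivlMl// mulr1 ltrBlDl => /ltW.
Qed.

Lemma rtest_bumpf (N x : R) : 0 < N -> 0 < x -> rtest (fun y => N * bumpf (N * (y - x))).
Proof.
move=> N0 x0; split; first exact: smooth_bumpf_affine.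
exists x, (x + N^-1); split => // y; apply: contraNT => H.
by rewrite bumpf_affine_out.
Qed.

Lemma Rintegral_bumpf u (N x c : R) : 0 < N -> 0 < x -> x + N^-1 <= c ->
  \int[leb]_(y in D) ((N * bumpf (N * (y - x))) * u y) =
  \int[leb]_(y in `[x, x + N^-1]) ((N * bumpf (N * (y - x))) * (u \_ `]0, c]) y).
Proof.
move=> N0 x0 xc; rewrite Rintegral_mkcond [RHS]Rintegral_mkcond.
congr Rintegral; apply/funext => y; rewrite !patchE /halfline !mem_setE !in_itv /= andbT.
have [xy|xy] := boolP (x <= y <= x + N^-1); last first.
  by rewrite bumpf_affine_out// mul0r if_same.
by rewrite (_ : 0 < y) /=; [rewrite (_ : y <= c)//|]; lra.
Qed.

(** The differentiation theorem applies to functions that are locally integrable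
    on the whole line. Cutting u at an integer, hence at countably many places,
    makes it available at almost every point with no bound on x. *)
Lemma patch_le_nat u (x : R) : 0 < x -> exists n : nat, x + 1 <= n%:R /\ (u \_ `]0, n%:R]) x = u x.
Proof.
move=> x0; exists (Num.truncn (x + 1)).+1; have h : x + 1 <= (Num.truncn (x + 1)).+1%:R by apply/ltW/truncnS_gt.
by split => //; rewrite patchE mem_setE in_itv /= x0 /= ifT//; lra.
Qed.

(** The set of full measure is independent of the scale N, so that a single
    point of it can be used along a whole sequence of mollifiers. *)
Lemma mollify_sqint u : sqint u -> {ae leb, forall x, D x -> forall e : R, 0 < e ->
  exists2 r0 : R, 0 < r0 & forall N : R, 0 < N -> N^-1 < r0 ->
    `|\int[leb]_(y in D) ((N * bumpf (N * (y - x))) * u y) - bump_mass R * u x| <= e}.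
Proof.
move=> su; apply: ae_mono (ae_lebesgue_pt_sqint su) => x H.
rewrite /halfline /= in_itv /= andbT => x0 e e0.
have [n [xn un]] := patch_le_nat u x0.
have [|r0 r00 K] := @mollify_lebesgue_pt _ (u \_ `]0, n%:R]) x x0 _ (H n) e e0.
  apply: integrable_locally_restrict; first exact: measurable_itv.
  exact: sqint_intble_itv.
exists (Num.min r0 1); first by rewrite lt_min r00 ltr01.
move=> N N0; rewrite lt_min => /andP[N1 N2].
by rewrite (@Rintegral_bumpf u N x n%:R N0 x0) -?un; [exact: K|lra].
Qed.

(** At almost every x the rescaled bumps at x, which are test functions, recover
    u(x) in the limit. *)
Lemma fundamental_lemma u : sqint u ->
  (forall phi, rtest phi -> \int[leb]_(x in D) (phi x * u x) = 0) ->
  ae_eq leb D u (fun=> 0).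
Proof.
move=> su H; apply: ae_mono (mollify_sqint su) => x K Dx.
have x0 := halfline_gt0 Dx.
have m0 := bump_mass_gt0 R.
apply/eqP; rewrite -(mulrI_eq0 _ (mulfI (lt0r_neq0 m0))) -normr_eq0 eq_le normr_ge0 andbT.
apply/ler_addgt0Pl => e e0; rewrite addr0.
have [r0 r00 L] := K Dx e e0.
have N0 : 0 < 2 / r0 by rewrite divr_gt0.
have := L _ N0; rewrite H; last exact: rtest_bumpf.
by rewrite sub0r normrN; apply; rewrite invf_div; lra.
Qed.

Definition locint w : Prop := forall s r : R, 0 < s -> s <= r -> intble `[s, r] w.

(** The base point 1 is inside the half-line because w need not be integrable
    near 0; one of the two integrals vanishes for each r. *)
Lemma has_density_primitive w : locint w -> exists u, has_density u w.
Proof.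
move=> iw.
(* Integrals over empty intervals vanish. *)
exists (fun r => \int[leb]_(x in `[1, r]) w x - \int[leb]_(x in `[r, 1]) w x).
move=> s r s0 sr; split; first exact: iw.
have E0 (a b : R) : b <= a -> \int[leb]_(x in `[a, b]) w x = 0.
  rewrite le_eqVlt => /predU1P[->|ba]; first by rewrite set_itv1 Rintegral_set1.
  by rewrite set_itv_ge ?Rintegral_set0// bnd_simp -ltNge.
have [s1|s1] := leP 1 s.
  rewrite (E0 s 1)// (E0 r 1); last by lra.
  by rewrite (@Rintegral_itv_split _ w 1 s r) ?s1//; [ring|apply: iw; lra].
have [r1|r1] := leP 1 r.
  rewrite (E0 1 s); last by lra.
  rewrite (E0 r 1); last by lra.
  rewrite (@Rintegral_itv_split _ w s 1 r); [ring|lra|exact: iw].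
rewrite (E0 1 s); last by lra.
rewrite (E0 1 r); last by lra.
rewrite (@Rintegral_itv_split _ w s r 1); [ring|lra|apply: iw; lra].
Qed.

Lemma stepf_diff_out (N x x' y : R) : 0 < N -> x <= x' -> ~~ (x <= y <= x' + N^-1) ->
  stepf (N * (y - x)) - stepf (N * (y - x')) = 0.
Proof.
move=> N0 xx'; rewrite negb_and -!ltNge => /orP[yx|yx].
  by rewrite !step_le0 ?subrr// nmulr_lle0//; lra.
have H (t : R) : t + N^-1 <= y -> 1 <= N * (y - t).
  by move=> ty; rewrite -ler_pdivrMl// mulr1; lra.
by rewrite !step_ge1 ?subrr// H//; lra.
Qed.

Lemma rtest_stepf (N x x' : R) : 0 < N -> 0 < x -> x <= x' ->
  rtest (fun y => stepf (N * (y - x)) - stepf (N * (y - x'))).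
Proof.
move=> N0 x0 xx'; split.
  rewrite (_ : (fun y => _) = fun y => -1 * stepf (N * (y - x')) + stepf (N * (y - x))); last first.
    by apply/funext => y; ring.
  by apply: smooth_linear; exact: smooth_stepf_affine.
exists x, (x' + N^-1); split => // y; apply: contraNT => H.
by rewrite stepf_diff_out.
Qed.

Lemma derive1_stepf_diff (N x x' y : R) :
  derive1 (fun y => stepf (N * (y - x)) - stepf (N * (y - x'))) y =
  N * bumpf (N * (y - x)) - N * bumpf (N * (y - x')).
Proof.
have D1 := is_derive_step_affine N x y; have D2 := is_derive_step_affine N x' y.
by have [_ <-] := is_deriveB D1 D2; rewrite derive1E.
Qed.

Lemma stepf_diff_bound (N x x' y : R) : 
  `|stepf (N * (y - x)) - stepf (N * (y - x'))| <= bump_mass R.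
Proof.
have /andP[h1 h2] := step_bound (N * (y - x)).
have /andP[h3 h4] := step_bound (N * (y - x')).
by rewrite ler_norml; lra.
Qed.

(** Differences of steps are smoothed indicators of [x, x']. They are bounded
    and vanish outside [x, x' + 1], whence dominated convergence. *)
Lemma cvg_stepf_diff w (x x' : R) : 0 < x -> x <= x' -> locint w ->
  measurable_fun D w ->
  \int[leb]_(y in D) ((stepf (n.+1%:R * (y - x)) - stepf (n.+1%:R * (y - x'))) * w y)
    @[n --> \oo] --> bump_mass R * \int[leb]_(y in `[x, x']) w y.
Proof.
move=> x0 xx' iw mw.
pose E : set R := `[x, x' + 1]%classic.
have mE : measurable E by exact: measurable_itv.
have iwE : intble E w by apply: iw => //; lra.
have N0 n : 0 < n.+1%:R :> R by [].
have mwp : measurable_fun E (w \_ `]x, x']).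
  apply: measurable_patch; first exact: measurable_itv.
  apply: measurable_funS mw => //; first exact: measurable_halfline.
  by move=> y; rewrite /halfline /= !in_itv /= => /andP[xy _]; rewrite andbT; lra.
have -> : (fun n => \int[leb]_(y in D) ((stepf (n.+1%:R * (y - x)) - stepf (n.+1%:R * (y - x'))) * w y)) =
  (fun n => \int[leb]_(y in E) ((stepf (n.+1%:R * (y - x)) - stepf (n.+1%:R * (y - x'))) * w y)).
  apply/funext => n; rewrite Rintegral_mkcond [RHS]Rintegral_mkcond.
  congr Rintegral; apply/funext => y.
  rewrite !patchE /E /halfline !mem_setE !in_itv /= andbT.
  have [xy|xy] := boolP (x <= y <= x' + 1); first by rewrite (_ : 0 < y)//; lra.
  rewrite stepf_diff_out ?mul0r ?if_same//; apply: contra xy => /andP[-> h] /=.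
  apply: (le_trans h); rewrite lerD2l invf_le1// ler1n//.
have -> : bump_mass R * \int[leb]_(y in `[x, x']) w y =
   \int[leb]_(y in E) (bump_mass R * (w \_ `]x, x']) y).
  rewrite RintegralZl//; last first.
    apply: (@intble_le _ _ _ (fun y => `|w y|)) => //.
      by move=> y _; rewrite patchE; case: ifP => _; rewrite ?normr0.
    exact: intble_norm.
  congr (_ * _); rewrite -Rintegral_itv_obnd_cbnd; last first.
    apply: (@intbleS _ `[x, x']%classic) => //; last exact: iw.
    by move=> y /=; rewrite !in_itv /= => /andP[/ltW -> ->].
  rewrite -Rintegral_mkcondr; congr Rintegral.
  by apply/seteqP; split => y /=; rewrite /E /= !in_itv /=; lra.
have mwE : measurable_fun E w by exact: intble_meas.
apply: (@dominated_Rintegral _ _ _ _ (fun y => bump_mass R * `|w y|)) => //.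
- move=> n; apply: measurable_funM => //.
  apply: measurable_funTS; apply: continuous_measurable_fun; apply: smooth_continuous.
  exact: (rtest_stepf (N0 n) x0 xx').1.
- by apply: measurable_funM => //; exact: mwp.
- exact: (intbleZ _ mE (intble_norm iwE)).
- by move=> n y _; rewrite normrM ler_wpM2r//; exact: stepf_diff_bound.
apply/aeW => y _.
have big (t : R) : t < y -> \forall n \near \oo, stepf (n.+1%:R * (y - t)) = bump_mass R.
  move=> ty; near=> n; apply: step_ge1.
  rewrite -ler_pdivrMr ?subr_gt0// mul1r.
  have : (y - t)^-1 <= n%:R by near: n; exact: nbhs_infty_ger.
  by move/le_trans; apply; rewrite ler_nat.
have small (t : R) n : y <= t -> stepf (n.+1%:R * (y - t)) = 0.
  by move=> ty; apply: step_le0; rewrite mulr_ge0_le0//; lra.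
apply: cvg_near_cst; rewrite patchE mem_setE in_itv /=.
have [yx|xy] := leP y x.
  near=> n; rewrite /= !small//; last by lra.
  by rewrite subrr mul0r mulr0.
have [yx'|x'y] := leP y x'.
  near=> n; rewrite /= (small x')// subr0; congr (_ * _); near: n.
  exact: big.
near=> n; rewrite /= mulr0 (_ : stepf _ = bump_mass R); last by near: n; exact: big.
rewrite (_ : stepf _ = bump_mass R); last by near: n; exact: big.
by rewrite subrr mul0r.
Unshelve. all: by end_near. Qed.

End TestFunctions.

(** * Weak derivatives are densities *)

Section WeakDensity.
Variable R : realType.
Implicit Types (u v w z phi : R -> R) (E : set R).

Lemma near_invS_lt (r0 : R) : 0 < r0 -> \forall n \near \oo, (n.+1%:R : R)^-1 < r0.
Proof.
move=> r00; near=> n; rewrite -[ltRHS]invrK ltf_pV2 ?posrE ?invr_gt0//.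
have : r0^-1 <= n%:R by near: n; exact: nbhs_infty_ger.
by move/le_lt_trans; apply; rewrite ltr_nat.
Unshelve. all: by end_near. Qed.

Lemma support_bounded phi (a b : R) : smooth phi ->
  (forall x, phi x != 0 -> a <= x <= b) -> exists c : R, forall x : R, `|phi x| <= c.
Proof.
move=> sp ab.
have cp : {within `[a, b], continuous phi}.
  by apply: continuous_subspaceT; exact: smooth_continuous.
have [ba|ab'] := ltP b a.
  exists 0 => x; have [->|/ab] := eqVneq (phi x) 0; first by rewrite normr0.
  by move=> H; exfalso; move: H ba; lra.
have [c1 _ H1] := EVT_max ab' cp.
have [c2 _ H2] := EVT_min ab' cp.
exists (`|phi c1| + `|phi c2|) => x.
have [->|/ab xab] := eqVneq (phi x) 0; first by rewrite normr0 addr_ge0.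
have h1 := H1 x; have h2 := H2 x; rewrite !in_itv /= in h1 h2.
have {}h1 := h1 xab; have {}h2 := h2 xab.
have k1 := ler_norm (phi c1); have k2 := ler_norm (- phi c2); rewrite normrN in k2.
have k3 := normr_ge0 (phi c1); have k4 := normr_ge0 (phi c2).
by rewrite ler_norml; lra.
Qed.

Lemma rtest_bounded phi : rtest phi -> exists c : R, forall x : R, `|phi x| <= c.
Proof. by move=> [sp [a [b [_ ab]]]]; exact: support_bounded ab. Qed.

Lemma rtest_measurable phi : rtest phi -> measurable_fun D phi.
Proof.
move=> [sp _]; apply: measurable_funTS; apply: continuous_measurable_fun.
exact: smooth_continuous.
Qed.

Lemma rtest_sqint phi : rtest phi -> sqint phi.
Proof.
move=> tp; have [c pc] := rtest_bounded tp.
have [_ [a [b [a0 ab]]]] := tp.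
apply: (@sqint_support _ _ a b c) => //; [exact: rtest_measurable|by move=> x _; exact: ab].
Qed.

Lemma derive1_support phi (a b : R) : (forall x, phi x != 0 -> a <= x <= b) ->
  forall x, derive1 phi x != 0 -> a <= x <= b.
Proof.
move=> ab x; apply: contraNT => xab.
have H (y : R) : ~~ (a <= y <= b) -> cst (0 : R) y = phi y.
  by move=> yab; apply/esym/eqP; apply: contraNT yab => /ab.
have D0 : is_derive (x : R^o) (1 : R^o) (phi : R^o -> R^o) 0.
  apply: (@near_eq_is_derive R R^o R^o (cst (0 : R))).
  move: xab; rewrite negb_and -!ltNge => /orP[xa|bx].
    near=> y; apply: H; rewrite negb_and -!ltNge; apply/orP; left.
    by near: y; exact: lt_nbhsl.
  near=> y; apply: H; rewrite negb_and -!ltNge; apply/orP; right.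
  by near: y; exact: lt_nbhsr.
by rewrite derive1E; apply/eqP; case: D0.
Unshelve. all: by end_near. Qed.

Lemma rtest_derive1 phi : rtest phi -> rtest (derive1 phi).
Proof.
move=> [sp [a [b [a0 ab]]]]; split; first exact: smooth_derive1.
by exists a, b; split => //; exact: derive1_support.
Qed.

(** Tested against the smoothed indicator of [x, x'], the weak equation equates
    mollifications of u at x and x' with an integral of w. At Lebesgue points
    its limit says that u(x') - u(x) is the integral of w over [x, x'], so u
    differs from a primitive of w by a constant, almost everywhere. *)
Lemma weak_density u w : sqint u -> measurable_fun D w -> locint w ->
  (forall phi, rtest phi ->
     \int[leb]_(y in D) (derive1 phi y * u y) = - \int[leb]_(y in D) (phi y * w y)) ->
  exists uc, ae_eq leb D u uc /\ has_density uc w.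
Proof.
move=> su mw lw H.
have [P HP] := has_density_primitive lw.
(* G x: the mollifications of u at x converge to u x. *)
pose G (x : R) := forall e : R, 0 < e ->
  exists2 r0 : R, 0 < r0 & forall N : R, 0 < N -> N^-1 < r0 ->
    `|\int[leb]_(y in D) ((N * bumpf (N * (y - x))) * u y) - bump_mass R * u x| <= e.
pose A x n := \int[leb]_(y in D) ((n.+1%:R * bumpf (n.+1%:R * (y - x))) * u y).
have cA x : G x -> A x n @[n --> \oo] --> bump_mass R * u x.
  move=> Gx; apply/cvgrPdist_le => e e0; have [r0 r00 K] := Gx e e0.
  by near=> n; rewrite distrC; apply: K => //; near: n; exact: near_invS_lt.
have key x x' : 0 < x -> x <= x' -> G x -> G x' -> u x' - u x = P x' - P x.
  move=> x0 xx' Gx Gx'.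
  have [iw ->] := HP x x' x0 xx'.
  have C1 := cvgB (cA x Gx) (cA x' Gx').
  have C2 := cvgN (cvg_stepf_diff x0 xx' lw mw).
  have E : (fun n => A x n - A x' n) = (fun n => - (\int[leb]_(y in D) ((stepf (n.+1%:R * (y - x)) - stepf (n.+1%:R * (y - x'))) * w y))).
    apply/funext => n; have n0 : 0 < n.+1%:R :> R by [].
    rewrite -(H _ (rtest_stepf n0 x0 xx')) /A -RintegralB//.
    - by apply: eq_Rintegral => y _; rewrite derive1_stepf_diff; ring.
    - exact: measurable_halfline.
    - by apply: sqintM => //; apply: rtest_sqint; exact: rtest_bumpf.
    - by apply: sqintM => //; apply: rtest_sqint; apply: rtest_bumpf => //; lra.
  have L : bump_mass R * u x - bump_mass R * u x' = - (bump_mass R * \int[leb]_(y in `[x, x']) w y).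
    have C1' : (fun n => A x n - A x' n) @ \oo --> bump_mass R * u x - bump_mass R * u x' by exact: (C1 _).
    move/(cvg_lim (@Rhausdorff R)): C1' => <-; rewrite E.
    exact: (cvg_lim (@Rhausdorff R) (C2 _)).
  have m0 := bump_mass_gt0 R.
  apply: (mulfI (lt0r_neq0 m0)).
  by rewrite (addrC (P x)) addrK mulrBr -opprB L opprK.
have G_ae := mollify_sqint su.
have [[x0 [x00 Gx0]]|nG] := pselect (exists x0, 0 < x0 /\ G x0).
  exists (fun x => P x + (u x0 - P x0)); split.
    apply: ae_mono G_ae => x Gx Dx; have {}Gx := Gx Dx.
    have x1 := halfline_gt0 Dx.
    have [xx0|/ltW xx0] := leP x x0.
      by have := key x x0 x1 xx0 Gx Gx0; lra.
    by have := key x0 x x00 xx0 Gx0 Gx; lra.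
  have := has_densityD HP (has_density_cst (u x0 - P x0)).
  by congr has_density; apply/funext => x; rewrite addr0.
exists P; split => //; apply: ae_mono G_ae => x Gx Dx; exfalso; apply: nG.
by exists x; split; [exact: halfline_gt0|exact: Gx Dx].
Unshelve. all: by end_near. Qed.

Lemma has_density_test phi u w : rtest phi -> sqint u -> has_density u w ->
  measurable_fun D w ->
  \int[leb]_(y in D) (derive1 phi y * u y) = - \int[leb]_(y in D) (phi y * w y).
Proof.
move=> tp su uw mw; have [sp [a [b [a0 ab]]]] := tp.
pose s := a / 2; pose r := `|b| + a + 1.
have s0 : 0 < s by rewrite divr_gt0.
have br : b < r by rewrite /r; have := ler_norm b; lra.
have sa : s < a by rewrite /s; lra.
have sr : s <= r by rewrite /r /s; have := normr_ge0 b; lra.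
have vanish phi' v : (forall x, phi' x != 0 -> a <= x <= b) ->
   \int[leb]_(y in D) (phi' y * v y) = \int[leb]_(y in `[s, r]) (phi' y * v y).
  move=> h; rewrite Rintegral_mkcond [RHS]Rintegral_mkcond.
  congr Rintegral; apply/funext => y; rewrite !patchE /halfline !mem_setE !in_itv /= andbT.
  have [->|/h yab] := eqVneq (phi' y) 0; first by rewrite mul0r !if_same.
  by rewrite ifT ?ifT//; lra.
have ab1 := derive1_support ab.
rewrite !vanish//.
have hphi : has_density phi (derive1 phi).
  apply: has_density_derive => x _; first exact: smooth_is_derive.
  exact: (smooth_continuous (smooth_derive1 sp)).
have [iM EM] := has_densityM hphi uw s0 sr.
have z1 : phi s = 0 by apply/eqP; apply: contraTT sa => /ab; rewrite -leNgt => /andP[].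
have z2 : phi r = 0 by apply/eqP; apply: contraTT br => /ab; rewrite -leNgt => /andP[].
move: EM; rewrite z1 z2 !mul0r add0r RintegralD//.
- by move/esym/eqP; rewrite addr_eq0 => /eqP.
- apply: (@intbleS _ D) => //; first exact: measurable_halfline.
  + exact: itv_halfline.
  + by apply: sqintM => //; apply: rtest_sqint; exact: rtest_derive1.
- have [c pc] := rtest_bounded tp.
  have [iw _] := uw s r s0 sr.
  apply: (@intble_bounded _ _ _ _ c) => //.
  apply: measurable_funS (rtest_measurable tp); first exact: measurable_halfline.
  exact: itv_halfline.
Qed.

End WeakDensity.

(** * Density of the test functions *)

Section Convolution.
Variable R : realType.
Implicit Types (u v w z phi eta : R -> R) (E : set R).

(** Correlation with eta rather than convolution: with eta supported in [0, 1/N],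
    the value at x only involves u on [x, x + 1/N], in accordance with the
    one-sided mollifiers above. *)
Definition conv eta u (x : R) : R := \int[leb]_(y in D) (eta (y - x) * u y).

(** Derivation under the integral sign falls on eta and gives a function of the
    same form, so that [smooth_class] applies to all these functions together. *)
Lemma smooth_conv eta u : smooth eta ->
  (exists a b : R, forall x : R, eta x != 0 -> a <= x <= b) -> intble D u ->
  smooth (conv eta u).
Proof.
move=> se [a [b ab]] iu.
have mD := @measurable_halfline R.
apply: (@smooth_class _ (fun f => exists eta, [/\ smooth eta,
  (forall x, eta x != 0 -> a <= x <= b) & f = conv eta u])); last by exists eta.
move=> _ {se ab eta} [eta [se ab ->]].
have se1 := smooth_derive1 se; have ab1 := derive1_support ab.
have [c0 etac] := support_bounded se ab.
have [c1 eta1c] := support_bounded se1 ab1.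
have ieta eta' (c x : R) : smooth eta' -> (forall x, `|eta' x| <= c) ->
    intble D (fun y => eta' (y - x) * u y).
  move=> se' ec; apply: (@intble_bounded _ _ _ _ c) => //.
  rewrite (_ : (fun y => _) = (fun y => eta' (1 * y + - x))); last first.
    by apply/funext => y; rewrite mul1r.
  apply: measurable_funTS; apply: continuous_measurable_fun.
  by apply: smooth_continuous; exact: smooth_affine.
pose f (x y : R) := eta (y - x) * u y.
have df (x y : R) : is_derive (x : R^o) (1 : R^o) (f ^~ y : R^o -> R^o) (- derive1 eta (y - x) * u y).
  have D1 : is_derive (x : R^o) (1 : R^o) (fun x : R => y - x : R) (-1 : R).
    have D0 := is_deriveB (is_derive_cst (y : R^o) (x : R^o) (1 : R^o)) (is_derive_id (x : R^o) (1 : R^o)).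
    by apply: (is_derive_eq D0); rewrite sub0r.
  have D2 := @is_derive1_comp _ eta (fun x : R => y - x) x _ _ (smooth_is_derive se (y - x)) D1.
  have D3 := is_deriveM D2 (is_derive_cst (u y : R^o) (x : R^o) (1 : R^o)).
  apply: (is_derive_eq D3); rewrite /GRing.scale /= /cst; ring.
have d1 x y : partial1of2 f x y = - derive1 eta (y - x) * u y.
  by rewrite /partial1of2 derive1E; case: (df x y).
have key (x : R) : derivable (conv eta u) x 1 /\ derive1 (conv eta u) x = conv (fun t => - derive1 eta t) u x.
  have xI : `]x - 1, x + 1[%classic x by rewrite /= in_itv /=; lra.
  have intf (z : R) : `]x - 1, x + 1[%classic z -> intble D (f z) by move=> _; exact: ieta etac.
  have derf (z y : R) : `]x - 1, x + 1[%classic z -> D y -> derivable (f ^~ y) z 1.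
    by move=> _ _; case: (df z y).
  have G0 y : 0 <= c1 * `|u y|.
    by rewrite mulr_ge0//; exact: le_trans (eta1c 0).
  have iG := intbleZ c1 mD (intble_norm iu).
  have Gub (z y : R) : `]x - 1, x + 1[%classic z -> D y -> `|partial1of2 f z y| <= c1 * `|u y|.
    by move=> _ _; rewrite d1 normrM normrN ler_wpM2r.
  split; first exact: (derivable_under_integral (mu := leb) mD xI intf derf G0 iG Gub).
  rewrite (differentiation_under_integral (mu := leb) mD xI intf derf G0 iG Gub).
  by apply: eq_Rintegral => y _; rewrite d1.
split; first by move=> x; case: (key x).
exists (fun t => - derive1 eta t); split.
- have := @smooth_linear R (-1) _ _ se1 (@smooth_cst R 0); congr smooth.
  by apply/funext => t; rewrite addr0 mulN1r.
- by move=> x; rewrite oppr_eq0; exact: ab1.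
- by apply/funext => x; case: (key x).
Qed.

(** The mollifications of u are bounded by the bound of u, vanish outside
    [a/2, b] once 1/N < a/2, and converge to u almost everywhere; dominated
    convergence gives convergence in the mean. *)
Lemma dense_bounded u (a b c : R) : 0 < a -> measurable_fun D u ->
  (forall x, `|u x| <= c) -> (forall x, u x != 0 -> a <= x <= b) ->
  forall e, 0 < e -> exists phi, rtest phi /\ \int[leb]_(x in D) ((u x - phi x) ^+ 2) < e.
Proof.
move=> a0 mu uc us e e0.
have mD := @measurable_halfline R.
have c0 : 0 <= c by apply: le_trans (uc 0).
have su : sqint u.
  by apply: (@sqint_support _ _ a b c) => // x _; exact: us.
have iu : intble D u.
  have iab : intble `]0, `|b| + 1] u by apply: sqint_intble_itv.
  have := intble_restrict (measurable_itv `]0, `|b| + 1]) iab.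
  rewrite (_ : u \_ _ = u); first by move=> h; exact: (@intbleS _ setT).
  apply/funext => x; rewrite patchE mem_setE in_itv /=.
  have [->|/us xab] := eqVneq (u x) 0; first by rewrite if_same.
  by rewrite ifT//; have := ler_norm b; lra.
have m0 := bump_mass_gt0 R.
pose F n := conv (fun t => (bump_mass R)^-1 * (n.+1%:R * bumpf (n.+1%:R * t))) u.
have n0 n : 0 < n.+1%:R :> R by [].
have a20 : 0 < a / 2 by lra.
(* From the index n1 on, the mollifications are supported away from 0. *)
have [n1 _ Hn1] := near_invS_lt a20.
have supp n : (n1 <= n)%N -> forall x, F n x != 0 -> a / 2 <= x <= b.
  move=> nn x; have Na := Hn1 n nn; apply: contraNT => xab.
  rewrite /F /conv; apply/eqP; rewrite (@eq_Rintegral _ _ _ _ _ (fun=> 0)) ?Rintegral_cst ?mul0r// => y _.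
  have [->|/us yab] := eqVneq (u y) 0; first by rewrite mulr0.
  rewrite bumpf_affine_out ?mulr0 ?mul0r//.
  apply: contra xab => /andP[xy yx].
  move: yab Na => /andP[h1 h2] /= h3.
  have K (i : R) : i < a / 2 -> y <= x + i -> a / 2 <= x by move: h1; clear; lra.
  by apply/andP; split; [exact: K h3 yx|exact: le_trans h2].
have smF n : smooth (F n).
  apply: smooth_conv => //.
    have -> : (fun t => (bump_mass R)^-1 * (n.+1%:R * bumpf (n.+1%:R * t))) =
      (fun t => (bump_mass R)^-1 * (n.+1%:R * bumpf (n.+1%:R * (t - 0))) + 0).
      by apply/funext => t; rewrite subr0 addr0.
    apply: smooth_linear; last exact: smooth_cst.
    exact: smooth_bumpf_affine.
  exists 0, (n.+1%:R^-1) => t; apply: contraNT => H.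
  have := @bumpf_affine_out _ n.+1%:R 0 t (n0 n); rewrite subr0 add0r => ->//.
  by rewrite mulr0.
have FE n (x : R) : 0 < x -> F n x = (bump_mass R)^-1 *
    \int[leb]_(y in D) ((n.+1%:R * bumpf (n.+1%:R * (y - x))) * u y).
  move=> x0; rewrite -RintegralZl//.
    by apply: eq_Rintegral => y _; rewrite mulrA.
  exact: sqintM (rtest_sqint (rtest_bumpf (n0 n) x0)) su.
have Fb n (x : R) : 0 < x -> `|F n x| <= c.
  move=> x0; rewrite FE//.
  have [ib mb] := Rintegral_bumpf_mass (n0 n) x0.
  set I : set R := `[x, x + n.+1%:R^-1]%classic in ib mb *.
  have mI : measurable I by exact: measurable_itv.
  rewrite (Rintegral_bumpf u (n0 n) x0 (lexx _)).
  set W := u \_ _; rewrite -/I.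
  have Wc y : I y -> `|W y| <= c.
    by move=> _; rewrite /W patchE; case: ifP => _; rewrite ?normr0.
  have mW : measurable_fun I W.
    apply: measurable_funTS; apply/(measurable_restrictT _ _).1; first exact: measurable_itv.
    apply: measurable_funS mu => //.
    by move=> y; rewrite /halfline /= !in_itv /= => /andP[->].
  have iW : intble I (fun y => (n.+1%:R * bumpf (n.+1%:R * (y - x))) * W y).
    by apply: eq_intble (intble_bounded mI mW Wc ib) => // y _; rewrite mulrC.
  rewrite normrM gtr0_norm ?invr_gt0// ler_pdivrMl// mb.
  apply: (le_trans (normr_Rintegral_le mI iW)).
  rewrite mulrC -RintegralZl//; apply: le_Rintegral => //.
  - exact: intble_norm.
  - exact: intbleZ.
  - move=> y Iy; rewrite normrM [leRHS]mulrC ger0_norm; last by rewrite mulr_ge0// bump_ge0.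
    by rewrite ler_wpM2l ?Wc// mulr_ge0// bump_ge0.
have H : \int[leb]_(x in D) ((u x - F (n1 + n)%N x) ^+ 2) @[n --> \oo] --> \int[leb]_(x in D) (0 : R).
  apply: (@dominated_Rintegral _ _ _ _ (fun x => (2 * c) ^+ 2 * \1_(`[a / 2, b]%classic) x)) => //.
  - move=> n; apply: measurable_funX; apply: measurable_funB => //.
    apply: measurable_funTS; apply: continuous_measurable_fun; exact: smooth_continuous (smF _).
  - apply: intbleZ => //; apply: (@intbleS _ setT) => //.
    exact: integrable_indic_itv.
  - move=> n x Dx.
    have x0 := halfline_gt0 Dx.
    rewrite normrX indicE mem_setE in_itv /=.
    have [xab|xab] := boolP (a / 2 <= x <= b).
      rewrite mulr1 ler_pXn2r ?nnegrE// ?mulr_ge0//.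
      apply: (le_trans (ler_normB _ _)).
      by have := uc x; have := Fb (n1 + n)%N x x0; lra.
    have -> : F (n1 + n)%N x = 0.
      by apply/eqP; apply: contraNT xab; apply: supp; exact: leq_addr.
    have -> : u x = 0.
      apply/eqP; apply: contraNT xab => /us /andP[h1 ->]; rewrite andbT.
      by lra.
    by rewrite subrr normr0 expr0n /= mulr0.
  - apply: ae_mono (mollify_sqint su) => x K Dx.
    have x0 := halfline_gt0 Dx.
    have C : (u x - F (n1 + n)%N x) @[n --> \oo] --> 0.
      apply/cvgr0Pnorm_le => d d0.
      have [r0 r00 L] := K Dx (bump_mass R * d) (mulr_gt0 m0 d0).
      near=> n; rewrite distrC FE//.
      have := L (n1 + n).+1%:R (n0 _).
      have : (n.+1%:R : R)^-1 < r0 by near: n; exact: near_invS_lt.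
      move=> h; have h' : ((n1 + n).+1%:R : R)^-1 < r0.
        by apply: le_lt_trans h; rewrite lef_pV2 ?posrE// ler_nat ltnS leq_addl.
      move=> /(_ h') H.
      rewrite -(ler_pM2l m0) -{1}(gtr0_norm m0) -normrM mulrBr mulVKf// gt_eqF//.
    have := cvgM C C; rewrite mulr0 => /(_ _) H.
    by under eq_fun do rewrite /= expr2; exact: H.
rewrite Rintegral_cst// mul0r in H.
have [n _ Hn] := cvgr0_norm_lt _ H _ e0.
exists (F (n1 + n)%N); split.
  split => //; exists (a / 2), b; split => //.
  by apply: supp; exact: leq_addr.
exact: le_lt_trans (ler_norm _) (Hn n (leqnn n)).
Unshelve. all: by end_near. Qed.

End Convolution.

Section Truncation.
Variable R : realType.
Implicit Types (u v w z phi eta : R -> R) (E : set R).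

Definition truncation u (n : nat) (x : R) : R :=
  if (n.+1%:R^-1 <= x <= n.+1%:R) && (`|u x| <= n.+1%:R) then u x else 0.

Lemma truncation_measurable u n : measurable_fun D u -> measurable_fun D (truncation u n).
Proof.
move=> mu; have mD := @measurable_halfline R.
rewrite /truncation; apply: measurable_fun_if => //.
- apply: measurable_and.
    apply: measurable_and; apply: measurable_fun_ler => //.
  apply: measurable_fun_ler => //.
  exact: measurableT_comp.
- apply: measurable_funS mu => //; exact: subIsetl.
Qed.

(** Truncating both the argument and the values reduces to [dense_bounded]. *)
Lemma sqint_dense u : sqint u -> forall e : R, 0 < e ->
  exists phi, rtest phi /\ \int[leb]_(x in D) ((u x - phi x) ^+ 2) < e.
Proof.
move=> su e e0; have [mu iu] := su.
have mD := @measurable_halfline R.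
have mT n := truncation_measurable n mu.
have n0 n : 0 < n.+1%:R :> R by [].
have Tle n x : `|truncation u n x| <= `|u x|.
  by rewrite /truncation; case: ifP => // _; rewrite normr0.
have Tb n x : `|truncation u n x| <= n.+1%:R.
  by rewrite /truncation; case: ifP => [/andP[]//|_]; rewrite normr0.
have Ts n x : truncation u n x != 0 -> n.+1%:R^-1 <= x <= n.+1%:R.
  by rewrite /truncation; case: ifP => [/andP[]//|_]; rewrite eqxx.
have ub n x : (u x - truncation u n x) ^+ 2 <= u x ^+ 2.
  rewrite /truncation; case: ifP => _; last by rewrite subr0.
  by rewrite subrr expr0n sqr_ge0.
have H : \int[leb]_(x in D) ((u x - truncation u n x) ^+ 2) @[n --> \oo] --> \int[leb]_(x in D) (0 : R).
  apply: (@dominated_Rintegral _ _ _ _ (fun x => u x ^+ 2)) => //.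
  - by move=> n; apply: measurable_funX; apply: measurable_funB => //; exact: mT.
  - by move=> n x Dx; rewrite ger0_norm ?sqr_ge0.
  apply/aeW => x Dx.
  have x0 := halfline_gt0 Dx.
  apply: cvg_near_cst; near=> n.
  rewrite /truncation ifT ?subrr ?expr0n//.
  apply/andP; split; last first.
    have : `|u x| <= n%:R by near: n; exact: nbhs_infty_ger.
    by move/le_trans; apply; rewrite ler_nat.
  apply/andP; split.
    by apply/ltW; near: n; exact: near_invS_lt.
  have : x <= n%:R by near: n; exact: nbhs_infty_ger.
  by move/le_trans; apply; rewrite ler_nat.
rewrite Rintegral_cst// mul0r in H.
have e40 : 0 < e / 4 by lra.
have [n _ /(_ n (leqnn n)) /= Hn] := cvgr0_norm_lt _ H _ e40.
have i0 : 0 < (n.+1%:R : R)^-1 by rewrite invr_gt0.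
have [phi [tp Hp]] := dense_bounded i0 (mT n) (Tb n) (Ts n) e40.
have sT : sqint (truncation u n) by exact: sqint_le su.
exists phi; split => //.
have s1 := sqintB su sT; have s2 := sqintB sT (rtest_sqint tp).
have [_ i1] := s1; have [_ i2] := s2.
have [_ i3] := sqintB su (rtest_sqint tp).
apply: (@le_lt_trans _ _ (2 * \int[leb]_(x in D) (u x - truncation u n x) ^+ 2 +
   2 * \int[leb]_(x in D) (truncation u n x - phi x) ^+ 2)).
  rewrite -!RintegralZl// -RintegralD//; try exact: intbleZ.
  apply: le_Rintegral => //.
    by apply: intbleD => //; exact: intbleZ.
  move=> x _; have := sqr_ge0 ((u x - truncation u n x) - (truncation u n x - phi x)).
  set a := truncation u n x; nra.
have h1 := le_lt_trans (ler_norm _) Hn.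
set J1 := Rintegral _ _ _ in h1 *; set J2 := Rintegral _ _ _ in Hp *.
move: h1 Hp; clear; lra.
Unshelve. all: by end_near. Qed.

End Truncation.

(** * Complex-valued functions *)

Section ComplexLayer.
Variable R : realType.
Implicit Types (u v w z : R -> R[i]) (E : set R) (c : R[i]).

Lemma ReD (x y : R[i]) : Re (x + y) = Re x + Re y. Proof. by case: x y => ? ? []. Qed.
Lemma ImD (x y : R[i]) : Im (x + y) = Im x + Im y. Proof. by case: x y => ? ? []. Qed.
Lemma ReN (x : R[i]) : Re (- x) = - Re x. Proof. by case: x. Qed.
Lemma ImN (x : R[i]) : Im (- x) = - Im x. Proof. by case: x. Qed.
Lemma ReM (x y : R[i]) : Re (x * y) = Re x * Re y - Im x * Im y. Proof. by case: x y => ? ? []. Qed.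
Lemma ImM (x y : R[i]) : Im (x * y) = Re x * Im y + Im x * Re y. Proof. by case: x y => ? ? []. Qed.
Lemma ReJ (x : R[i]) : Re (conjc x) = Re x. Proof. by case: x. Qed.
Lemma ImJ (x : R[i]) : Im (conjc x) = - Im x. Proof. by case: x. Qed.
Definition ReImE := (ReD, ImD, ReN, ImN, ReM, ImM, ReJ, ImJ).
Lemma eq_ReIm (x y : R[i]) : Re x = Re y -> Im x = Im y -> x = y.
Proof. by case: x y => ? ? [? ?] /= -> ->. Qed.

Definition cintble E u := intble E (fun x => Re (u x)) /\ intble E (fun x => Im (u x)).
(** Over the half-line this is [cintegral]; the set is a parameter because the
    rules of integration do not depend on it. *)
Definition cint E u : R[i] :=
  (\int[leb]_(x in E) Re (u x)) +i* (\int[leb]_(x in E) Im (u x)).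

Lemma eq_cint E u v : (forall x, E x -> u x = v x) -> cint E u = cint E v.
Proof.
by move=> uv; congr (_ +i* _); apply: eq_Rintegral => x /set_mem Ex; rewrite uv.
Qed.

Lemma eq_cintble E u v : measurable E -> (forall x, E x -> u x = v x) ->
  cintble E u -> cintble E v.
Proof.
move=> mE uv [i1 i2]; split; [apply: eq_intble i1 => //|apply: eq_intble i2 => //].
  by move=> x Ex; rewrite uv.
by move=> x Ex; rewrite uv.
Qed.

Lemma cintbleD E u v : measurable E -> cintble E u -> cintble E v ->
  cintble E (fun x => u x + v x).
Proof.
move=> mE [i1 i2] [j1 j2]; split.
  by apply: eq_intble (intbleD mE i1 j1) => // x _; rewrite ReImE.
by apply: eq_intble (intbleD mE i2 j2) => // x _; rewrite ReImE.
Qed.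

Lemma cintD E u v : measurable E -> cintble E u -> cintble E v ->
  cint E (fun x => u x + v x) = cint E u + cint E v.
Proof.
move=> mE [i1 i2] [j1 j2]; apply: eq_ReIm; rewrite ReImE /= -RintegralD//;
by apply: eq_Rintegral => x _; rewrite ReImE.
Qed.

Lemma cintbleZ E c u : measurable E -> cintble E u -> cintble E (fun x => c * u x).
Proof.
move=> mE [i1 i2]; split.
  apply: eq_intble (intbleB mE (intbleZ (Re c) mE i1) (intbleZ (Im c) mE i2)) => // x _.
  by rewrite ReImE.
apply: eq_intble (intbleD mE (intbleZ (Re c) mE i2) (intbleZ (Im c) mE i1)) => // x _.
by rewrite ReImE.
Qed.

Lemma cintZ E c u : measurable E -> cintble E u ->
  cint E (fun x => c * u x) = c * cint E u.
Proof.
move=> mE [i1 i2]; apply: eq_ReIm; rewrite ReImE /= -!RintegralZl//.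
  rewrite -RintegralB//; try exact: intbleZ.
  by apply: eq_Rintegral => x _; rewrite ReImE.
rewrite -RintegralD//; try exact: intbleZ.
by apply: eq_Rintegral => x _; rewrite ReImE.
Qed.

Lemma cintbleN E u : measurable E -> cintble E u -> cintble E (fun x => - u x).
Proof.
by move=> mE iu; apply: eq_cintble (cintbleZ (-1) mE iu) => // x _; rewrite mulN1r.
Qed.

Lemma cintN E u : measurable E -> cintble E u -> cint E (fun x => - u x) = - cint E u.
Proof.
by move=> mE iu; rewrite -mulN1r -cintZ//; apply: eq_cint => x _; rewrite mulN1r.
Qed.

Lemma cintbleB E u v : measurable E -> cintble E u -> cintble E v ->
  cintble E (fun x => u x - v x).
Proof. by move=> mE iu iv; apply: cintbleD => //; exact: cintbleN. Qed.

Lemma cintB E u v : measurable E -> cintble E u -> cintble E v ->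
  cint E (fun x => u x - v x) = cint E u - cint E v.
Proof. by move=> mE iu iv; rewrite cintD ?cintN//; exact: cintbleN. Qed.

Definition csq u : Prop := sqint (fun x => Re (u x)) /\ sqint (fun x => Im (u x)).

Lemma csqM u v : csq u -> csq v -> cintble D (fun x => u x * v x).
Proof.
have mD := @measurable_halfline R.
move=> [u1 u2] [v1 v2]; split.
  apply: eq_intble (intbleB mD (sqintM u1 v1) (sqintM u2 v2)) => // x _.
  by rewrite ReImE.
apply: eq_intble (intbleD mD (sqintM u1 v2) (sqintM u2 v1)) => // x _.
by rewrite ReImE.
Qed.

Lemma eq_csq u v : u =1 v -> csq u -> csq v.
Proof. by move=> /funext ->. Qed.

Lemma csqD u v : csq u -> csq v -> csq (fun x => u x + v x).
Proof.
move=> [u1 u2] [v1 v2]; split.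
  by have := sqintD u1 v1; congr sqint; apply/funext => x; rewrite ReImE.
by have := sqintD u2 v2; congr sqint; apply/funext => x; rewrite ReImE.
Qed.

Lemma csq_bounded u v (c : R) : cmeasurable v ->
  (forall x, D x -> `|Re (v x)| <= c /\ `|Im (v x)| <= c) -> csq u ->
  csq (fun x => v x * u x).
Proof.
move=> [m1 m2] vc [u1 u2].
have b1 x : D x -> `|Re (v x)| <= c by move=> /vc[].
have b2 x : D x -> `|Im (v x)| <= c by move=> /vc[].
split.
  have := sqintB (sqint_bounded m1 b1 u1) (sqint_bounded m2 b2 u2).
  by congr sqint; apply/funext => x; rewrite ReImE.
have := sqintD (sqint_bounded m1 b1 u2) (sqint_bounded m2 b2 u1).
by congr sqint; apply/funext => x; rewrite ReImE.
Qed.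

Lemma csqZ c u : csq u -> csq (fun x => c * u x).
Proof.
move=> su; apply: (@csq_bounded _ _ (`|Re c| + `|Im c|)) => //.
by move=> x _; split; rewrite ?lerDl ?lerDr.
Qed.

Lemma csqN u : csq u -> csq (fun x => - u x).
Proof. by move=> /(csqZ (-1)); apply: eq_csq => x; rewrite mulN1r. Qed.

Lemma csqB u v : csq u -> csq v -> csq (fun x => u x - v x).
Proof. by move=> su sv; apply: csqD => //; exact: csqN. Qed.

Lemma csqJ u : csq u -> csq (fun x => conjc (u x)).
Proof.
move=> [u1 u2]; split.
  by move: u1; congr sqint; apply/funext => x; rewrite ReImE.
by have := sqintN u2; congr sqint; apply/funext => x; rewrite ReImE.
Qed.

Lemma csq_measurable u : csq u -> cmeasurable u.
Proof. by move=> [[? _] [? _]]. Qed.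

Lemma cmeasurableD u v : cmeasurable u -> cmeasurable v -> cmeasurable (fun x => u x + v x).
Proof.
move=> [u1 u2] [v1 v2]; split.
  rewrite (_ : (fun x => _) = fun x => Re (u x) + Re (v x)); last by apply/funext => x; rewrite ReImE.
  exact: measurable_funD.
rewrite (_ : (fun x => _) = fun x => Im (u x) + Im (v x)); last by apply/funext => x; rewrite ReImE.
exact: measurable_funD.
Qed.

Lemma cmeasurableM u v : cmeasurable u -> cmeasurable v -> cmeasurable (fun x => u x * v x).
Proof.
move=> [u1 u2] [v1 v2]; split.
  rewrite (_ : (fun x => _) = fun x => Re (u x) * Re (v x) - Im (u x) * Im (v x)); last by apply/funext => x; rewrite ReImE.
  by apply: measurable_funB; exact: measurable_funM.
rewrite (_ : (fun x => _) = fun x => Re (u x) * Im (v x) + Im (u x) * Re (v x)); last by apply/funext => x; rewrite ReImE.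
by apply: measurable_funD; exact: measurable_funM.
Qed.

Lemma cmeasurable_cst c : cmeasurable (fun=> c : R[i]).
Proof. by split; exact: measurable_cst. Qed.

Lemma cmeasurable_real (f : R -> R) : measurable_fun D f -> cmeasurable (fun x => (f x)%:C).
Proof. by move=> mf; split => //; exact: measurable_cst. Qed.

Lemma cmeasurableN u : cmeasurable u -> cmeasurable (fun x => - u x).
Proof.
move=> mu; have := cmeasurableM (cmeasurable_cst (-1)) mu.
by congr cmeasurable; apply/funext => x; rewrite mulN1r.
Qed.

Lemma cmeasurableJ u : cmeasurable u -> cmeasurable (fun x => conjc (u x)).
Proof.
move=> [u1 u2]; split.
  by move: u1; congr measurable_fun; apply/funext => x; rewrite ReImE.
rewrite (_ : (fun x => _) = fun x => - Im (u x)); last by apply/funext => x; rewrite ReImE.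
exact: measurable_funN.
Qed.

Lemma eq_ae_cint u v : cmeasurable u -> cmeasurable v -> ae_eq leb D u v ->
  cint D u = cint D v.
Proof.
have mD := @measurable_halfline R.
move=> [u1 u2] [v1 v2] uv; congr (_ +i* _); apply: eq_ae_Rintegral => //.
  by apply: ae_mono uv => x uv Dx; rewrite uv.
by apply: ae_mono uv => x uv Dx; rewrite uv.
Qed.

Lemma csq_ae u v : cmeasurable v -> ae_eq leb D u v -> csq u -> csq v.
Proof.
move=> [v1 v2] uv [u1 u2]; split; [apply: sqint_ae u1|apply: sqint_ae u2] => //.
  by apply: ae_mono uv => x uv Dx; rewrite uv.
by apply: ae_mono uv => x uv Dx; rewrite uv.
Qed.

Definition chd u w : Prop := has_density (fun x => Re (u x)) (fun x => Re (w x)) /\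
  has_density (fun x => Im (u x)) (fun x => Im (w x)).

Lemma eq_chd u w w' : w =1 w' -> chd u w -> chd u w'.
Proof. by move=> /funext ->. Qed.

Lemma chdD u w v z : chd u w -> chd v z -> chd (fun x => u x + v x) (fun x => w x + z x).
Proof.
move=> [u1 u2] [v1 v2]; split.
  by have := has_densityD u1 v1; congr has_density; apply/funext => x; rewrite ReImE.
by have := has_densityD u2 v2; congr has_density; apply/funext => x; rewrite ReImE.
Qed.

Lemma chdM u w v z : chd u w -> chd v z ->
  chd (fun x => u x * v x) (fun x => w x * v x + u x * z x).
Proof.
move=> [u1 u2] [v1 v2]; split.
  have := has_densityD (has_densityM u1 v1) (has_densityZ (-1) (has_densityM u2 v2)).
  by congr has_density; apply/funext => x; rewrite !ReImE; ring.
have := has_densityD (has_densityM u1 v2) (has_densityM u2 v1).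
by congr has_density; apply/funext => x; rewrite !ReImE; ring.
Qed.

Lemma chd_cst c : chd (fun=> c) (fun=> 0).
Proof. by split; exact: has_density_cst. Qed.

Lemma chdZ c u w : chd u w -> chd (fun x => c * u x) (fun x => c * w x).
Proof.
move=> uw; apply: eq_chd (chdM (chd_cst c) uw) => x.
by rewrite mul0r add0r.
Qed.

Lemma chdJ u w : chd u w -> chd (fun x => conjc (u x)) (fun x => conjc (w x)).
Proof.
move=> [u1 u2]; split.
  by move: u1; congr has_density; apply/funext => x; rewrite ReImE.
have := has_densityZ (-1) u2.
by congr has_density; apply/funext => x; rewrite ReImE mulN1r.
Qed.

Lemma chd_measurable u w : chd u w -> cmeasurable u.
Proof.
by move=> [h1 h2]; split; apply: has_density_measurable; try exact: measurable_halfline; eauto.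
Qed.

End ComplexLayer.

(** * Spinors *)

Section Spinor.
Variable R : realType.
Implicit Types (f g : spinor R).

Lemma sum_I2 (V : nmodType) (F : 'I_2 -> V) : \sum_(i < 2) F i = F i0 + F i1.
Proof. by rewrite big_ord_recr big_ord_recr big_ord0 /= add0r; congr (F _ + F _); apply/val_inj. Qed.

Lemma I2P (i : 'I_2) : i = i0 \/ i = i1.
Proof. by case: i => [[|[|//]]] h; [left|right]; apply/val_inj. Qed.

Lemma eq_cV2 (u v : 'cV[R[i]]_2) : u i0 0 = v i0 0 -> u i1 0 = v i1 0 -> u = v.
Proof.
move=> h0 h1; apply/matrixP => i j; rewrite (ord1 j).
by have [->|->] := I2P i.
Qed.

Lemma vec2_0 (a b : R[i]) : vec2 a b i0 0 = a. Proof. by rewrite mxE. Qed.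
Lemma vec2_1 (a b : R[i]) : vec2 a b i1 0 = b. Proof. by rewrite mxE. Qed.
Lemma mat2_0 (a b c d : R[i]) (v : 'cV[R[i]]_2) : (mat2 a b c d *m v) i0 0 = a * v i0 0 + b * v i1 0.
Proof. by rewrite mxE sum_I2 !mxE. Qed.
Lemma mat2_1 (a b c d : R[i]) (v : 'cV[R[i]]_2) : (mat2 a b c d *m v) i1 0 = c * v i0 0 + d * v i1 0.
Proof. by rewrite mxE sum_I2 !mxE. Qed.

Lemma vnorm_sqr (v : 'cV[R[i]]_2) :
  vnorm v ^+ 2 = (Re (v i0 0) ^+ 2 + Im (v i0 0) ^+ 2) + (Re (v i1 0) ^+ 2 + Im (v i1 0) ^+ 2).
Proof.
by rewrite /vnorm sqr_sqrtr ?sum_I2 /cabs2// !addr_ge0// sqr_ge0.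
Qed.

Lemma sqintP (u : R -> R) : measurable_fun D u ->
  sqint u <-> (\int[leb]_(x in D) (u x ^+ 2)%:E < +oo)%E.
Proof.
move=> mu; have E : (\int[leb]_(x in D) (u x ^+ 2)%:E = \int[leb]_(x in D) `|(u x ^+ 2)%:E|)%E.
  by apply: eq_integral => x _; rewrite gee0_abs// lee_fin sqr_ge0.
split=> [[_ /integrableP[_]]|H]; first by rewrite E.
split => //; apply/integrableP; split; last by rewrite E in H.
by apply/measurable_EFinP; exact: measurable_funX.
Qed.

Lemma L2P f : L2 f <-> forall i, csq (fun x => f x i 0).
Proof.
have mD := @measurable_halfline R.
split=> [[mf Hf] i|H].
  have [m1 m2] := mf i.
  have K (u : R -> R) : measurable_fun D u -> (forall x, u x ^+ 2 <= vnorm (f x) ^+ 2) -> sqint u.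
    move=> mu uf; apply/sqintP => //; apply: le_lt_trans Hf.
    apply: ge0_le_integral => //.
    - by move=> x _; rewrite lee_fin sqr_ge0.
    - by apply/measurable_EFinP; exact: measurable_funX.
    - apply/measurable_EFinP.
      rewrite (_ : (fun x => _) = fun x => (Re (f x i0 0) ^+ 2 + Im (f x i0 0) ^+ 2) + (Re (f x i1 0) ^+ 2 + Im (f x i1 0) ^+ 2)); last first.
        by apply/funext => x; rewrite vnorm_sqr.
      have [a1 a2] := mf i0; have [b1 b2] := mf i1.
      by apply: measurable_funD; apply: measurable_funD; exact: measurable_funX.
    - by move=> x _; rewrite lee_fin uf.
  split; apply: K => // x; rewrite vnorm_sqr;
  have a1 := sqr_ge0 (Re (f x i0 0)); have a2 := sqr_ge0 (Im (f x i0 0));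
  have a3 := sqr_ge0 (Re (f x i1 0)); have a4 := sqr_ge0 (Im (f x i1 0));
  by have [->|->] := I2P i; lra.
split; first by move=> i; exact: csq_measurable.
have [[m1 a1] [m2 a2]] := H i0; have [[m3 a3] [m4 a4]] := H i1.
have A := intbleD mD (intbleD mD a1 a2) (intbleD mD a3 a4).
have /integrableP[_] := A; apply: le_lt_trans.
rewrite le_eqVlt; apply/orP; left; apply/eqP; apply: eq_integral => x _ /=.
by rewrite vnorm_sqr ger0_norm// !addr_ge0// sqr_ge0.
Qed.

Lemma test_functionP (phi : R -> R[i]) :
  test_function phi <-> rtest (fun x => Re (phi x)) /\ rtest (fun x => Im (phi x)).
Proof.
split=> [[s1 s2 [a [b [a0 ab]]]]|[[s1 [a [b [a0 ab]]]] [s2 [c [d [c0 cd]]]]]].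
  split; split => //; exists a, b; split => // x nz; apply: ab;
  by apply: contra_neq nz => ->.
split => //; exists (Num.min a c), (Num.max b d); split; first by rewrite lt_min a0.
move=> x nz; rewrite ge_min le_max.
have [/eqP re0|/ab /andP[-> ->]//] := boolP (Re (phi x) == 0).
have [/eqP im0|/cd /andP[-> ->]] := boolP (Im (phi x) == 0); last by rewrite !orbT.
by exfalso; move: nz; rewrite (@eq_ReIm _ (phi x) 0)// eqxx.
Qed.

Lemma rtest_real (phi : R -> R) : rtest phi -> test_function (fun x => (phi x)%:C).
Proof.
move=> tp; apply/test_functionP; split => //; split; first exact: smooth_cst.
by exists 1, 0; split => // x /=; rewrite eqxx.
Qed.

Lemma test_functionJ (phi : R -> R[i]) : test_function phi -> test_function (fun x => conjc (phi x)).
Proof.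
move=> /test_functionP[[s1 [a [b [a0 ab]]]] [s2 [c [d [c0 cd]]]]]; apply/test_functionP; split.
  rewrite (_ : (fun x => _) = fun x => Re (phi x)); last by apply/funext => x; rewrite ReImE.
  by split => //; exists a, b.
rewrite (_ : (fun x => _) = fun x => - Im (phi x)); last by apply/funext => x; rewrite ReImE.
split; last by exists c, d; split => // x; rewrite oppr_eq0; exact: cd.
have := @smooth_linear R (-1) _ _ s2 (@smooth_cst R 0); congr smooth.
by apply/funext => x; rewrite addr0 mulN1r.
Qed.

Lemma cderiveJ (phi : R -> R[i]) : test_function phi -> forall x,
  cderive (fun x => conjc (phi x)) x = conjc (cderive phi x).
Proof.
move=> /test_functionP[[s1 _] [s2 _]] x; apply: eq_ReIm; rewrite /= ?ReImE /=.
  by congr (derive1 _ _); apply/funext => y; rewrite ReImE.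
rewrite (_ : (fun y => _) = - (fun y => Im (phi y))); last by apply/funext => y; rewrite ReImE.
have D1 := smooth_is_derive s2 x.
by have [_ <-] := is_deriveN D1; rewrite derive1E.
Qed.

Lemma cderive_real (phi : R -> R) x : cderive (fun x => (phi x)%:C) x = (derive1 phi x)%:C.
Proof. by apply: eq_ReIm => //=; rewrite derive1_cst. Qed.

Lemma test_function0 : test_function (fun=> 0 : R[i]).
Proof. by split; try exact: smooth_cst; exists 1, 0; split => // x; rewrite eqxx. Qed.

Lemma cderive0 : cderive (fun=> 0 : R[i]) = fun=> 0.
Proof. by apply/funext => x; apply: eq_ReIm; rewrite /= derive1_cst. Qed.

Lemma test_csq (phi : R -> R[i]) : test_function phi -> csq phi.
Proof. by move=> /test_functionP[? ?]; split; exact: rtest_sqint. Qed.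

Lemma test_cderive_csq (phi : R -> R[i]) : test_function phi -> csq (cderive phi).
Proof. by move=> /test_functionP[? ?]; split; apply: rtest_sqint; exact: rtest_derive1. Qed.

Lemma measurable_pot (al be : R) : measurable_fun D (fun x => al + be / x).
Proof.
apply: measurable_funD => //; apply: measurable_funM => //.
apply: open_continuous_measurable_fun; first exact: interval_open.
move=> x /set_mem; rewrite /halfline /= in_itv /= andbT => x0.
by apply: inv_continuous; rewrite gt_eqF.
Qed.

Lemma rtest_pot (phi : R -> R) (al be : R) : rtest phi ->
  sqint (fun x => (al + be / x) * phi x).
Proof.
move=> tp; have [c pc] := rtest_bounded tp; have [_ [a [b [a0 ab]]]] := tp.
apply: (@sqint_support _ _ a b ((`|al| + `|be| / a) * c)).
- by apply: measurable_funM; [exact: measurable_pot|exact: rtest_measurable].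
- move=> x _; have [->|/ab /andP[ax _]] := eqVneq (phi x) 0.
    rewrite mulr0 normr0 mulr_ge0// ?addr_ge0// ?divr_ge0 ?(ltW a0)//.
    exact: le_trans (pc 0).
  rewrite normrM ler_pM// (le_trans (ler_normD _ _))// lerD2l normrM ler_wpM2l// normrV ?unitfE; last by rewrite gt_eqF; lra.
  by rewrite gtr0_norm ?lef_pV2 ?posrE//; lra.
- by move=> x _ nz; apply: ab; apply: contra_neq nz => ->; rewrite mulr0.
Qed.

Lemma rtest_intble phi (w : R -> R) : rtest phi -> locint w -> measurable_fun D w ->
  intble D (fun x => phi x * w x).
Proof.
move=> tp lw mw; have [c pc] := rtest_bounded tp; have [_ [a [b [a0 ab]]]] := tp.
have [ba|ab'] := ltP b a.
  have E : (fun x => phi x * w x) = fun=> 0.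
    apply/funext => x; have [->|/ab] := eqVneq (phi x) 0; first by rewrite mul0r.
    by move=> H; exfalso; move: H ba; lra.
  by rewrite E; exact: (@integrable0 _ _ _ leb).
have mI : measurable (`[a, b]%classic : set R) by exact: measurable_itv.
have iw := lw a b a0 ab'.
apply: (@intble_le _ _ _ (fun x => c * `|(w \_ `[a, b]) x|)).
- exact: measurable_halfline.
- by apply: measurable_funM => //; exact: rtest_measurable.
- move=> x _; rewrite patchE mem_setE in_itv /= normrM.
  have [->|/ab ->] := eqVneq (phi x) 0; last by rewrite ler_wpM2r.
  by rewrite normr0 mul0r mulr_ge0//; exact: le_trans (pc 0).
- apply: (@intbleS _ setT) => //; first exact: measurable_halfline.
  by apply: intbleZ => //; apply: intble_norm; exact: intble_restrict.
Qed.

Lemma chd_test (phi u w : R -> R[i]) : test_function phi -> csq u -> chd u w -> cmeasurable w ->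
  cintble D (fun x => phi x * w x) /\
  cint D (fun x => cderive phi x * u x) = - cint D (fun x => phi x * w x).
Proof.
move=> tp [u1 u2] [h1 h2] [m1 m2]; have mD := @measurable_halfline R.
have [t1 t2] := (test_functionP phi).1 tp.
have l1 : locint (fun x => Re (w x)) by move=> s r s0 sr; case: (h1 s r s0 sr).
have l2 : locint (fun x => Im (w x)) by move=> s r s0 sr; case: (h2 s r s0 sr).
have s1 := rtest_sqint (rtest_derive1 t1); have s2 := rtest_sqint (rtest_derive1 t2).
have j11 := rtest_intble t1 l1 m1; have j12 := rtest_intble t1 l2 m2.
have j21 := rtest_intble t2 l1 m1; have j22 := rtest_intble t2 l2 m2.
split.
  split; first by apply: eq_intble (intbleB mD j11 j22) => // x _; rewrite ReImE.
  by apply: eq_intble (intbleD mD j12 j21) => // x _; rewrite ReImE.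
apply: eq_ReIm; rewrite ReImE /=.
  transitivity (\int[leb]_(x in D) (derive1 (fun y => Re (phi y)) x * Re (u x)) -
     \int[leb]_(x in D) (derive1 (fun y => Im (phi y)) x * Im (u x))).
    rewrite -RintegralB//; try exact: sqintM.
    by apply: eq_Rintegral => x _; rewrite ReImE.
  rewrite (has_density_test t1 u1 h1 m1) (has_density_test t2 u2 h2 m2).
  rewrite -opprD -RintegralB//; congr (- _).
  by apply: eq_Rintegral => x _; rewrite ReImE.
transitivity (\int[leb]_(x in D) (derive1 (fun y => Re (phi y)) x * Im (u x)) +
   \int[leb]_(x in D) (derive1 (fun y => Im (phi y)) x * Re (u x))).
  rewrite -RintegralD//; try exact: sqintM.
  by apply: eq_Rintegral => x _; rewrite ReImE.
rewrite (has_density_test t1 u2 h2 m2) (has_density_test t2 u1 h1 m1).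
rewrite -opprD -RintegralD//; congr (- _).
by apply: eq_Rintegral => x _; rewrite ReImE.
Qed.

End Spinor.

(** * The weak form of the maximal operator *)

Section WeakForm.
Variable R : realType.
Implicit Types (f g : spinor R).

Lemma has_density_ae (u w z : R -> R) : measurable_fun D z -> ae_eq leb D w z ->
  has_density u w -> has_density u z.
Proof.
move=> mz wz uw s r s0 sr; have [iw ->] := uw s r s0 sr.
have mI : measurable (`[s, r]%classic : set R) by exact: measurable_itv.
have mzI : measurable_fun (`[s, r]%classic : set R) z.
  apply: measurable_funS mz; first exact: measurable_halfline.
  exact: itv_halfline.
have wzI : ae_eq leb (`[s, r]%classic : set R) w z.
  by apply: ae_mono wz => x wz Ix; apply: wz; exact: itv_halfline Ix.
split; first exact: intble_ae iw.
by congr (_ + _); apply: eq_ae_Rintegral => //; exact: intble_meas.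
Qed.

Lemma chd_ae (u w z : R -> R[i]) : cmeasurable z -> ae_eq leb D w z -> chd u w -> chd u z.
Proof.
move=> [z1 z2] wz [h1 h2]; split.
  by apply: has_density_ae h1 => //; apply: ae_mono wz => x wz Dx; rewrite wz.
by apply: has_density_ae h2 => //; apply: ae_mono wz => x wz Dx; rewrite wz.
Qed.

Variables (m nu mu lam : R) (k : int).
Local Notation V := (dirac_V m nu mu lam k).
Local Notation kap := (k%:~R + lam).

Lemma potE0 (r : R) (v : 'cV[R[i]]_2) : (V r *m v) i0 0 =
  (m + (nu + mu) / r)%:C * v i0 0 + (0 + kap / r)%:C * v i1 0.
Proof. by rewrite mat2_0 add0r. Qed.

Lemma potE1 (r : R) (v : 'cV[R[i]]_2) : (V r *m v) i1 0 =
  (0 + kap / r)%:C * v i0 0 + (- m + (nu - mu) / r)%:C * v i1 0.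
Proof. by rewrite mat2_1 add0r. Qed.

Lemma JE0 (v : 'cV[R[i]]_2) : (dirac_J R *m v) i0 0 = - v i1 0.
Proof. by rewrite mat2_0 mul0r add0r mulN1r. Qed.

Lemma JE1 (v : 'cV[R[i]]_2) : (dirac_J R *m v) i1 0 = v i0 0.
Proof. by rewrite mat2_1 mul0r addr0 mul1r. Qed.

Lemma pot_cmeasurable f i : (forall j, cmeasurable (fun x => f x j 0)) ->
  cmeasurable (fun x => (V x *m f x) i 0).
Proof.
move=> mf; have [->|->] := I2P i.
  rewrite (funext (fun x => potE0 x (f x))).
  by apply: cmeasurableD; apply: cmeasurableM => //; apply: cmeasurable_real; exact: measurable_pot.
rewrite (funext (fun x => potE1 x (f x))).
by apply: cmeasurableD; apply: cmeasurableM => //; apply: cmeasurable_real; exact: measurable_pot.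
Qed.

Lemma test_pot_csq (phi : R -> R[i]) (al be : R) : test_function phi ->
  csq (fun x => (al + be / x)%:C * phi x).
Proof.
move=> /test_functionP[t1 t2]; split.
  have := rtest_pot al be t1; congr sqint; apply/funext => x.
  by rewrite ReImE /= mul0r subr0.
have := rtest_pot al be t2; congr sqint; apply/funext => x.
by rewrite ReImE /= mul0r addr0.
Qed.

Lemma test_pot_cintble (phi : R -> R[i]) f i : test_function phi -> L2 f ->
  cintble D (fun x => phi x * (V x *m f x) i 0).
Proof.
move=> tp /L2P Lf; have mD := @measurable_halfline R.
have K (al be : R) j : cintble D (fun x => phi x * ((al + be / x)%:C * f x j 0)).
  apply: eq_cintble (csqM (test_pot_csq al be tp) (Lf j)) => // x _.
  by rewrite mulrCA mulrA.
have [->|->] := I2P i.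
  by apply: eq_cintble (cintbleD mD (K m (nu + mu) i0) (K 0 kap i1)) => // x _; rewrite potE0 mulrDr.
by apply: eq_cintble (cintbleD mD (K 0 kap i0) (K (- m) (nu - mu) i1)) => // x _; rewrite potE1 mulrDr.
Qed.

(** The equation h^* f = g in the classical sense: f is locally absolutely
    continuous and the equation, solved for the derivatives of its two
    components, holds for the densities. *)
Definition dirac_ac f g : Prop :=
  chd (fun x => f x i0 0) (fun x => g x i1 0 - (V x *m f x) i1 0) /\
  chd (fun x => f x i1 0) (fun x => (V x *m f x) i0 0 - g x i0 0).

Lemma L2_cmeasurable f : L2 f -> forall i, cmeasurable (fun x => f x i 0).
Proof. by move=> [mf _]. Qed.

Lemma weak_entry0 f (phi : R -> R[i]) x :
  (- cderive phi x *: (dirac_J R *m f x) + phi x *: (V x *m f x)) i0 0 =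
  cderive phi x * f x i1 0 + phi x * (V x *m f x) i0 0.
Proof. by rewrite mxE [X in X + _]mxE [X in _ + X]mxE JE0 mulrNN. Qed.

Lemma weak_entry1 f (phi : R -> R[i]) x :
  (- cderive phi x *: (dirac_J R *m f x) + phi x *: (V x *m f x)) i1 0 =
  - (cderive phi x * f x i0 0) + phi x * (V x *m f x) i1 0.
Proof. by rewrite mxE [X in X + _]mxE [X in _ + X]mxE JE1 mulNr. Qed.

(** The two components of the weak equation, with the derivative terms separated
    from the potential terms. Each of them is integrable on its own because a
    test function keeps away from the singularity of the potential. *)
Lemma dirac_weakP f g : L2 f -> L2 g -> dirac_weak m nu mu lam k f g <->
  forall phi : R -> R[i], test_function phi ->
    cint D (fun x => cderive phi x * f x i1 0)
      = cint D (fun x => phi x * g x i0 0) - cint D (fun x => phi x * (V x *m f x) i0 0) /\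
    cint D (fun x => cderive phi x * f x i0 0)
      = cint D (fun x => phi x * (V x *m f x) i1 0) - cint D (fun x => phi x * g x i1 0).
Proof.
move=> Lf Lg; have mD := @measurable_halfline R.
have lf := (L2P f).1 Lf.
have K phi : test_function phi ->
    cint D (fun x => (- cderive phi x *: (dirac_J R *m f x) + phi x *: (V x *m f x)) i0 0) =
    cint D (fun x => cderive phi x * f x i1 0) + cint D (fun x => phi x * (V x *m f x) i0 0) /\
    cint D (fun x => (- cderive phi x *: (dirac_J R *m f x) + phi x *: (V x *m f x)) i1 0) =
    - cint D (fun x => cderive phi x * f x i0 0) + cint D (fun x => phi x * (V x *m f x) i1 0).
  move=> tp; have p0 := test_pot_cintble i0 tp Lf; have p1 := test_pot_cintble i1 tp Lf.
  have q0 := csqM (test_cderive_csq tp) (lf i0); have q1 := csqM (test_cderive_csq tp) (lf i1).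
  split; rewrite -?cintN// -cintD//; try exact: cintbleN.
    by apply: eq_cint => x _; exact: weak_entry0.
  by apply: eq_cint => x _; exact: weak_entry1.
split=> [W phi tp|W phi tp i]; have [K0 K1] := K phi tp.
  have W0 := etrans (esym K0) (W phi tp i0); have W1 := etrans (esym K1) (W phi tp i1).
  rewrite -[cint D (fun x => phi x * g x i0 0)]W0 -[cint D (fun x => phi x * g x i1 0)]W1.
  by split; ring.
have [E0 E1] := W phi tp; rewrite -[LHS]/(cint D _) -[RHS]/(cint D _).
by have [->|->] := I2P i; rewrite ?K0 ?K1 ?E0 ?E1; ring.
Qed.

Lemma ac_weak f g : L2 f -> L2 g -> dirac_ac f g -> dirac_weak m nu mu lam k f g.
Proof.
move=> Lf Lg [h0 h1]; apply/dirac_weakP => // phi tp; have mD := @measurable_halfline R.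
have lf := (L2P f).1 Lf; have lg := (L2P g).1 Lg.
have mg := L2_cmeasurable Lg.
have mV i := pot_cmeasurable i (L2_cmeasurable Lf).
have p0 := test_pot_cintble i0 tp Lf; have p1 := test_pot_cintble i1 tp Lf.
have q0 := csqM (test_csq tp) (lg i0); have q1 := csqM (test_csq tp) (lg i1).
have [_ ->] := chd_test tp (lf i1) h1 (cmeasurableD (mV i0) (cmeasurableN (mg i0))).
have [_ ->] := chd_test tp (lf i0) h0 (cmeasurableD (mg i1) (cmeasurableN (mV i1))).
split.
  rewrite -[RHS]opprB -cintB//; congr (- _).
  by apply: eq_cint => x _; rewrite mulrBr.
rewrite -[RHS]opprB -cintB//; congr (- _).
by apply: eq_cint => x _; rewrite mulrBr.
Qed.

Lemma sqint_locint (u : R -> R) : sqint u -> locint u.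
Proof.
move=> su s r s0 sr.
have i2 := @sqint_intble_itv _ u (s/2) r ltac:(lra) su.
apply: intbleS i2 => //.
by move=> x /=; rewrite !in_itv /= => /andP[? ?]; lra.
Qed.

Lemma locintD (u v : R -> R) : locint u -> locint v -> locint (fun x => u x + v x).
Proof. by move=> lu lv s r s0 sr; apply: intbleD; [exact: measurable_itv|exact: lu|exact: lv]. Qed.

Lemma locintB (u v : R -> R) : locint u -> locint v -> locint (fun x => u x - v x).
Proof. by move=> lu lv s r s0 sr; apply: intbleB; [exact: measurable_itv|exact: lu|exact: lv]. Qed.

Lemma pot_locint f i : L2 f ->
  locint (fun x => Re ((V x *m f x) i 0)) /\ locint (fun x => Im ((V x *m f x) i 0)).
Proof.
move=> /L2P Lf.
have K (al be : R) (u : R -> R) : sqint u -> locint (fun x => (al + be / x) * u x).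
  move=> su s r s0 sr; apply: (@intble_bounded _ _ _ _ (`|al| + `|be| / s)) => //.
  - apply: measurable_funS (measurable_pot al be); first exact: measurable_halfline.
    exact: itv_halfline.
  - move=> x /=; rewrite in_itv /= => /andP[sx xr].
    rewrite (le_trans (ler_normD _ _))// lerD2l normrM ler_wpM2l// normrV ?unitfE; last by rewrite gt_eqF; lra.
    by rewrite gtr0_norm ?lef_pV2 ?posrE//; lra.
  - exact: sqint_locint.
have [l00 l01] := Lf i0; have [l10 l11] := Lf i1.
have [->|->] := I2P i; split.
- have := locintD (K m (nu + mu) _ l00) (K 0 kap _ l10); congr locint; apply/funext => x.
  by rewrite potE0 !ReImE /= !mul0r !subr0.
- have := locintD (K m (nu + mu) _ l01) (K 0 kap _ l11); congr locint; apply/funext => x.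
  by rewrite potE0 !ReImE /= !mul0r !addr0.
- have := locintD (K 0 kap _ l00) (K (- m) (nu - mu) _ l10); congr locint; apply/funext => x.
  by rewrite potE1 !ReImE /= !mul0r !subr0.
- have := locintD (K 0 kap _ l01) (K (- m) (nu - mu) _ l11); congr locint; apply/funext => x.
  by rewrite potE1 !ReImE /= !mul0r !addr0.
Qed.

End WeakForm.

(** * The domain of the maximal operator *)

Section WeakSolution.
Variable R : realType.
Implicit Types (f g : spinor R).

Lemma Re_cint_real (phi : R -> R) (u : R -> R[i]) :
  Re (cint D (fun x => (phi x)%:C * u x)) = \int[leb]_(x in D) (phi x * Re (u x)).
Proof. by apply: eq_Rintegral => x _; rewrite ReImE /= mul0r subr0. Qed.

Lemma Im_cint_real (phi : R -> R) (u : R -> R[i]) :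
  Im (cint D (fun x => (phi x)%:C * u x)) = \int[leb]_(x in D) (phi x * Im (u x)).
Proof. by apply: eq_Rintegral => x _; rewrite ReImE /= mul0r addr0. Qed.

Lemma cweak_density (u w : R -> R[i]) : csq u -> cmeasurable w ->
  locint (fun x => Re (w x)) -> locint (fun x => Im (w x)) ->
  (forall phi : R -> R, rtest phi ->
    cint D (fun x => (derive1 phi x)%:C * u x) = - cint D (fun x => (phi x)%:C * w x)) ->
  exists uc, ae_eq leb D u uc /\ chd uc w.
Proof.
move=> [u1 u2] [m1 m2] l1 l2 H.
have [|a [ua ha]] := weak_density u1 m1 l1.
  by move=> phi tp; rewrite -!Re_cint_real H// ReN.
have [|b [ub hb]] := weak_density u2 m2 l2.
  by move=> phi tp; rewrite -!Im_cint_real H// ImN.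
exists (fun x => a x +i* b x); split; last by split.
apply: ae_mono2 ua ub => x ax bx Dx.
apply: eq_ReIm; [exact: ax Dx|exact: bx Dx].
Qed.

Variables (m nu mu lam : R) (k : int).
Local Notation V := (dirac_V m nu mu lam k).

Lemma ae_eq_entries f g : eqL2 f g <-> forall i, ae_eq leb D (fun x => f x i 0) (fun x => g x i 0).
Proof.
split=> [fg i|H]; first by apply: ae_mono fg => x fg Dx; rewrite fg.
apply: ae_mono2 (H i0) (H i1) => x h0 h1 Dx.
apply: eq_cV2; [exact: h0 Dx|exact: h1 Dx].
Qed.

(** The representative fc still satisfies the equation with itself in the
    potential term, as the densities only matter almost everywhere. *)
Lemma weak_ac f g : L2 f -> L2 g -> dirac_weak m nu mu lam k f g ->
  exists fc, [/\ eqL2 f fc, L2 fc & dirac_ac m nu mu lam k fc g].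
Proof.
move=> Lf Lg; move/(dirac_weakP _ _ _ _ _ Lf Lg) => W; have mD := @measurable_halfline R.
have lf := (L2P f).1 Lf; have lg := (L2P g).1 Lg.
have mg := L2_cmeasurable Lg; have mf := L2_cmeasurable Lf.
have mV i := pot_cmeasurable m nu mu lam k i mf.
have lV i := pot_locint m nu mu lam k i Lf.
have lG i : locint (fun x => Re (g x i 0)) /\ locint (fun x => Im (g x i 0)).
  by have [a b] := lg i; split; exact: sqint_locint.
have K j (w1 w2 : R -> R[i]) : cmeasurable w1 -> cmeasurable w2 ->
    locint (fun x => Re (w1 x)) /\ locint (fun x => Im (w1 x)) ->
    locint (fun x => Re (w2 x)) /\ locint (fun x => Im (w2 x)) ->
    (forall phi, test_function phi -> [/\ cintble D (fun x => phi x * w1 x),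
      cintble D (fun x => phi x * w2 x) & cint D (fun x => cderive phi x * f x j 0) =
      cint D (fun x => phi x * w2 x) - cint D (fun x => phi x * w1 x)]) ->
    exists uc, ae_eq leb D (fun x => f x j 0) uc /\ chd uc (fun x => w1 x - w2 x).
  move=> m1 m2 [l1 l1'] [l2 l2'] E; apply: cweak_density => //.
  - by apply: cmeasurableD => //; exact: cmeasurableN.
  - by have := locintB l1 l2; congr locint; apply/funext => x; rewrite !ReImE.
  - by have := locintB l1' l2'; congr locint; apply/funext => x; rewrite !ReImE.
  move=> phi tp; have [j1 j2 {}E] := E _ (rtest_real tp).
  transitivity (cint D (fun x => cderive (fun x => (phi x)%:C) x * f x j 0)).
    by apply: eq_cint => x _; rewrite cderive_real.
  rewrite E -opprB -cintB//; congr (- _).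
  by apply: eq_cint => x _; rewrite mulrBr.
have [|a [fa ha]] := K i0 _ _ (mg i1) (mV i1) (lG i1) (lV i1).
  by move=> phi tp; split; [exact: csqM (test_csq tp) (lg i1)|exact: test_pot_cintble|case: (W _ tp)].
have [|b [fb hb]] := K i1 _ _ (mV i0) (mg i0) (lV i0) (lG i0).
  by move=> phi tp; split; [exact: test_pot_cintble|exact: csqM (test_csq tp) (lg i0)|case: (W _ tp)].
pose fc x := vec2 (a x) (b x).
have fc0 : (fun x => fc x i0 0) = a by apply/funext => x; rewrite vec2_0.
have fc1 : (fun x => fc x i1 0) = b by apply/funext => x; rewrite vec2_1.
have ffc : eqL2 f fc.
  apply/ae_eq_entries => i; have [->|->] := I2P i; first by rewrite fc0.
  by rewrite fc1.
have mfc i : cmeasurable (fun x => fc x i 0).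
  have [->|->] := I2P i; first by rewrite fc0; exact: chd_measurable ha.
  by rewrite fc1; exact: chd_measurable hb.
have mVc i := pot_cmeasurable m nu mu lam k i mfc.
exists fc; split => //.
  by apply/L2P => i; apply: csq_ae (lf i) => //; exact: (ae_eq_entries f fc).1.
split.
  rewrite fc0; apply: chd_ae ha; first by apply: cmeasurableD => //; exact: cmeasurableN.
  by apply: ae_mono ffc => x ffc Dx; rewrite (ffc Dx).
rewrite fc1; apply: chd_ae hb; first by apply: cmeasurableD => //; exact: cmeasurableN.
by apply: ae_mono ffc => x ffc Dx; rewrite (ffc Dx).
Qed.

Lemma dirac_weak_ae f g f' g' : L2 f -> L2 g -> L2 f' -> L2 g' ->
  eqL2 f f' -> eqL2 g g' -> dirac_weak m nu mu lam k f g -> dirac_weak m nu mu lam k f' g'.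
Proof.
move=> Lf Lg Lf' Lg' ff gg; move/(dirac_weakP _ _ _ _ _ Lf Lg) => W.
apply/dirac_weakP => // phi tp; have [E0 E1] := W phi tp.
have mf := L2_cmeasurable Lf; have mg := L2_cmeasurable Lg.
have mf' := L2_cmeasurable Lf'; have mg' := L2_cmeasurable Lg'.
have mV i := pot_cmeasurable m nu mu lam k i mf.
have mV' i := pot_cmeasurable m nu mu lam k i mf'.
have mp := csq_measurable (test_csq tp); have md := csq_measurable (test_cderive_csq tp).
have K (c : R -> R[i]) (v v' : spinor R) i : cmeasurable c -> cmeasurable (fun x => v x i 0) ->
   cmeasurable (fun x => v' x i 0) -> eqL2 v v' ->
   cint D (fun x => c x * v x i 0) = cint D (fun x => c x * v' x i 0).
  move=> mc mv mv' vv; apply: eq_ae_cint; try exact: cmeasurableM.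
  by apply: ae_mono vv => x vv Dx; rewrite vv.
have VV : eqL2 (fun x => V x *m f x) (fun x => V x *m f' x).
  by apply: ae_mono ff => x ff Dx; rewrite ff.
rewrite -(K (cderive phi) f f' i1)// -(K (cderive phi) f f' i0)//.
rewrite -(K phi g g' i1)// -(K phi g g' i0)//.
by rewrite -(K phi (fun x => V x *m f x) (fun x => V x *m f' x) i1)// -(K phi (fun x => V x *m f x) (fun x => V x *m f' x) i0).
Qed.

Lemma dirac_max_functional f g g' : dirac_max m nu mu lam k (f, g) ->
  dirac_max m nu mu lam k (f, g') -> eqL2 g g'.
Proof.
move=> [/= Lf Lg W] [/= _ Lg' W']; have mD := @measurable_halfline R.
have lg := (L2P g).1 Lg; have lg' := (L2P g').1 Lg'.
have E phi i : rtest phi -> cint D (fun x => (phi x)%:C * (g x i 0 - g' x i 0)) = 0.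
  move=> tp; have tp' := rtest_real tp.
  rewrite (@eq_cint _ _ _ (fun x => (phi x)%:C * g x i 0 - (phi x)%:C * g' x i 0)); last first.
    by move=> x _; rewrite mulrBr.
  rewrite cintB//; try exact: (csqM (test_csq tp')).
  by apply/eqP; rewrite subr_eq0; apply/eqP; transitivity (cintegral (fun r => (phi r)%:C * g r i 0)) => //; rewrite -(W _ tp' i); exact: (W' _ tp' i).
apply/ae_eq_entries => i.
have [s1 s2] := csqB (lg i) (lg' i).
have A1 := fundamental_lemma s1 (fun phi tp => etrans (esym (Re_cint_real phi _)) (congr1 Re (E phi i tp))).
have A2 := fundamental_lemma s2 (fun phi tp => etrans (esym (Im_cint_real phi _)) (congr1 Im (E phi i tp))).
apply: ae_mono2 A1 A2 => x h1 h2 Dx.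
by apply/eqP; rewrite -subr_eq0; apply/eqP/eq_ReIm; [exact: h1 Dx|exact: h2 Dx].
Qed.

End WeakSolution.

(** * Indefinite integrals at the end points of the half-line *)

Section EndPoints.
Variable R : realType.

Lemma cvg_Rintegral_sets (w : R -> R) (F : nat -> set R) (b : bool) : intble D w ->
  (forall n, measurable (F n)) -> (forall n, F n `<=` D) ->
  (forall x, 0 < x -> \forall n \near \oo, (x \in F n) = b) ->
  \int[leb]_(x in F n) w x @[n --> \oo] --> if b then \int[leb]_(x in D) w x else 0.
Proof.
move=> iw mF FD Fb; have mD := @measurable_halfline R.
have H : \int[leb]_(x in D) ((w \_ (F n)) x) @[n --> \oo] -->
    \int[leb]_(x in D) (if b then w x else 0).
  apply: (@dominated_Rintegral _ _ _ _ (fun x => `|w x|)) => //.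
  - by move=> n; apply: measurable_patch => //; apply: measurable_funS (intble_meas iw).
  - by case: (b) => //; exact: intble_meas.
  - exact: intble_norm.
  - by move=> n x Dx; rewrite patchE; case: ifP => _; rewrite ?normr0.
  apply/aeW => x Dx; apply: cvg_near_cst; near=> n; rewrite patchE.
  rewrite (_ : (x \in F n) = b)//; near: n; exact: Fb (halfline_gt0 Dx).
rewrite (_ : (fun n => \int[leb]_(x in F n) w x) = fun n => \int[leb]_(x in D) ((w \_ (F n)) x)).
  by move: H; case: (b) => //; rewrite Rintegral_cst// mul0r.
apply/funext => n; rewrite -Rintegral_mkcondr; congr Rintegral.
by apply/esym/setIidr.
Unshelve. all: by end_near. Qed.

Lemma intble_small (u : R -> R) : intble D u -> (forall x, D x -> 0 <= u x) ->
  forall e : R, 0 < e -> exists2 r0 : R, 0 < r0 & forall r, 0 < r < r0 ->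
    \int[leb]_(x in `]0, r]) u x <= e.
Proof.
move=> iu u0 e e0; have mD := @measurable_halfline R.
have mI (c : R) : measurable (`]0, c]%classic : set R) by exact: measurable_itv.
have ID (c : R) : `]0, c]%classic `<=` D.
  by move=> x; rewrite /halfline /= !in_itv /= => /andP[->].
have H : \int[leb]_(x in `]0, n.+1%:R^-1]) u x @[n --> \oo] --> 0.
  apply: (@cvg_Rintegral_sets _ _ false) => // x x0; near=> n.
  rewrite mem_setE in_itv /= x0 /=; apply/negbTE; rewrite -ltNge; near: n.
  exact: near_invS_lt.
have [n _ /(_ n (leqnn n)) /= Hn] := cvgr0_norm_lt _ H _ e0.
exists (n.+1%:R^-1); first by rewrite invr_gt0.
move=> r /andP[r0 rn].
apply: le_trans (ltW (le_lt_trans (ler_norm _) Hn)).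
rewrite [leLHS]Rintegral_mkcond [leRHS]Rintegral_mkcond.
apply: le_Rintegral => //; try by apply: intble_restrict => //; exact: (intbleS mD).
move=> x _; rewrite !patchE !mem_setE !in_itv /=.
case: ifP => [/andP[x0 xr]|_]; first by rewrite x0 ifT// (le_trans xr)// ltW.
by case: ifP => // /andP[x0 _]; apply: u0; rewrite /halfline /= in_itv /= x0.
Unshelve. all: by end_near. Qed.

(** The parameter t is free and is optimised in [has_density_origin]. *)
Lemma le_young (W t : R) : 0 < t -> W <= t / 2 + (2 * t)^-1 * W ^+ 2.
Proof.
move=> t0; have t20 : 0 < 2 * t by rewrite mulr_gt0.
rewrite -(ler_pM2l t20) mulrDr mulVKf; last by rewrite gt_eqF.
by have := sqr_ge0 (W - t); nra.
Qed.

(** By the Cauchy-Schwarz inequality the integral of w over ]0, r] is at most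
    sqrt r times the L^2 norm of w there, and that norm tends to 0. *)
Lemma has_density_origin (u w : R -> R) : has_density u w -> sqint w ->
  exists v : R, forall e : R, 0 < e -> exists2 r0 : R, 0 < r0 &
    forall r, 0 < r < r0 -> `|u r - v| <= e * Num.sqrt r.
Proof.
move=> uw sw; have [mw iw2] := sw; have mD := @measurable_halfline R.
exists (u 1 - \int[leb]_(x in `]0, 1]) w x) => e e0.
have e20 : 0 < e ^+ 2 by rewrite exprn_gt0.
have [r0 r00 H] := intble_small iw2 (fun x _ => sqr_ge0 (w x)) e20.
exists (Num.min r0 1); first by rewrite lt_min r00 ltr01.
move=> r /andP[rp]; rewrite lt_min => /andP[rr0 r1].
have i1 : intble `]0, 1] w by exact: sqint_intble_itv.
have ir : intble `]0, r] w by exact: sqint_intble_itv.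
have mI : measurable (`]0, r]%classic : set R) by exact: measurable_itv.
have ID : `]0, r]%classic `<=` D.
  by move=> x; rewrite /halfline /= !in_itv /= => /andP[->].
have -> : u r - (u 1 - \int[leb]_(x in `]0, 1]) w x) = \int[leb]_(x in `]0, r]) w x.
  have [iw ->] := uw r 1 rp (ltW r1).
  have := @Rintegral_itvB _ w (BRight 0) (BRight 1) r i1.
  rewrite !bnd_simp => /(_ (ltW rp) (ltW r1)).
  rewrite (@Rintegral_itv_obnd_cbnd _ r).
    by move=> <-; ring.
  apply: (@intbleS _ `[r, 1]%classic) => //.
  by move=> x /=; rewrite !in_itv /= => /andP[/ltW -> ->].
apply: (le_trans (normr_Rintegral_le mI ir)).
have sr0 : 0 < Num.sqrt r by rewrite sqrtr_gt0.
have sr2 : Num.sqrt r ^+ 2 = r by rewrite sqr_sqrtr// ltW.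
(* Cauchy-Schwarz in the form |w| <= t / 2 + w^2 / (2 t), integrated over
   ]0, r], with the value of t that balances the two terms. *)
pose t := e / Num.sqrt r; have t0 : 0 < t by rewrite divr_gt0.
have iw2r := intbleS mD mI ID iw2.
have icst (c : R) : intble (`]0, r]%classic : set R) (fun=> c).
  apply: (@intbleS _ `[0, r]%classic) => //; last exact: intble_cst_itv.
  by move=> x /=; rewrite !in_itv /= => /andP[/ltW -> ->].
apply: (@le_trans _ _ (\int[leb]_(x in `]0, r]) (t / 2 + (2 * t)^-1 * w x ^+ 2))).
  apply: le_Rintegral => //; first exact: intble_norm.
    by apply: intbleD => //; exact: intbleZ.
  by move=> x _; rewrite -(real_normK (num_real (w x))); exact: le_young.
rewrite RintegralD//; last exact: intbleZ.
have cstI (c : R) : \int[leb]_(x in `]0, r]) c = c * r.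
  rewrite Rintegral_cst; last exact: measurable_itv.
  congr (_ * _); have L : leb (`]0, r]%classic : set R) = r%:E.
    by rewrite lebesgue_measure_itv /= lte_fin rp oppr0 adde0.
  exact: (congr1 fine L).
rewrite (cstI (t / 2)) RintegralZl//.
have h := H r _; rewrite rp rr0 in h; have {}h := h isT.
set A := Rintegral _ _ _ in h *.
have -> : t / 2 * r = e * Num.sqrt r / 2.
  by rewrite /t -{2}sr2; field; rewrite gt_eqF.
have -> : (2 * t)^-1 * A = (Num.sqrt r / (2 * e)) * A.
  by rewrite /t; field; rewrite !gt_eqF.
have : (Num.sqrt r / (2 * e)) * A <= (Num.sqrt r / (2 * e)) * e ^+ 2.
  by rewrite ler_wpM2l// divr_ge0// ltW// mulr_gt0.
have -> : (Num.sqrt r / (2 * e)) * e ^+ 2 = e * Num.sqrt r / 2 by field; rewrite gt_eqF.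
set B := _ * A; move: (e * Num.sqrt r) B; clear; move=> X B; lra.
Qed.

Lemma intble_exhaust (w : R -> R) : intble D w ->
  \int[leb]_(x in `[n.+1%:R^-1, n.+1%:R]) w x @[n --> \oo] --> \int[leb]_(x in D) w x.
Proof.
move=> iw; apply: (@cvg_Rintegral_sets _ _ true) => // [n|x x0].
  by apply: itv_halfline; rewrite invr_gt0.
near=> n; rewrite mem_setE in_itv /=; apply/andP; split.
  by apply/ltW; near: n; exact: near_invS_lt.
have : x <= n%:R by near: n; exact: nbhs_infty_ger.
by move/le_trans; apply; rewrite ler_nat.
Unshelve. all: by end_near. Qed.

Lemma intble_tail (w : R -> R) : intble D w ->
  \int[leb]_(x in `[n.+1%:R, n.+2%:R]) `|w x| @[n --> \oo] --> 0.
Proof.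
move=> /intble_norm iw; apply: (@cvg_Rintegral_sets _ _ false) => // [n|x x0].
  exact: itv_halfline.
near=> n; rewrite mem_setE in_itv /=; apply/negbTE; rewrite negb_and -ltNge; apply/orP; left.
have : x <= n%:R by near: n; exact: nbhs_infty_ger.
by move/le_lt_trans; apply; rewrite ltr_nat.
Unshelve. all: by end_near. Qed.

(** The integral of w over [1/n, n] is u(n) - u(1/n). At infinity, |u(n)| is at
    most the integral of |u| + |w| over [n, n + 1], the tail of a convergent
    integral. *)
Lemma has_density_boundary (u w : R -> R) (u0 : R) : has_density u w ->
  intble D u -> intble D w ->
  (forall e : R, 0 < e -> exists2 r0 : R, 0 < r0 & forall r, 0 < r < r0 -> `|u r - u0| <= e) ->
  \int[leb]_(x in D) w x = - u0.
Proof.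
move=> uw iu iw H.
have n0 n : 0 < n.+1%:R :> R by [].
have C0 : u (n.+1%:R^-1) @[n --> \oo] --> u0.
  apply/cvgrPdist_le => e e0; have [r0 r00 K] := H e e0.
  near=> n; rewrite distrC; apply: K; rewrite invr_gt0 n0 /=.
  by near: n; exact: near_invS_lt.
have Cy : u n.+1%:R @[n --> \oo] --> 0.
  have S := cvgD (intble_tail iu) (intble_tail iw); rewrite addr0 in S.
  pose T (n : nat) := \int[leb]_(x in `[n.+1%:R, n.+2%:R]) `|u x| +
    \int[leb]_(x in `[n.+1%:R, n.+2%:R]) `|w x|.
  have {}S : T @ \oo --> 0 by exact: S.
  apply/cvgr0Pnorm_le => e e0.
  move/cvgr0_norm_le : S => S.
  near=> n.
  have : `|T n| <= e by near: n; exact: S.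
  apply: le_trans; apply: le_trans (ler_norm _); rewrite /T.
  have nn : n.+1%:R <= n.+2%:R :> R by rewrite ler_nat.
  set I : set R := `[n.+1%:R, n.+2%:R]%classic.
  have mI : measurable I by exact: measurable_itv.
  have [iwI _] := uw _ _ (n0 n) nn.
  have iuI : intble I u.
    apply: (@intbleS _ D) => //; first exact: measurable_halfline.
    exact: itv_halfline.
  have one (c : R) : \int[leb]_(x in I) c = c.
    by rewrite Rintegral_cst_itv// -natrB// subSnn mulr1.
  rewrite -[leLHS]one -[X in _ + X]one -RintegralD//; first last.
  - exact: intble_cst_itv.
  - exact: intble_norm.
  apply: le_Rintegral => //; first exact: intble_cst_itv.
    by apply: intbleD => //; [exact: intble_norm|exact: intble_cst_itv].
  move=> x Ix; have := Ix; rewrite /I /= in_itv /= => /andP[nx xn].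
  have [iwx ux] := uw _ _ (n0 n) nx.
  have -> : u n.+1%:R = u x - \int[leb]_(y in `[n.+1%:R, x]) w y by rewrite ux; ring.
  apply: (le_trans (ler_normB _ _)); rewrite lerD2l.
  apply: (le_trans (normr_Rintegral_le (measurable_itv _) iwx)).
  rewrite /I (@Rintegral_itv_split _ (fun y => `|w y|) n.+1%:R x n.+2%:R) ?nx ?xn//; last exact: intble_norm.
  by rewrite lerDl; apply: Rintegral_ge0.
have C1 := cvgB Cy C0; rewrite sub0r in C1.
have E : (fun n : nat => u n.+1%:R - u (n.+1%:R^-1)) =
    (fun n : nat => \int[leb]_(x in `[n.+1%:R^-1, n.+1%:R]) w x).
  apply/funext => n.
  have le1 : (n.+1%:R : R)^-1 <= n.+1%:R.
    by apply: (@le_trans _ _ 1); rewrite ?invf_le1// ler1n.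
  have i0 : 0 < (n.+1%:R : R)^-1 by rewrite invr_gt0.
  by have [_ ->] := uw _ _ i0 le1; rewrite addrC addKr.
have C1' : (fun n : nat => u n.+1%:R - u (n.+1%:R^-1)) @ \oo --> - u0 by exact: C1.
rewrite E in C1'.
have := cvg_lim (@Rhausdorff R) (intble_exhaust iw) => <-.
exact: (cvg_lim (@Rhausdorff R)).
Unshelve. all: by end_near. Qed.

End EndPoints.

(** * Complex functions negligible against the square root at 0 *)

Section OSqrt.
Variable R : realType.

(** The l^1 norm of R^2: it is submultiplicative and avoids square roots, and
    the conditions considered here only depend on a norm up to equivalence. *)
Definition cn (z : R[i]) : R := `|Re z| + `|Im z|.

Lemma cn_ge0 z : 0 <= cn z. Proof. by rewrite addr_ge0. Qed.
Lemma cnN z : cn (- z) = cn z. Proof. by rewrite /cn !ReImE !normrN. Qed.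
Lemma cnD z w : cn (z + w) <= cn z + cn w.
Proof.
rewrite /cn !ReImE; have := ler_normD (Re z) (Re w); have := ler_normD (Im z) (Im w).
lra.
Qed.
Lemma cnB z w : cn (z - w) <= cn z + cn w.
Proof. by rewrite -(cnN w); exact: cnD. Qed.
Lemma cnM z w : cn (z * w) <= cn z * cn w.
Proof.
rewrite /cn !ReImE.
have h1 := ler_normB (Re z * Re w) (Im z * Im w).
have h2 := ler_normD (Re z * Im w) (Im z * Re w).
by move: h1 h2; rewrite !normrM; nra.
Qed.
Lemma cn_eq0 z : cn z <= 0 -> z = 0.
Proof.
rewrite /cn => h; have a := normr_ge0 (Re z); have b := normr_ge0 (Im z).
by apply: eq_ReIm; apply/eqP; rewrite -normr_eq0 eq_le normr_ge0 andbT; lra.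
Qed.

Lemma cisN_cis (x : R) : cis (- x) * cis x = 1.
Proof.
apply: eq_ReIm; rewrite !ReImE /= cosN sinN; last by ring.
by rewrite mulNr opprK -!expr2 cos2Dsin2.
Qed.

Lemma cisJ (x : R) : conjc (cis x) = cis (- x).
Proof. by apply: eq_ReIm; rewrite ReImE /= ?cosN ?sinN. Qed.

Lemma cn_cis (x : R) : cn (cis x) <= 2.
Proof.
rewrite /cn /=; have h1 := cos_le1 x; have h2 := cos_geN1 x; have h3 := sin_le1 x; have h4 := sin_geN1 x.
have : `|cos x| <= 1 by rewrite ler_norml h1 h2.
have : `|sin x| <= 1 by rewrite ler_norml h3 h4.
lra.
Qed.

Lemma vnorm_ge0 (v : 'cV[R[i]]_2) : 0 <= vnorm v.
Proof. exact: sqrtr_ge0. Qed.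

Lemma cn_vnorm (v : 'cV[R[i]]_2) i : cn (v i 0) <= 2 * vnorm v.
Proof.
have h := vnorm_sqr v; have n0 := vnorm_ge0 v.
have K (x : R) : x ^+ 2 <= vnorm v ^+ 2 -> `|x| <= vnorm v.
  by rewrite -(real_normK (num_real x)) ler_pXn2r ?nnegrE.
have a1 := sqr_ge0 (Re (v i0 0)); have a2 := sqr_ge0 (Im (v i0 0)).
have a3 := sqr_ge0 (Re (v i1 0)); have a4 := sqr_ge0 (Im (v i1 0)).
rewrite /cn mulrDl mul1r; apply: lerD; apply: K; have [->|->] := I2P i; lra.
Qed.

Lemma vnorm_cn (v : 'cV[R[i]]_2) : vnorm v <= cn (v i0 0) + cn (v i1 0).
Proof.
rewrite -(ler_pXn2r (n := 2)) ?nnegrE ?vnorm_ge0 ?addr_ge0 ?cn_ge0//.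
rewrite vnorm_sqr /cn.
rewrite -(real_normK (num_real (Re (v i0 0)))) -(real_normK (num_real (Im (v i0 0)))).
rewrite -(real_normK (num_real (Re (v i1 0)))) -(real_normK (num_real (Im (v i1 0)))).
move: (normr_ge0 (Re (v i0 0))) (normr_ge0 (Im (v i0 0))) (normr_ge0 (Re (v i1 0))) (normr_ge0 (Im (v i1 0))).
move: (`|Re (v i0 0)|) (`|Im (v i0 0)|) (`|Re (v i1 0)|) (`|Im (v i1 0)|).
by clear; move=> x y z w x0 y0 z0 w0; nra.
Qed.

(** h(r) = o(sqrt r) at 0, the precision demanded by the boundary condition. *)
Definition o_sqrt (h : R -> R[i]) : Prop := forall e : R, 0 < e ->
  exists2 r0 : R, 0 < r0 & forall r, 0 < r < r0 -> cn (h r) <= e * Num.sqrt r.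

Lemma o_sqrtD h1 h2 : o_sqrt h1 -> o_sqrt h2 -> o_sqrt (fun r => h1 r + h2 r).
Proof.
move=> H1 H2 e e0; have e20 : 0 < e / 2 by lra.
have [r1 r10 K1] := H1 _ e20; have [r2 r20 K2] := H2 _ e20.
exists (Num.min r1 r2); first by rewrite lt_min r10.
move=> r /andP[r0]; rewrite lt_min => /andP[rr1 rr2].
apply: (le_trans (cnD _ _)).
have := K1 r; rewrite r0 rr1 => /(_ isT) h1'.
have := K2 r; rewrite r0 rr2 => /(_ isT) h2'.
have : e * Num.sqrt r = e / 2 * Num.sqrt r + e / 2 * Num.sqrt r by field.
lra.
Qed.

Lemma o_sqrtM (c : R) b h : (forall r, 0 < r -> cn (b r) <= c) -> o_sqrt h ->
  o_sqrt (fun r => b r * h r).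
Proof.
move=> bc H e e0.
have c0 : 0 <= c by apply: le_trans (bc 1 ltr01); exact: cn_ge0.
have e1 : 0 < e / (c + 1) by rewrite divr_gt0// ltr_wpDl.
have [r0 r00 K] := H _ e1; exists r0 => // r rr.
apply: (le_trans (cnM _ _)).
have h1 := K r rr; have /andP[rp _] := rr; have h2 := bc r rp.
have h3 := cn_ge0 (h r); have h4 := cn_ge0 (b r).
apply: (@le_trans _ _ ((c + 1) * (e / (c + 1) * Num.sqrt r))).
  by apply: ler_pM => //; apply: (le_trans h2); rewrite lerDl.
by rewrite mulrA mulrCA divff ?mulr1// gt_eqF// ltr_wpDl.
Qed.

Lemma o_sqrt_eq h1 h2 : (forall r, 0 < r -> h1 r = h2 r) -> o_sqrt h1 -> o_sqrt h2.
Proof.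
move=> h12 H e e0; have [r0 r00 K] := H e e0; exists r0 => // r rr.
by rewrite -h12; [exact: K|case/andP: rr].
Qed.

Lemma o_sqrt_vnorm (F : R -> 'cV[R[i]]_2) :
  (vnorm (F r) * r `^ (- 2^-1) @[r --> 0^'+] --> (0 : R)) <->
  o_sqrt (fun r => F r i0 0) /\ o_sqrt (fun r => F r i1 0).
Proof.
have P (r : R) : 0 < r -> r `^ (- 2^-1) = (Num.sqrt r)^-1.
  by move=> r0; rewrite powRN powR12_sqrt// ltW.
split=> [H|[H0 H1]].
  have K i : o_sqrt (fun r => F r i 0).
    move=> e e0; have e20 : 0 < e / 2 by lra.
    have /cvgr0_norm_le H' := H.
    have [r0 /= r00 K] := H' _ e20.
    exists r0 => // r /andP[rp rr].
    have := K r; rewrite /ball_ /= sub0r normrN gtr0_norm// => /(_ rr rp).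
    rewrite P// ger0_norm; last by rewrite mulr_ge0 ?vnorm_ge0// invr_ge0 sqrtr_ge0.
    rewrite ler_pdivrMr ?sqrtr_gt0// => h.
    apply: (le_trans (cn_vnorm _ i)); rewrite -ler_pdivlMl//.
    by apply: (le_trans h); rewrite mulrA [2^-1 * e]mulrC.
  by split; exact: K.
apply/cvgr0Pnorm_le => e e0; have e20 : 0 < e / 2 by lra.
have [r1 r10 K1] := H0 _ e20; have [r2 r20 K2] := H1 _ e20.
near=> r.
have rp : 0 < r by near: r; exact: nbhs_right_gt.
have rr1 : r < r1 by near: r; exact: nbhs_right_lt.
have rr2 : r < r2 by near: r; exact: nbhs_right_lt.
rewrite P// ger0_norm; last by rewrite mulr_ge0 ?vnorm_ge0// invr_ge0 sqrtr_ge0.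
rewrite ler_pdivrMr ?sqrtr_gt0//; apply: (le_trans (vnorm_cn _)).
have := K1 r; rewrite rp rr1 => /(_ isT) h1'.
have := K2 r; rewrite rp rr2 => /(_ isT) h2'.
have : e * Num.sqrt r = e / 2 * Num.sqrt r + e / 2 * Num.sqrt r by field.
lra.
Unshelve. all: by end_near. Qed.

Lemma chd_origin (u w : R -> R[i]) : chd u w -> csq w ->
  exists v : R[i], o_sqrt (fun r => u r - v).
Proof.
move=> [h1 h2] [s1 s2].
have [a Ha] := has_density_origin h1 s1; have [b Hb] := has_density_origin h2 s2.
exists (a +i* b) => e e0; have e20 : 0 < e / 2 by lra.
have [r1 r10 K1] := Ha _ e20; have [r2 r20 K2] := Hb _ e20.
exists (Num.min r1 r2); first by rewrite lt_min r10.
move=> r /andP[rp]; rewrite lt_min => /andP[rr1 rr2].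
have := K1 r; rewrite rp rr1 => /(_ isT) h1'.
have := K2 r; rewrite rp rr2 => /(_ isT) h2'.
rewrite /cn !ReImE /=.
have : e * Num.sqrt r = e / 2 * Num.sqrt r + e / 2 * Num.sqrt r by field.
lra.
Qed.

Lemma chd_boundary (u w : R -> R[i]) (u0 : R[i]) : chd u w ->
  cintble (@halfline R) u -> cintble (@halfline R) w ->
  (forall e : R, 0 < e -> exists2 r0 : R, 0 < r0 & forall r, 0 < r < r0 -> cn (u r - u0) <= e) ->
  cint (@halfline R) w = - u0.
Proof.
move=> [h1 h2] [a1 a2] [b1 b2] H; apply: eq_ReIm; rewrite ReImE /=.
  apply: (has_density_boundary h1 a1 b1) => e e0; have [r0 r00 K] := H e e0.
  exists r0 => // r rr; have := K r rr; rewrite /cn !ReImE.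
  by apply: le_trans; rewrite lerDl.
apply: (has_density_boundary h2 a2 b2) => e e0; have [r0 r00 K] := H e e0.
exists r0 => // r rr; have := K r rr; rewrite /cn !ReImE.
by apply: le_trans; rewrite lerDr.
Qed.

End OSqrt.

(** * The frame at the origin *)

Section Frame.
Variable R : realType.
Implicit Types (f g : spinor R).

Lemma chd_cis_ln (s : R) :
  chd (fun x => cis (s * ln x)) (fun x => 'i%C * (s / x)%:C * cis (s * ln x)).
Proof.
have Dl (x : R) : 0 < x -> is_derive x 1 (fun x : R => s * ln x) (s / x).
  move=> x0; have D1 := @is_derive1_ln R x x0.
  by apply: (is_derive_eq (is_deriveZ s D1)).
have ci (x : R) : 0 < x -> {for x, continuous (fun x : R => s / x)}.
  move=> x0; apply: cvgM; first exact: cvg_cst.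
  by apply: inv_continuous; rewrite gt_eqF.
have cl (x : R) : 0 < x -> {for x, continuous (fun x : R => s * ln x)}.
  by move=> x0; apply: cvgM; [exact: cvg_cst|exact: continuous_ln].
split.
  rewrite (_ : (fun x => Re ('i%C * _ * _)) = (fun x => - (sin (s * ln x) * (s / x)))); last first.
    by apply/funext => x; rewrite !ReImE /=; ring.
  apply: has_density_derive => x x0.
    have D2 := @is_derive1_comp _ (@cos R) (fun x : R => s * ln x) x _ _ (is_derive_cos _) (Dl x x0).
    by apply: (is_derive_eq D2); ring.
  apply: cvgN; apply: cvgM; last exact: ci.
  by apply: continuous_comp; [exact: cl|exact: continuous_sin].
rewrite (_ : (fun x => Im ('i%C * _ * _)) = (fun x => cos (s * ln x) * (s / x))); last first.
  by apply/funext => x; rewrite !ReImE /=; ring.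
apply: has_density_derive => x x0.
  exact: (@is_derive1_comp _ (@sin R) (fun x : R => s * ln x) x _ _ (is_derive_sin _) (Dl x x0)).
apply: cvgM; last exact: ci.
by apply: continuous_comp; [exact: cl|exact: continuous_cos].
Qed.

Lemma cis_ln_bounded (s x : R) : `|Re (cis (s * ln x))| <= 1 /\ `|Im (cis (s * ln x))| <= 1.
Proof. by rewrite /= !ler_norml cos_le1 cos_geN1 sin_le1 sin_geN1. Qed.

Lemma csq_cis_ln (s : R) (u : R -> R[i]) : csq u -> csq (fun x => cis (s * ln x) * u x).
Proof.
move=> su; apply: (@csq_bounded _ _ _ 1) => //; first exact: chd_measurable (chd_cis_ln s).
by move=> x _; exact: cis_ln_bounded.
Qed.

Variables (m nu mu lam : R) (k : int).
Hypothesis hdelta : dirac_delta nu mu lam k < 0.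
Local Notation kap := (k%:~R + lam).
Local Notation gam := (dirac_gamma nu mu lam k).
Local Notation p := (nu + mu).
Local Notation q := (nu - mu).

(** The number kappa - i gamma: (a, - p) and (q, - a) are the eigenvectors, for
    i gamma and - i gamma, of the constant matrix of the singular part. *)
Definition dirac_a : R[i] := (lam + k%:~R)%:C - 'i%C * gam%:C.
Local Notation a := dirac_a.

Lemma gamma_gt0 : 0 < gam.
Proof. by rewrite sqrtr_gt0 normr_gt0 lt_eqF. Qed.

Lemma gamma_sqr : gam ^+ 2 = p * q - kap ^+ 2.
Proof.
rewrite sqr_sqrtr ?normr_ge0// ltr0_norm// /dirac_delta; ring.
Qed.

Lemma pq_gt0 : 0 < p * q.
Proof. by have := gamma_sqr; have := gamma_gt0; have := sqr_ge0 kap; nra. Qed.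

Lemma a_neq0 : a != 0.
Proof.
apply/eqP => /(congr1 Im); rewrite /a !ReImE /= => h.
by have := gamma_gt0; lra.
Qed.

Lemma realC_add (x y : R) : (x + y)%:C = x%:C + y%:C :> R[i].
Proof. by apply: eq_ReIm; rewrite !ReImE /=; ring. Qed.
Lemma realC_mul (x y : R) : (x * y)%:C = x%:C * y%:C :> R[i].
Proof. by apply: eq_ReIm; rewrite !ReImE /=; ring. Qed.
Lemma realC_opp (x : R) : (- x)%:C = - x%:C :> R[i].
Proof. by apply: eq_ReIm; rewrite !ReImE /=; ring. Qed.

Lemma pq_a : p%:C * q%:C - a * a = 2%:R * 'i%C * gam%:C * a.
Proof.
have h := gamma_sqr.
apply: eq_ReIm; rewrite /a !ReImE /=; first lra.
ring.
Qed.

Lemma d_neq0 : 2%:R * 'i%C * gam%:C * a != 0.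
Proof.
have n2 : 2%:R != 0 :> R[i] by rewrite pnatr_eq0.
have ni : 'i%C != 0 :> R[i] by apply/eqP => /(congr1 Im) /= /eqP; rewrite oner_eq0.
have ng : gam%:C != 0 :> R[i] by apply/eqP => /(congr1 Re) /= /eqP; rewrite gt_eqF ?gamma_gt0.
by rewrite !mulf_eq0 !negb_or n2 ni ng a_neq0.
Qed.

Definition dirac_d : R[i] := (2%:R * 'i%C * gam%:C * a)^-1.
Local Notation d := dirac_d.

Lemma d_pq : d * (p%:C * q%:C - a * a) = 1.
Proof. by rewrite pq_a mulVf// d_neq0. Qed.

Lemma dirac_D0 (v : 'cV[R[i]]_2) : (dirac_D nu mu lam k *m v) i0 0 = d * (a * v i0 0 + q%:C * v i1 0).
Proof. by rewrite /dirac_D -scalemxAl mxE mat2_0. Qed.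

Lemma dirac_D1 (v : 'cV[R[i]]_2) : (dirac_D nu mu lam k *m v) i1 0 = d * (- p%:C * v i0 0 - a * v i1 0).
Proof. by rewrite /dirac_D -scalemxAl mxE mat2_1 realC_opp !mulNr. Qed.

(** First coordinate of v in the moving frame D diag(r^(i gamma),
    r^(- i gamma)). The inverse of D is minus D without its scalar prefactor,
    since the square of that matrix is a^2 - p q. *)
Definition coord0 (v : 'cV[R[i]]_2) (r : R) : R[i] :=
  cis ((- gam) * ln r) * (- (a * v i0 0 + q%:C * v i1 0)).
Definition coord1 (v : 'cV[R[i]]_2) (r : R) : R[i] :=
  cis (gam * ln r) * (p%:C * v i0 0 + a * v i1 0).

Definition frame (c0 c1 : R[i]) (r : R) : 'cV[R[i]]_2 :=
  dirac_D nu mu lam k *m vec2 (c0 * cis (gam * ln r)) (c1 * cis (- (gam * ln r))).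

Lemma frame_coord (v : 'cV[R[i]]_2) r : frame (coord0 v r) (coord1 v r) r = v.
Proof.
rewrite /frame /coord0 /coord1 mulNr.
have h := cisN_cis (gam * ln r); have dpq := d_pq.
set e := cis (gam * ln r) in h *; set e' := cis (- _) in h *.
apply: eq_cV2.
  rewrite dirac_D0 vec2_0 vec2_1.
  transitivity (d * (p%:C * q%:C - a * a) * (e' * e) * v i0 0); first by ring.
  by rewrite dpq h !mul1r.
rewrite dirac_D1 vec2_0 vec2_1.
transitivity (d * (p%:C * q%:C - a * a) * (e' * e) * v i1 0); first by ring.
by rewrite dpq h !mul1r.
Qed.

Lemma coord0_frame c0 c1 r : coord0 (frame c0 c1 r) r = c0.
Proof.
rewrite /frame /coord0 mulNr dirac_D0 dirac_D1 vec2_0 vec2_1.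
have h := cisN_cis (gam * ln r); have dpq := d_pq.
set e := cis (gam * ln r) in h *; set e' := cis (- _) in h *.
transitivity (d * (p%:C * q%:C - a * a) * (e' * e) * c0); first by ring.
by rewrite dpq h !mul1r.
Qed.

Lemma coord1_frame c0 c1 r : coord1 (frame c0 c1 r) r = c1.
Proof.
rewrite /frame /coord1 dirac_D0 dirac_D1 vec2_0 vec2_1.
have h := cisN_cis (gam * ln r); have dpq := d_pq.
set e := cis (gam * ln r) in h *; set e' := cis (- _) in h *.
transitivity (d * (p%:C * q%:C - a * a) * (e' * e) * c1); first by ring.
by rewrite dpq h !mul1r.
Qed.

Lemma coord0B v w r : coord0 (v - w) r = coord0 v r - coord0 w r.
Proof. by rewrite /coord0 4!mxE; ring. Qed.
Lemma coord1B v w r : coord1 (v - w) r = coord1 v r - coord1 w r.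
Proof. by rewrite /coord1 4!mxE; ring. Qed.

Lemma dirac_D_unit : dirac_D nu mu lam k \in unitmx.
Proof.
suff H : dirac_D nu mu lam k *m mat2 (- a) (- q%:C) p%:C a = 1%:M.
  by have [] := mulmx1_unit H.
have dpq := d_pq.
apply/matrixP => i j; rewrite /dirac_D -scalemxAl mxE mxE sum_I2 [RHS]mxE -/a.
have [->|->] := I2P i; have [->|->] := I2P j; rewrite !mxE /= ?realC_opp -/d.
- by rewrite -[RHS]dpq; ring.
- by ring.
- by ring.
- by rewrite -[RHS]dpq; ring.
Qed.

(** The frame and its inverse are bounded on the whole half-line, because
    r^(i gamma) has modulus 1; so the boundary condition can be read on
    coordinates. *)
Lemma o_sqrt_frame (fc : spinor R) c0 c1 :
  (vnorm (fc r - frame c0 c1 r) * r `^ (- 2^-1) @[r --> 0^'+] --> (0 : R)) <->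
  o_sqrt (fun r => coord0 (fc r) r - c0) /\ o_sqrt (fun r => coord1 (fc r) r - c1).
Proof.
have cb (s : R) (c : R[i]) r : 0 < r -> cn (cis (s * ln r) * c) <= 2 * cn c.
  by move=> _; apply: (le_trans (cnM _ _)); rewrite ler_wpM2r ?cn_ge0// cn_cis.
split=> [/o_sqrt_vnorm[H0 H1]|[H0 H1]].
  split.
    apply: (@o_sqrt_eq _ (fun r => cis ((- gam) * ln r) * (- a) * (fc r - frame c0 c1 r) i0 0
       + cis ((- gam) * ln r) * (- q%:C) * (fc r - frame c0 c1 r) i1 0)).
      by move=> r r0; rewrite -[in RHS](coord0_frame c0 c1 r) -coord0B /coord0; ring.
    by apply: o_sqrtD; [apply: (o_sqrtM (cb _ _) H0)|apply: (o_sqrtM (cb _ _) H1)].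
  apply: (@o_sqrt_eq _ (fun r => cis (gam * ln r) * p%:C * (fc r - frame c0 c1 r) i0 0
     + cis (gam * ln r) * a * (fc r - frame c0 c1 r) i1 0)).
    by move=> r r0; rewrite -[in RHS](coord1_frame c0 c1 r) -coord1B /coord1; ring.
  by apply: o_sqrtD; [apply: (o_sqrtM (cb _ _) H0)|apply: (o_sqrtM (cb _ _) H1)].
have E r : fc r - frame c0 c1 r = frame (coord0 (fc r) r - c0) (coord1 (fc r) r - c1) r.
  by rewrite -[LHS](frame_coord _ r) coord0B coord1B coord0_frame coord1_frame.
apply/o_sqrt_vnorm; split.
  apply: (@o_sqrt_eq _ (fun r => cis (gam * ln r) * (d * a) * (coord0 (fc r) r - c0)
     + cis ((- gam) * ln r) * (d * q%:C) * (coord1 (fc r) r - c1))).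
    by move=> r r0; rewrite E /frame dirac_D0 vec2_0 vec2_1 mulNr; ring.
  by apply: o_sqrtD; [apply: (o_sqrtM (cb _ _) H0)|apply: (o_sqrtM (cb _ _) H1)].
apply: (@o_sqrt_eq _ (fun r => cis (gam * ln r) * (- d * p%:C) * (coord0 (fc r) r - c0)
   + cis ((- gam) * ln r) * (- d * a) * (coord1 (fc r) r - c1))).
  by move=> r r0; rewrite E /frame dirac_D1 vec2_0 vec2_1 (mulNr gam); ring.
by apply: o_sqrtD; [apply: (o_sqrtM (cb _ _) H0)|apply: (o_sqrtM (cb _ _) H1)].
Qed.

End Frame.

(** * The trace at the origin *)

Section Trace.
Variable R : realType.
Implicit Types (f g : spinor R).

(** Limits at 0 are compared through this: functions equal almost everywhere
    agree at points arbitrarily close to 0. *)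
Lemma ae_point (P : R -> Prop) : {ae leb, forall x, D x -> P x} ->
  forall r : R, 0 < r -> exists2 x, 0 < x < r & P x.
Proof.
move=> [N [mN N0 sub]] r r0; apply: contrapT => H.
have IN : `]0, r[%classic `<=` N.
  move=> x /=; rewrite in_itv /= => xr; apply: sub => /= h; apply: H; exists x => //.
  by apply: h; rewrite /halfline /= in_itv /= andbT; case/andP: xr.
have : (leb (`]0%R, r[%classic : set R) <= leb N)%E.
  by apply: le_measure; rewrite ?inE//; exact: measurable_itv.
by rewrite N0 lebesgue_measure_itv /= lte_fin r0 oppr0 adde0 lee_fin leNgt r0.
Qed.

Definition clim (h : R -> R[i]) (l : R[i]) : Prop := forall e : R, 0 < e ->
  exists2 r0 : R, 0 < r0 & forall r, 0 < r < r0 -> cn (h r - l) <= e.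

Lemma o_sqrt_clim h l : o_sqrt (fun r => h r - l) -> clim h l.
Proof.
move=> H e e0; have [r0 r00 K] := H e e0.
exists (Num.min r0 1); first by rewrite lt_min r00 ltr01.
move=> r /andP[rp]; rewrite lt_min => /andP[rr r1].
have := K r; rewrite rp rr => /(_ isT) h1; apply: (le_trans h1).
by rewrite ler_piMr ?(ltW e0)// -sqrtr1 ler_sqrt// ltW.
Qed.

Lemma climD h l h' l' : clim h l -> clim h' l' -> clim (fun r => h r + h' r) (l + l').
Proof.
move=> H H' e e0; have e20 : 0 < e / 2 by lra.
have [r1 r10 K1] := H _ e20; have [r2 r20 K2] := H' _ e20.
exists (Num.min r1 r2); first by rewrite lt_min r10.
move=> r /andP[rp]; rewrite lt_min => /andP[rr1 rr2].
have := K1 r; rewrite rp rr1 => /(_ isT) h1.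
have := K2 r; rewrite rp rr2 => /(_ isT) h2.
rewrite opprD addrACA; apply: (le_trans (cnD _ _)); lra.
Qed.

Lemma climZ c h l : clim h l -> clim (fun r => c * h r) (c * l).
Proof.
move=> H e e0.
have c1 : 0 < cn c + 1 by rewrite ltr_wpDl// cn_ge0.
have e1 : 0 < e / (cn c + 1) by rewrite divr_gt0.
have [r0 r00 K] := H _ e1; exists r0 => // r rr.
rewrite -mulrBr; apply: (le_trans (cnM _ _)).
apply: (@le_trans _ _ ((cn c + 1) * (e / (cn c + 1)))).
  by apply: ler_pM; rewrite ?cn_ge0// ?lerDl// K.
by rewrite mulrCA divff ?mulr1// gt_eqF.
Qed.

Lemma clim_eq h h' l : (forall r, 0 < r -> h r = h' r) -> clim h l -> clim h' l.
Proof.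
move=> E H e e0; have [r0 r00 K] := H e e0; exists r0 => // r rr.
by rewrite -E; [exact: K|case/andP: rr].
Qed.

Lemma climM h l h' l' : clim h l -> clim h' l' -> clim (fun r => h r * h' r) (l * l').
Proof.
move=> H H'.
have P : clim (fun r => (h r - l) * (h' r - l')) 0.
  move=> e e0; have e1 : 0 < Num.min e 1 by rewrite lt_min e0 ltr01.
  have [r1 r10 K1] := H _ e1; have [r2 r20 K2] := H' _ e1.
  exists (Num.min r1 r2); first by rewrite lt_min r10.
  move=> r /andP[rp]; rewrite lt_min => /andP[rr1 rr2].
  have := K1 r; rewrite rp rr1 => /(_ isT); rewrite le_min => /andP[h1 _].
  have := K2 r; rewrite rp rr2 => /(_ isT); rewrite le_min => /andP[_ h2].
  rewrite subr0; apply: (le_trans (cnM _ _)); rewrite -[leRHS]mulr1.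
  by apply: ler_pM => //; exact: cn_ge0.
have Q1 := climZ l H'; have Q2 := climZ l' H.
have C : clim (fun=> - (l * l')) (- (l * l')).
  by move=> e e0; exists 1 => // r _; rewrite subrr /cn /= !normr0 addr0 ltW.
have := climD (climD P Q1) (climD Q2 C).
rewrite (_ : 0 + l * l' + (l' * l + - (l * l')) = l * l'); last by ring.
by apply: clim_eq => r _; ring.
Qed.

Lemma climB h l h' l' : clim h l -> clim h' l' -> clim (fun r => h r - h' r) (l - l').
Proof.
move=> H /(climZ (-1)) H'; have := climD H H'; rewrite mulN1r.
by apply: clim_eq => r _; rewrite mulN1r.
Qed.

Lemma climJ h l : clim h l -> clim (fun r => conjc (h r)) (conjc l).
Proof.
move=> H e e0; have [r0 r00 K] := H e e0; exists r0 => // r rr.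
have := K r rr; rewrite /cn !ReImE.
by rewrite -opprD normrN.
Qed.

Variables (m nu mu lam : R) (k : int).
Hypothesis hdelta : dirac_delta nu mu lam k < 0.
Local Notation V := (dirac_V m nu mu lam k).
Local Notation kap := (k%:~R + lam).
Local Notation gam := (dirac_gamma nu mu lam k).
Local Notation p := (nu + mu).
Local Notation q := (nu - mu).
Local Notation a := (dirac_a nu mu lam k).
Local Notation Y0 := (coord0 nu mu lam k).
Local Notation Y1 := (coord1 nu mu lam k).
Local Notation dirac_ac := (dirac_ac m nu mu lam k).
Local Notation dmax := (dirac_max m nu mu lam k).

(** The trace of f is the pair of limits of its coordinates in the frame.
    Prescribing the rate o(sqrt r) makes the boundary condition a statement about
    the trace alone. *)
Definition has_trace f (c0 c1 : R[i]) : Prop := exists fc,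
  [/\ continuous_representative f fc, o_sqrt (fun r => Y0 (fc r) r - c0) &
      o_sqrt (fun r => Y1 (fc r) r - c1)].

Lemma boundary_condition_trace theta f : boundary_condition nu mu lam k theta f <->
  exists A, has_trace f (A * cis theta) (A * (Num.sqrt (p / q))%:C * cis (- theta)).
Proof.
split=> [[fc [cr [A H]]]|[A [fc [cr H0 H1]]]].
  by exists A, fc; move/(o_sqrt_frame hdelta) : H => [].
by exists fc; split => //; exists A; apply/(o_sqrt_frame hdelta).
Qed.

Lemma potR0 (r : R) (v : 'cV[R[i]]_2) : (V r *m v) i0 0 =
  (m%:C + p%:C * (r^-1)%:C) * v i0 0 + kap%:C * (r^-1)%:C * v i1 0.
Proof. by rewrite potE0 (realC_add m) (realC_mul p) add0r (realC_mul kap). Qed.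

Lemma potR1 (r : R) (v : 'cV[R[i]]_2) : (V r *m v) i1 0 =
  kap%:C * (r^-1)%:C * v i0 0 + (- m%:C + q%:C * (r^-1)%:C) * v i1 0.
Proof. by rewrite potE1 add0r (realC_add (- m)) (realC_mul q) (realC_mul kap) realC_opp. Qed.

Lemma a_kap : kap%:C = a + 'i%C * gam%:C.
Proof. by rewrite /dirac_a subrK addrC. Qed.

(** The characteristic equation a conj(a) = p q, with conj(a) = a + 2 i gamma. It
    accounts for all the cancellations below. *)
Lemma rel_pq : a * a + 2%:R * 'i%C * gam%:C * a - p%:C * q%:C = 0.
Proof. by rewrite -(pq_a hdelta); ring. Qed.

(** In the frame the singular terms in 1/r cancel, by the eigenvector relation
    [rel_pq]. What remains of the derivative is square integrable. *)
Lemma chd_coord0 f g : dirac_ac f g -> chd (fun r => Y0 (f r) r)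
  (fun r => cis ((- gam) * ln r) *
    (q%:C * (g r i0 0 - m%:C * f r i0 0) - a * (g r i1 0 + m%:C * f r i1 0))).
Proof.
move=> [h0 h1].
have := chdM (chd_cis_ln (- gam)) (chdZ (-1) (chdD (chdZ a h0) (chdZ q%:C h1))).
rewrite (_ : (fun x => cis _ * (-1 * _)) = (fun r => Y0 (f r) r)); last first.
  by apply/funext => r; rewrite mulN1r.
apply: eq_chd => r; rewrite potR0 potR1 a_kap realC_mul realC_opp.
set X := (r^-1)%:C; set e := cis _; set I := 'i%C; set G := gam%:C.
have rel := rel_pq; rewrite -/I -/G in rel.
apply/eqP; rewrite -subr_eq0; apply/eqP.
transitivity (X * e * f r i0 0 * (a * a + 2%:R * I * G * a - p%:C * q%:C)); first by ring.
by rewrite rel mulr0.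
Qed.

Lemma chd_coord1 f g : dirac_ac f g -> chd (fun r => Y1 (f r) r)
  (fun r => cis (gam * ln r) *
    (p%:C * (g r i1 0 + m%:C * f r i1 0) - a * (g r i0 0 - m%:C * f r i0 0))).
Proof.
move=> [h0 h1].
have := chdM (chd_cis_ln gam) (chdD (chdZ p%:C h0) (chdZ a h1)).
apply: eq_chd => r; rewrite potR0 potR1 a_kap realC_mul.
set X := (r^-1)%:C; set e := cis _; set I := 'i%C; set G := gam%:C.
have rel := rel_pq; rewrite -/I -/G in rel.
apply/eqP; rewrite -subr_eq0; apply/eqP.
transitivity (X * e * f r i1 0 * (a * a + 2%:R * I * G * a - p%:C * q%:C)); first by ring.
by rewrite rel mulr0.
Qed.

Lemma ac_trace f g : L2 f -> L2 g -> dirac_ac f g ->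
  exists c0 c1, o_sqrt (fun r => Y0 (f r) r - c0) /\ o_sqrt (fun r => Y1 (f r) r - c1).
Proof.
move=> /L2P Lf /L2P Lg fg.
have [|c0 H0] := chd_origin (chd_coord0 fg).
  apply: csq_cis_ln; apply: csqB; apply: csqZ.
    by apply: csqB => //; exact: csqZ.
  by apply: csqD => //; exact: csqZ.
have [|c1 H1] := chd_origin (chd_coord1 fg).
  apply: csq_cis_ln; apply: csqB; apply: csqZ.
    by apply: csqD => //; exact: csqZ.
  by apply: csqB => //; exact: csqZ.
by exists c0, c1.
Qed.

Lemma chd_continuous (u w : R -> R[i]) : chd u w -> forall r, 0 < r ->
  cn (u s - u r) @[s --> r] --> (0 : R).
Proof.
move=> [h1 h2] r r0.
have c1 := has_density_continuous h1 r0; have c2 := has_density_continuous h2 r0.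
rewrite -[X in _ --> X](addr0 0).
rewrite (_ : (fun s => cn _) = (fun s => `|Re (u s) - Re (u r)| + `|Im (u s) - Im (u r)|)); last first.
  by apply/funext => s; rewrite /cn !ReImE.
have z1 : (fun s => Re (u s) - Re (u r)) @ r --> (0 : R).
  by rewrite -(subrr (Re (u r))); apply: cvgB; [exact: c1|exact: cvg_cst].
have z2 : (fun s => Im (u s) - Im (u r)) @ r --> (0 : R).
  by rewrite -(subrr (Im (u r))); apply: cvgB; [exact: c2|exact: cvg_cst].
have := cvg_norm z1; have := cvg_norm z2; rewrite normr0 => y2 y1.
by apply: cvgD; [exact: y1|exact: y2].
Qed.

Lemma chd_continuous_representative f fc (w0 w1 : R -> R[i]) : eqL2 f fc ->
  chd (fun r => fc r i0 0) w0 -> chd (fun r => fc r i1 0) w1 -> continuous_representative f fc.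
Proof.
move=> ffc h0 h1; split => // r r0.
have C := cvgD (chd_continuous h0 r0) (chd_continuous h1 r0); rewrite addr0 in C.
apply: (@squeeze_cvgr _ _ _ _ (cst 0) (fun s => cn (fc s i0 0 - fc r i0 0) + cn (fc s i1 0 - fc r i1 0))).
- apply: nearW => s; rewrite vnorm_ge0 /=.
  by apply: (le_trans (vnorm_cn _)); rewrite 4!mxE.
- exact: cvg_cst.
- exact: C.
Qed.

Lemma trace_exists f : dom dmax f -> exists c0 c1, has_trace f c0 c1.
Proof.
move=> [g [/= Lf Lg W]]; have [fc [ffc Lfc acf]] := weak_ac Lf Lg W.
have [c0 [c1 [H0 H1]]] := ac_trace Lfc Lg acf.
exists c0, c1, fc; split => //.
exact: (chd_continuous_representative ffc acf.1 acf.2).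
Qed.

(** Two continuous representatives agree almost everywhere, hence at points that
    tend to 0. *)
Lemma trace_unique f c0 c1 c0' c1' : has_trace f c0 c1 -> has_trace f c0' c1' ->
  c0 = c0' /\ c1 = c1'.
Proof.
move=> [fc [[ffc _] H0 H1]] [fc' [[ffc' _] H0' H1']].
have E : {ae leb, forall x, D x -> fc x = fc' x}.
  by apply: ae_mono2 ffc ffc' => x h h' Dx; rewrite -h// h'.
have K (h h' : R -> R[i]) (c c' : R[i]) : o_sqrt (fun r => h r - c) -> o_sqrt (fun r => h' r - c') ->
    (forall r, fc r = fc' r -> h r = h' r) -> c = c'.
  move=> /o_sqrt_clim H /o_sqrt_clim H' hh.
  apply/eqP; rewrite -subr_eq0; apply/eqP/cn_eq0/ler_addgt0Pl => e e0; rewrite addr0.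
  have e20 : 0 < e / 2 by lra.
  have [r1 r10 K1] := H _ e20; have [r2 r20 K2] := H' _ e20.
  have m0 : 0 < Num.min r1 r2 by rewrite lt_min r10.
  have [x /andP[x0]] := ae_point E m0; rewrite lt_min => /andP[xr1 xr2] Ex.
  have := K1 x; rewrite x0 xr1 => /(_ isT) k1.
  have := K2 x; rewrite x0 xr2 => /(_ isT) k2.
  rewrite (_ : c - c' = (h' x - c') - (h x - c)); last by rewrite (hh x Ex); ring.
  by apply: (le_trans (cnB _ _)); lra.
by split; [apply: K H0 H0' _ => r ->|apply: K H1 H1' _ => r ->].
Qed.

Lemma continuous_representative_linear (al : R[i]) f fc f' fc' :
  continuous_representative f fc -> continuous_representative f' fc' ->
  continuous_representative (fun x => al *: f x + f' x) (fun x => al *: fc x + fc' x).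
Proof.
move=> [e1 c1] [e2 c2]; split; first by apply: ae_mono2 e1 e2 => x h h' Dx; rewrite h// h'.
move=> r r0.
have C := cvgD (cvgM (cvg_cst (4 * cn al : R^o)) (c1 r r0)) (cvgM (cvg_cst (4 : R^o)) (c2 r r0)).
rewrite !mulr0 addr0 in C.
apply: (@squeeze_cvgr _ _ _ _ (cst 0) (fun s => 4 * cn al * vnorm (fc s - fc r) + 4 * vnorm (fc' s - fc' r))).
- apply: nearW => s; rewrite vnorm_ge0 /=.
  apply: (le_trans (vnorm_cn _)).
  have K i : cn ((al *: fc s + fc' s - (al *: fc r + fc' r)) i 0) <=
      2 * cn al * vnorm (fc s - fc r) + 2 * vnorm (fc' s - fc' r).
    rewrite (_ : al *: fc s + fc' s - _ = al *: (fc s - fc r) + (fc' s - fc' r)); last first.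
      by rewrite scalerBr opprD addrACA.
    rewrite mxE [X in X + _]mxE; apply: (le_trans (cnD _ _)); apply: lerD; last exact: cn_vnorm.
    apply: (le_trans (cnM _ _)); rewrite -mulrA mulrCA ler_wpM2l ?cn_ge0//.
    exact: cn_vnorm.
  have := K i0; have := K i1.
  set A := cn _; set B := cn ((_ : 'cV__) i0 0); set X := vnorm _; set Y := vnorm _; set C' := cn al.
  move: A B X Y C'; clear; move=> A B X Y C' h1 h2.
  have -> : 4 * C' * X + 4 * Y = (2 * C' * X + 2 * Y) + (2 * C' * X + 2 * Y) by ring.
  exact: lerD.
- exact: cvg_cst.
- exact: C.
Qed.

Lemma trace_linear (al : R[i]) f f' c0 c1 c0' c1' : has_trace f c0 c1 -> has_trace f' c0' c1' ->
  has_trace (fun x => al *: f x + f' x) (al * c0 + c0') (al * c1 + c1').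
Proof.
move=> [fc [cr H0 H1]] [fc' [cr' H0' H1']].
have bal (r : R) : 0 < r -> cn (cst al r) <= cn al by [].
exists (fun x => al *: fc x + fc' x); split; first exact: continuous_representative_linear.
  apply: (o_sqrt_eq _ (o_sqrtD (o_sqrtM bal H0) H0')) => r _.
  by rewrite /cst /coord0 4!mxE; ring.
apply: (o_sqrt_eq _ (o_sqrtD (o_sqrtM bal H1) H1')) => r _.
by rewrite /cst /coord1 4!mxE; ring.
Qed.

Lemma trace_ae f f' c0 c1 : eqL2 f f' -> has_trace f c0 c1 -> has_trace f' c0 c1.
Proof.
move=> ff [fc [[e c] H0 H1]]; exists fc; split => //; split => //.
by apply: ae_mono2 ff e => x h h' Dx; rewrite -h// h'.
Qed.

End Trace.

(** * Green's formula *)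

Section Lagrange.
Variable R : realType.
Implicit Types (f g : spinor R).

Variables (m nu mu lam : R) (k : int).
Hypothesis hdelta : dirac_delta nu mu lam k < 0.
Local Notation gam := (dirac_gamma nu mu lam k).
Local Notation p := (nu + mu).
Local Notation q := (nu - mu).
Local Notation a := (dirac_a nu mu lam k).
Local Notation d := (dirac_d nu mu lam k).
Local Notation Y0 := (coord0 nu mu lam k).
Local Notation Y1 := (coord1 nu mu lam k).
Local Notation dirac_ac := (dirac_ac m nu mu lam k).
Local Notation dmax := (dirac_max m nu mu lam k).
Local Notation has_trace := (has_trace nu mu lam k).

(** This is f^* J g, where J is the matrix of the derivative term. *)
Definition wronskian (f g : 'cV[R[i]]_2) : R[i] :=
  conjc (f i1 0) * g i0 0 - conjc (f i0 0) * g i1 0.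

(** The Wronskian in terms of the coordinates in the frame; it is a nonzero
    multiple of an indefinite Hermitian form. *)
Definition boundary_form (c0 c1 e0 e1 : R[i]) : R[i] :=
  d * conjc d * (2%:R * 'i%C * gam%:C) * (p%:C * conjc c0 * e0 - q%:C * conjc c1 * e1).

Lemma inner_dot f g : inner f g =
  cint D (fun x => conjc (f x i0 0) * g x i0 0 + conjc (f x i1 0) * g x i1 0).
Proof. by apply: eq_cint => x _; rewrite sum_I2. Qed.

Lemma realCJ (x : R) : conjc x%:C = x%:C :> R[i].
Proof. by apply: eq_ReIm; rewrite !ReImE //= oppr0. Qed.

Lemma cjD (x y : R[i]) : conjc (x + y) = conjc x + conjc y. Proof. exact: rmorphD. Qed.
Lemma cjN (x : R[i]) : conjc (- x) = - conjc x. Proof. exact: rmorphN. Qed.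
Lemma cjM (x y : R[i]) : conjc (x * y) = conjc x * conjc y. Proof. exact: rmorphM. Qed.
Definition cjE := (cjD, cjN, cjM, realCJ).

(** The potential is a real symmetric matrix, so its contributions cancel. *)
Lemma chd_wronskian f g f' g' : dirac_ac f g -> dirac_ac f' g' ->
  chd (fun x => wronskian (f x) (f' x))
    (fun x => (conjc (f x i0 0) * g' x i0 0 + conjc (f x i1 0) * g' x i1 0) -
      (conjc (g x i0 0) * f' x i0 0 + conjc (g x i1 0) * f' x i1 0)).
Proof.
move=> [h0 h1] [h0' h1'].
have := chdD (chdM (chdJ h1) h0') (chdZ (-1) (chdM (chdJ h0) h1')).
rewrite (_ : (fun x => _ + -1 * _) = (fun x => wronskian (f x) (f' x))); last first.
  by apply/funext => x; rewrite mulN1r.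
apply: eq_chd => x; rewrite !potR0 !potR1 !cjE; ring.
Qed.

(** In the coordinates the cross terms carry r^(2 i gamma) and r^(-2 i gamma);
    their common factor vanishes by [rel_pq], so that the expression does not
    depend on r. *)
Lemma wronskian_coord (v w : 'cV[R[i]]_2) r :
  wronskian v w = boundary_form (Y0 v r) (Y1 v r) (Y0 w r) (Y1 w r).
Proof.
rewrite -[in LHS](frame_coord hdelta v r) -[in LHS](frame_coord hdelta w r).
move: (Y0 v r) (Y1 v r) (Y0 w r) (Y1 w r) => c0 c1 e0 e1.
rewrite /wronskian /frame !dirac_D0 !dirac_D1 !vec2_0 !vec2_1 /boundary_form.
have h := cisN_cis (gam * ln r).
have aJ : conjc a = a + 2%:R * 'i%C * gam%:C.
  by apply: eq_ReIm; rewrite /dirac_a !ReImE /=; ring.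
have rel := rel_pq hdelta.
move: aJ rel; move: (a) (d) => A B aJ rel.
rewrite !cjE !cisJ !opprK.
set e := cis (gam * ln r) in h *; set e' := cis (- _) in h *.
rewrite aJ -[RHS]mulr1 -[X in _ = _ * X]h.
apply/eqP; rewrite -subr_eq0; apply/eqP.
transitivity (B * conjc B * (conjc c1 * e0 * e * e - conjc c0 * e1 * e' * e') *
  - (A * A + 2%:R * 'i%C * gam%:C * A - p%:C * q%:C)); first by ring.
by rewrite rel oppr0 mulr0.
Qed.

Lemma eqL2_refl f : eqL2 f f.
Proof. exact/aeW. Qed.

Lemma inner_ae f f' g g' : L2 f -> L2 f' -> L2 g -> L2 g' -> eqL2 f f' -> eqL2 g g' ->
  inner f g = inner f' g'.
Proof.
move=> Lf Lf' Lg Lg' ff gg; rewrite !inner_dot; apply: eq_ae_cint.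
- by apply: cmeasurableD; apply: cmeasurableM; first [exact: (cmeasurableJ (L2_cmeasurable Lf _))|exact: (L2_cmeasurable Lg)].
- by apply: cmeasurableD; apply: cmeasurableM; first [exact: (cmeasurableJ (L2_cmeasurable Lf' _))|exact: (L2_cmeasurable Lg')].
- by apply: ae_mono2 ff gg => x h h' Dx; rewrite h// h'.
Qed.

Lemma L2_dot f g : L2 f -> L2 g ->
  cintble D (fun x => conjc (f x i0 0) * g x i0 0 + conjc (f x i1 0) * g x i1 0).
Proof.
move=> /L2P Lf /L2P Lg; apply: cintbleD; first exact: measurable_halfline.
  by apply: csqM => //; exact: csqJ.
by apply: csqM => //; exact: csqJ.
Qed.

Lemma trace_of_ac f fc g c0 c1 : eqL2 f fc -> L2 fc -> L2 g -> dirac_ac fc g -> has_trace f c0 c1 ->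
  o_sqrt (fun r => Y0 (fc r) r - c0) /\ o_sqrt (fun r => Y1 (fc r) r - c1).
Proof.
move=> ffc Lfc Lg acf T; have [e0 [e1 [H0 H1]]] := ac_trace hdelta Lfc Lg acf.
have [-> ->] : c0 = e0 /\ c1 = e1; last by [].
apply: (trace_unique T); exists fc; split => //.
exact: (chd_continuous_representative ffc acf.1 acf.2).
Qed.

(** The density of the Wronskian is the difference of the two integrands; the
    Wronskian tends to [boundary_form] at 0 and to 0 at infinity. *)
Lemma lagrange_identity f g f' g' c0 c1 e0 e1 : dmax (f, g) -> dmax (f', g') ->
  has_trace f c0 c1 -> has_trace f' e0 e1 ->
  inner g f' = inner f g' + boundary_form c0 c1 e0 e1.
Proof.
move=> [/= Lf Lg W] [/= Lf' Lg' W'] T T'.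
have [fc [ffc Lfc acf]] := weak_ac Lf Lg W.
have [fc' [ffc' Lfc' acf']] := weak_ac Lf' Lg' W'.
have [H0 H1] := trace_of_ac ffc Lfc Lg acf T.
have [H0' H1'] := trace_of_ac ffc' Lfc' Lg' acf' T'.
rewrite (inner_ae Lg Lg Lf' Lfc' (eqL2_refl g) ffc').
rewrite (inner_ae Lf Lfc Lg' Lg' ffc (eqL2_refl g')).
have mD := @measurable_halfline R.
have B := chd_boundary (u0 := boundary_form c0 c1 e0 e1) (chd_wronskian acf acf').
have C : cint D (fun x => (conjc (fc x i0 0) * g' x i0 0 + conjc (fc x i1 0) * g' x i1 0) -
      (conjc (g x i0 0) * fc' x i0 0 + conjc (g x i1 0) * fc' x i1 0)) = - boundary_form c0 c1 e0 e1.
  apply: B.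
  - move/L2P: Lfc => lf; move/L2P: Lfc' => lf'.
    by apply: cintbleB => //; apply: csqM => //; exact: csqJ.
  - by apply: cintbleB => //; exact: L2_dot.
  - have K : clim (fun r => wronskian (fc r) (fc' r)) (boundary_form c0 c1 e0 e1).
      apply: (@clim_eq _ (fun r => boundary_form (Y0 (fc r) r) (Y1 (fc r) r) (Y0 (fc' r) r) (Y1 (fc' r) r))).
        by move=> r _; rewrite -wronskian_coord.
      by apply: climZ; apply: climB; apply: climM;
        [apply: climZ; apply: climJ| |apply: climZ; apply: climJ|]; exact: o_sqrt_clim.
    exact: K.
move: C; rewrite cintB//; try exact: L2_dot.
rewrite -!inner_dot => /eqP; rewrite subr_eq => /eqP ->.
by rewrite addrAC addNr add0r.
Qed.

End Lagrange.

(** * The minimal operator *)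

Section MinimalOperator.
Variable R : realType.
Implicit Types (f g : spinor R).

Definition test_spinor f := forall i, test_function (fun x => f x i 0).

Lemma chd_test_cderive (phi : R -> R[i]) : test_function phi -> chd phi (cderive phi).
Proof.
move=> /test_functionP[[s1 _] [s2 _]]; split; apply: has_density_derive => x _.
- exact: smooth_is_derive.
- exact: (smooth_continuous (smooth_derive1 s1)).
- exact: smooth_is_derive.
- exact: (smooth_continuous (smooth_derive1 s2)).
Qed.

Lemma test_spinor_L2 f : test_spinor f -> L2 f.
Proof. by move=> tf; apply/L2P => i; exact: test_csq. Qed.

Variables (m nu mu lam : R) (k : int).
Local Notation V := (dirac_V m nu mu lam k).
Local Notation dmax := (dirac_max m nu mu lam k).
Local Notation dmin := (dirac_min m nu mu lam k).
Local Notation H := (dirac_expr m nu mu lam k).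

Lemma dirac_expr0 f r : H f r i0 0 = - cderive (fun x => f x i1 0) r + (V r *m f r) i0 0.
Proof. by rewrite /dirac_expr mxE JE0 mxE. Qed.

Lemma dirac_expr1 f r : H f r i1 0 = cderive (fun x => f x i0 0) r + (V r *m f r) i1 0.
Proof. by rewrite /dirac_expr mxE JE1 mxE. Qed.

Lemma test_expr_L2 f : test_spinor f -> L2 (H f).
Proof.
move=> tf; apply/L2P => i; have [->|->] := I2P i.
  rewrite (funext (fun x => dirac_expr0 f x)); apply: csqD.
    by apply: csqN; exact: test_cderive_csq.
  rewrite (funext (fun x => potE0 m nu mu lam k x (f x))).
  by apply: csqD; exact: test_pot_csq.
rewrite (funext (fun x => dirac_expr1 f x)); apply: csqD; first exact: test_cderive_csq.
rewrite (funext (fun x => potE1 m nu mu lam k x (f x))).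
by apply: csqD; exact: test_pot_csq.
Qed.

Lemma test_expr_ac f : test_spinor f -> dirac_ac m nu mu lam k f (H f).
Proof.
move=> tf; split.
  by apply: eq_chd (chd_test_cderive (tf i0)) => x; rewrite dirac_expr1 addrK.
have := chd_test_cderive (tf i1); apply: eq_chd => x; rewrite dirac_expr0; ring.
Qed.

Lemma test_dmin f : test_spinor f -> dmin (f, H f).
Proof.
move=> tf; split => /=; [exact: test_spinor_L2|exact: test_expr_L2|].
by exists f; split => //; exact: eqL2_refl.
Qed.

Lemma eqL2_sym f g : eqL2 f g -> eqL2 g f.
Proof. by move=> fg; apply: ae_mono fg => x h Dx; rewrite h. Qed.

Lemma dmin_dmax : dmin `<=` dmax.
Proof.
move=> [f g] [/= Lf Lg [phi [tp fp gp]]]; split => //=.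
apply: (dirac_weak_ae (test_spinor_L2 tp) (test_expr_L2 tp) Lf Lg).
- exact: eqL2_sym.
- exact: eqL2_sym.
- by apply: ac_weak; [exact: test_spinor_L2|exact: test_expr_L2|exact: test_expr_ac].
Qed.

(** A test spinor vanishes near 0. *)
Lemma dmin_trace f : dom dmin f -> has_trace nu mu lam k f 0 0.
Proof.
move=> [g [/= Lf Lg [phi [tp fp gp]]]]; have acp := test_expr_ac tp.
have [r0 r00 z] : exists2 r0 : R, 0 < r0 & forall r, 0 < r < r0 -> phi r = 0.
  have [_ _ [a0 [b0 [a00 h0]]]] := tp i0; have [_ _ [a1 [b1 [a10 h1]]]] := tp i1.
  exists (Num.min a0 a1); first by rewrite lt_min a00.
  move=> r /andP[rp]; rewrite lt_min => /andP[ra0 ra1]; apply: eq_cV2; rewrite mxE.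
    by apply/eqP; apply: contraTT ra0 => /h0 /andP[? _]; rewrite -leNgt.
  by apply/eqP; apply: contraTT ra1 => /h1 /andP[? _]; rewrite -leNgt.
exists phi; split.
- exact: (chd_continuous_representative fp acp.1 acp.2).
- move=> e e0; exists r0 => // r rr; rewrite (z r rr) /coord0 !mxE !mulr0 addr0 oppr0 mulr0 addr0.
  by rewrite /cn /= !normr0 addr0 mulr_ge0// ?sqrtr_ge0// ltW.
- move=> e e0; exists r0 => // r rr; rewrite (z r rr) /coord1 !mxE !mulr0 addr0 mulr0 subr0.
  by rewrite /cn /= !normr0 addr0 mulr_ge0// ?sqrtr_ge0// ltW.
Qed.

Lemma dmin_dense : densely_defined dmin.
Proof.
move=> f Lf e e0; have mD := @measurable_halfline R.
have lf := (L2P f).1 Lf.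
have e40 : 0 < e / 4 by lra.
have [sr0 si0] := lf i0; have [sr1 si1] := lf i1.
have [p1 [t1 h1]] := sqint_dense sr0 e40; have [p2 [t2 h2]] := sqint_dense si0 e40.
have [p3 [t3 h3]] := sqint_dense sr1 e40; have [p4 [t4 h4]] := sqint_dense si1 e40.
pose g : spinor R := fun x => vec2 (p1 x +i* p2 x) (p3 x +i* p4 x).
have tg : test_spinor g.
  move=> i; apply/test_functionP; have [->|->] := I2P i.
    by split; [move: t1|move: t2]; congr rtest; apply/funext => x; rewrite vec2_0.
  by split; [move: t3|move: t4]; congr rtest; apply/funext => x; rewrite vec2_1.
exists g; first by exists (H g); exact: test_dmin.
have j1 := (sqintB sr0 (rtest_sqint t1)).2; have j2 := (sqintB si0 (rtest_sqint t2)).2.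
have j3 := (sqintB sr1 (rtest_sqint t3)).2; have j4 := (sqintB si1 (rtest_sqint t4)).2.
have J := intbleD mD (intbleD mD j1 j2) (intbleD mD j3 j4).
rewrite /L2sqnorm.
have -> : (\int[leb]_(x in D) ((vnorm (f x - g x)) ^+ 2)%:E =
  \int[leb]_(x in D) (((Re (f x i0 0) - p1 x) ^+ 2 + (Im (f x i0 0) - p2 x) ^+ 2) +
   ((Re (f x i1 0) - p3 x) ^+ 2 + (Im (f x i1 0) - p4 x) ^+ 2))%:E)%E.
  by apply: eq_integral => x _; rewrite vnorm_sqr !mxE /= !ReImE.
rewrite -(fineK (integrable_fin_num _ J))// lte_fin.
rewrite -/(Rintegral _ _ _) RintegralD//; try exact: intbleD.
rewrite RintegralD// RintegralD//.
set a1 := Rintegral _ _ _ in h1 *; set a2 := Rintegral _ _ _ in h2 *.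
set a3 := Rintegral _ _ _ in h3 *; set a4 := Rintegral _ _ _ in h4 *.
move: (a1) (a2) (a3) (a4) h1 h2 h3 h4; clear; move=> x y z w *; lra.
Qed.

(** Pairing with the test spinors conj(phi) e_i, which are in the domain of every
    extension of h, is exactly the weak equation for component i. *)
Lemma adjoint_max (t : graph R) : dmin `<=` t -> adjoint t `<=` dmax.
Proof.
move=> mt [f g] [/= Lf Lg Ha]; split => //=.
have mD := @measurable_halfline R.
have lf := (L2P f).1 Lf; have lg := (L2P g).1 Lg.
have z0 := @test_function0 R; have c0 := @cderive0 R.
apply/dirac_weakP => // phi tp; have tJ := test_functionJ tp.
have dJ := cderiveJ tp.
have p0 := test_pot_cintble m nu mu lam k i0 tp Lf; have p1 := test_pot_cintble m nu mu lam k i1 tp Lf.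
have q0 := csqM (test_cderive_csq tp) (lf i0); have q1 := csqM (test_cderive_csq tp) (lf i1).
split.
  pose Phi : spinor R := fun x => vec2 (conjc (phi x)) 0.
  have P0 : (fun x => Phi x i0 0) = (fun x => conjc (phi x)) by apply/funext => x; rewrite vec2_0.
  have P1 : (fun x => Phi x i1 0) = (fun=> 0) by apply/funext => x; rewrite vec2_1.
  have tP : test_spinor Phi by move=> i; have [->|->] := I2P i; rewrite ?P0 ?P1.
  have := Ha _ _ (mt _ (test_dmin tP)); rewrite !inner_dot.
  rewrite (@eq_cint _ _ _ (fun x => phi x * (V x *m f x) i0 0 + cderive phi x * f x i1 0)); last first.
    move=> x _; rewrite dirac_expr0 dirac_expr1 P0 P1 c0 /= !potR0 !potR1 vec2_0 vec2_1 dJ.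
    by rewrite !cjE !conjcK ?conjc0; ring.
  rewrite [X in _ = X](@eq_cint _ _ _ (fun x => phi x * g x i0 0)); last first.
    by move=> x _; rewrite vec2_0 vec2_1 ?conjcK ?conjc0; ring.
  by rewrite cintD// => <-; rewrite addrC addKr.
pose Phi : spinor R := fun x => vec2 0 (conjc (phi x)).
have P0 : (fun x => Phi x i0 0) = (fun=> 0) by apply/funext => x; rewrite vec2_0.
have P1 : (fun x => Phi x i1 0) = (fun x => conjc (phi x)) by apply/funext => x; rewrite vec2_1.
have tP : test_spinor Phi by move=> i; have [->|->] := I2P i; rewrite ?P0 ?P1.
have := Ha _ _ (mt _ (test_dmin tP)); rewrite !inner_dot.
rewrite (@eq_cint _ _ _ (fun x => phi x * (V x *m f x) i1 0 - cderive phi x * f x i0 0)); last first.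
  move=> x _; rewrite dirac_expr0 dirac_expr1 P0 P1 c0 /= !potR0 !potR1 vec2_0 vec2_1 dJ.
  by rewrite !cjE !conjcK ?conjc0; ring.
rewrite [X in _ = X](@eq_cint _ _ _ (fun x => phi x * g x i1 0)); last first.
  by move=> x _; rewrite vec2_0 vec2_1 ?conjcK ?conjc0; ring.
by rewrite cintB// => <-; rewrite opprB addrC subrK.
Qed.

End MinimalOperator.

(** * Surjectivity of the trace *)

Section Surjectivity.
Variable R : realType.
Implicit Types (f g : spinor R).

(** Smooth, equal to 1 on ]0, 1] and to 0 beyond 2. *)
Definition cutoff (x : R) : R := 1 - (bump_mass R)^-1 * stepf (1 * (x - 1)).
Definition cutoff' (x : R) : R := - (bump_mass R)^-1 * (1 * bumpf (1 * (x - 1))).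

Lemma has_density_cutoff : has_density cutoff cutoff'.
Proof.
have := has_densityD (has_density_cst 1) (has_densityZ (- (bump_mass R)^-1) (has_density_step 1 1)).
rewrite (_ : (fun x => 0 + _) = cutoff'); last by apply/funext => x; rewrite add0r.
by congr has_density; apply/funext => x; rewrite mulNr.
Qed.

Lemma cutoff_le1 (x : R) : x <= 1 -> cutoff x = 1.
Proof. by move=> x1; rewrite /cutoff step_le0 ?mulr0 ?subr0// mul1r subr_le0. Qed.

Lemma cutoff_sqint : sqint cutoff.
Proof.
have m0 := bump_mass_gt0 R.
apply: (@sqint_support _ _ 0 2 1).
- by apply: has_density_measurable has_density_cutoff => //; exact: measurable_halfline.
- move=> x _; rewrite /cutoff.
  have /andP[h1 h2] := step_bound (1 * (x - 1)).
  have : 0 <= (bump_mass R)^-1 * stepf (1 * (x - 1)) <= 1.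
    by rewrite mulr_ge0 ?invr_ge0 ?(ltW m0)//= ler_pdivrMl// mulr1.
  by move=> /andP[h3 h4]; rewrite ler_norml; lra.
- move=> x; rewrite /halfline /= in_itv /= andbT => x0 nz.
  rewrite (ltW x0) /=; apply: contraNT nz; rewrite -ltNge => x2.
  have x1 : 1 <= 1 * (x - 1) by rewrite mul1r lerBrDr; apply: le_trans (ltW x2); rewrite -natr1.
  by rewrite /cutoff step_ge1// mulVf ?subrr// gt_eqF.
Qed.

Lemma cutoff'_sqint : sqint cutoff'.
Proof.
have := sqintZ (- (bump_mass R)^-1) (rtest_sqint (rtest_bumpf (N := 1) (x := 1) ltr01 ltr01)).
by [].
Qed.

Variables (m nu mu lam : R) (k : int).
Hypothesis hdelta : dirac_delta nu mu lam k < 0.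
Local Notation kap := (k%:~R + lam).
Local Notation gam := (dirac_gamma nu mu lam k).
Local Notation p := (nu + mu).
Local Notation q := (nu - mu).
Local Notation a := (dirac_a nu mu lam k).
Local Notation d := (dirac_d nu mu lam k).
Local Notation dmax := (dirac_max m nu mu lam k).
Local Notation frame := (frame nu mu lam k).

Lemma frame0 c0 c1 r : frame c0 c1 r i0 0 =
  d * a * c0 * cis (gam * ln r) + d * q%:C * c1 * cis ((- gam) * ln r).
Proof. by rewrite /frame dirac_D0 vec2_0 vec2_1 (mulNr gam); ring. Qed.

Lemma frame1 c0 c1 r : frame c0 c1 r i1 0 =
  - d * p%:C * c0 * cis (gam * ln r) + - d * a * c1 * cis ((- gam) * ln r).
Proof. by rewrite /frame dirac_D1 vec2_0 vec2_1 (mulNr gam); ring. Qed.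

Lemma chd_frame0 c0 c1 : chd (fun r => frame c0 c1 r i0 0)
  (fun r => - (r^-1)%:C * (kap%:C * frame c0 c1 r i0 0 + q%:C * frame c0 c1 r i1 0)).
Proof.
rewrite (funext (frame0 c0 c1)).
have := chdD (chdZ (d * a * c0) (chd_cis_ln gam)) (chdZ (d * q%:C * c1) (chd_cis_ln (- gam))).
apply: eq_chd => r; rewrite frame0 frame1 (a_kap nu mu lam k) !realC_mul realC_opp.
have rel := rel_pq hdelta.
set e := cis _; set e' := cis _; set X := (r^-1)%:C.
apply/eqP; rewrite -subr_eq0; apply/eqP.
transitivity (X * d * c0 * e * (a * a + 2%:R * 'i%C * gam%:C * a - p%:C * q%:C)); first by ring.
by rewrite rel mulr0.
Qed.

Lemma chd_frame1 c0 c1 : chd (fun r => frame c0 c1 r i1 0)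
  (fun r => (r^-1)%:C * (p%:C * frame c0 c1 r i0 0 + kap%:C * frame c0 c1 r i1 0)).
Proof.
rewrite (funext (frame1 c0 c1)).
have := chdD (chdZ (- d * p%:C * c0) (chd_cis_ln gam)) (chdZ (- d * a * c1) (chd_cis_ln (- gam))).
apply: eq_chd => r; rewrite frame0 frame1 (a_kap nu mu lam k) !realC_mul realC_opp.
have rel := rel_pq hdelta.
set e := cis _; set e' := cis _; set X := (r^-1)%:C.
apply/eqP; rewrite -subr_eq0; apply/eqP.
transitivity (X * d * c1 * e' * (a * a + 2%:R * 'i%C * gam%:C * a - p%:C * q%:C)); first by ring.
by rewrite rel mulr0.
Qed.

Lemma csq_real (u : R -> R) : sqint u -> csq (fun x => (u x)%:C).
Proof. by move=> su; split => //; exact: sqint0. Qed.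

Lemma csq_frame (u : R -> R) c0 c1 i : sqint u -> csq (fun r => (u r)%:C * frame c0 c1 r i 0).
Proof.
move=> /csq_real su; have [->|->] := I2P i.
  apply: eq_csq (csqD (csqZ (d * a * c0) (csq_cis_ln gam su)) (csqZ (d * q%:C * c1) (csq_cis_ln (- gam) su))) => r.
  by rewrite frame0; ring.
apply: eq_csq (csqD (csqZ (- d * p%:C * c0) (csq_cis_ln gam su)) (csqZ (- d * a * c1) (csq_cis_ln (- gam) su))) => r.
by rewrite frame1; ring.
Qed.

(** The columns of the frame solve the homogeneous equation without mass term.
    Multiplied by a cutoff they are in the domain of h^*, and their coordinates
    are constant on ]0, 1[. *)
Lemma trace_surjective c0 c1 : exists2 f, dom dmax f & has_trace nu mu lam k f c0 c1.
Proof.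
pose E := frame c0 c1.
pose f : spinor R := fun r => (cutoff r)%:C *: E r.
(* The derivative of the cutoff and the mass are the only terms that survive. *)
pose g : spinor R := fun r => vec2 (m%:C * f r i0 0 - (cutoff' r)%:C * E r i1 0)
  ((cutoff' r)%:C * E r i0 0 - m%:C * f r i1 0).
have fE r i : f r i 0 = (cutoff r)%:C * E r i 0 by rewrite mxE.
have Lf : L2 f.
  apply/L2P => i; rewrite (funext (fun r => fE r i)); apply: csq_frame; exact: cutoff_sqint.
have Lg : L2 g.
  apply/L2P => i; have [->|->] := I2P i.
    rewrite (_ : (fun x => _) = fun r => m%:C * f r i0 0 - (cutoff' r)%:C * E r i1 0); last first.
      by apply/funext => r; rewrite vec2_0.
    apply: csqB; first by apply: csqZ; exact: (L2P f).1.
    by apply: csq_frame; exact: cutoff'_sqint.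
  rewrite (_ : (fun x => _) = fun r => (cutoff' r)%:C * E r i0 0 - m%:C * f r i1 0); last first.
    by apply/funext => r; rewrite vec2_1.
  apply: csqB; last by apply: csqZ; exact: (L2P f).1.
  by apply: csq_frame; exact: cutoff'_sqint.
have hc : chd (fun r => (cutoff r)%:C) (fun r => (cutoff' r)%:C).
  by split; [exact: has_density_cutoff|exact: has_density_cst].
have acf : dirac_ac m nu mu lam k f g.
  split.
    rewrite (funext (fun r => fE r i0)).
    apply: eq_chd (chdM hc (chd_frame0 c0 c1)) => r.
    by rewrite vec2_1 potR1 !fE -/(E r); ring.
  rewrite (funext (fun r => fE r i1)).
  apply: eq_chd (chdM hc (chd_frame1 c0 c1)) => r.
  by rewrite vec2_0 potR0 !fE -/(E r); ring.
exists f; first by exists g; split => //; exact: ac_weak.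
have f1 r : 0 < r < 1 -> f r = E r.
  by move=> /andP[_ r1]; rewrite /f cutoff_le1 ?(ltW r1)// scale1r.
exists f; split.
- exact: (chd_continuous_representative (eqL2_refl f) acf.1 acf.2).
- move=> e e0; exists 1 => // r rr; rewrite f1// (coord0_frame hdelta) subrr /cn /= normr0 addr0.
  by rewrite mulr_ge0 ?sqrtr_ge0// ltW.
- move=> e e0; exists 1 => // r rr; rewrite f1// (coord1_frame hdelta) subrr /cn /= normr0 addr0.
  by rewrite mulr_ge0 ?sqrtr_ge0// ltW.
Qed.

End Surjectivity.

(** * Self-adjoint extensions *)

Section Extensions.
Variable R : realType.
Implicit Types (f g : spinor R).

Variables (m nu mu lam : R) (k : int).
Hypothesis hdelta : dirac_delta nu mu lam k < 0.
Local Notation gam := (dirac_gamma nu mu lam k).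
Local Notation p := (nu + mu).
Local Notation q := (nu - mu).
Local Notation d := (dirac_d nu mu lam k).
Local Notation dmax := (dirac_max m nu mu lam k).
Local Notation dmin := (dirac_min m nu mu lam k).
Local Notation has_trace := (has_trace nu mu lam k).
Local Notation trace_form := (boundary_form nu mu lam k).
Local Notation rho := (Num.sqrt (p / q)).

Lemma q_neq0 : q != 0.
Proof. by have := pq_gt0 hdelta; apply: contraTneq => ->; rewrite mulr0 ltxx. Qed.

Lemma rho_gt0 : 0 < rho.
Proof.
rewrite sqrtr_gt0; have q2 : 0 < q ^+ 2 by rewrite exprn_even_gt0// q_neq0.
rewrite (_ : p / q = (p * q) / q ^+ 2); first by rewrite divr_gt0// (pq_gt0 hdelta).
by field; exact: q_neq0.
Qed.

Lemma p_rho : p%:C = q%:C * rho%:C * rho%:C :> R[i].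
Proof.
rewrite -!realC_mul; congr (_ %:C); rewrite -mulrA -expr2 sqr_sqrtr.
  by rewrite mulrCA divff ?mulr1// q_neq0.
by rewrite ltW// -sqrtr_gt0 rho_gt0.
Qed.

(** The line of traces of parameter theta, solved for c1; it depends on
    e^(-2 i theta) only, which is why theta ranges over [0, pi). *)
Definition on_ray (theta : R) (c0 c1 : R[i]) : Prop :=
  c1 = rho%:C * cis (- theta) * cis (- theta) * c0.

Lemma bc_ray theta f c0 c1 : has_trace f c0 c1 ->
  boundary_condition nu mu lam k theta f <-> on_ray theta c0 c1.
Proof.
move=> T; rewrite (boundary_condition_trace hdelta); split=> [[A T']|r].
  have [-> ->] := trace_unique T T'; rewrite /on_ray.
  transitivity (rho%:C * cis (- theta) * A * (cis (- theta) * cis theta)); last by ring.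
  by rewrite cisN_cis mulr1; ring.
exists (c0 * cis (- theta)).
have -> : c0 * cis (- theta) * cis theta = c0 by rewrite -mulrA cisN_cis mulr1.
by rewrite (_ : _ * _ * _ = c1)// r; ring.
Qed.

(** On the line of parameter theta the form is a multiple, nonzero unless
    c0 = 0, of the equation of that same line: the line is its own orthogonal. *)
Lemma trace_formE theta c0 c1 e0 e1 : on_ray theta c0 c1 ->
  trace_form c0 c1 e0 e1 = d * conjc d * (2%:R * 'i%C * gam%:C) * conjc c0 * q%:C * rho%:C
    * (cis theta * cis theta) * (rho%:C * cis (- theta) * cis (- theta) * e0 - e1).
Proof.
move=> ->; rewrite /boundary_form p_rho !cjM !realCJ cisJ opprK.
have h := cisN_cis theta; set e := cis theta in h *; set e' := cis (- theta) in h *.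
set K := d * _ * _.
transitivity (K * (q%:C * rho%:C * rho%:C * conjc c0 * e0 * (e' * e) * (e' * e) -
  q%:C * (rho%:C * e * e * conjc c0) * e1)); first by rewrite h !mulr1.
ring.
Qed.

Lemma trace_form_ray theta c0 c1 e0 e1 : on_ray theta c0 c1 -> on_ray theta e0 e1 ->
  trace_form c0 c1 e0 e1 = 0.
Proof. by move=> r ->; rewrite (trace_formE _ _ r) subrr mulr0. Qed.

Lemma cis_neq0 (x : R) : cis x != 0.
Proof.
apply/eqP => h; have := cisN_cis x; rewrite h mulr0 => /eqP.
by rewrite eq_sym oner_eq0.
Qed.

Lemma realC_neq0 (x : R) : x != 0 -> x%:C != 0 :> R[i].
Proof. by move=> x0; apply/eqP => /(congr1 Re) /= /eqP; apply/negP. Qed.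

Lemma conjc_neq0 (z : R[i]) : z != 0 -> conjc z != 0.
Proof. by apply: contra_neq => h; rewrite -[z]conjcK h conjc0. Qed.

Lemma form_cst_neq0 : d * conjc d * (2%:R * 'i%C * gam%:C) != 0.
Proof.
have dn := d_neq0 hdelta.
have d0 : d != 0 by rewrite invr_eq0.
have {}dn : 2%:R * 'i%C * gam%:C != 0 :> R[i] by move: dn; rewrite mulf_eq0 negb_or => /andP[].
by apply: mulf_neq0 => //; apply: mulf_neq0 => //; exact: conjc_neq0.
Qed.

Lemma trace_form_eq0_ray theta c0 c1 e0 e1 : on_ray theta c0 c1 -> c0 != 0 ->
  trace_form c0 c1 e0 e1 = 0 -> on_ray theta e0 e1.
Proof.
move=> r c00; rewrite (trace_formE _ _ r) => /eqP.
rewrite mulf_eq0 => /orP[|]; last by rewrite subr_eq0 => /eqP <-.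
rewrite !mulf_eq0 -!orbA => h; exfalso; move: h.
have := form_cst_neq0; rewrite !mulf_eq0 !negb_or -!andbA => /and5P[h1 h2 h3 h4 h5].
rewrite (negbTE h1) (negbTE h2) (negbTE h3) (negbTE h4) (negbTE h5) (negbTE (conjc_neq0 c00)).
rewrite (negbTE (realC_neq0 q_neq0)) (negbTE (realC_neq0 (lt0r_neq0 rho_gt0))).
by rewrite (negbTE (cis_neq0 theta)).
Qed.

Lemma dmax_linear (al : R[i]) f g f' g' : dmax (f, g) -> dmax (f', g') ->
  dmax (fun x => al *: f x + f' x, fun x => al *: g x + g' x).
Proof.
move=> [/= Lf Lg W] [/= Lf' Lg' W'].
have LL (u v : spinor R) : L2 u -> L2 v -> L2 (fun x => al *: u x + v x).
  move=> /L2P Lu /L2P Lv; apply/L2P => i.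
  by apply: eq_csq (csqD (csqZ al (Lu i)) (Lv i)) => x; rewrite !mxE.
have [fc [e Lfc [h0 h1]]] := weak_ac Lf Lg W.
have [fc' [e' Lfc' [h0' h1']]] := weak_ac Lf' Lg' W'.
split => /=; [exact: LL|exact: LL|].
apply: (@dirac_weak_ae _ _ _ _ _ _ (fun x => al *: fc x + fc' x) (fun x => al *: g x + g' x)).
- exact: LL.
- exact: LL.
- exact: LL.
- exact: LL.
- by apply: ae_mono2 e e' => x h h' Dx; rewrite h// h'.
- exact: eqL2_refl.
apply: ac_weak; [exact: LL|exact: LL|].
split.
  rewrite (_ : (fun x => _) = fun x => al * fc x i0 0 + fc' x i0 0); last first.
    by apply/funext => x; rewrite !mxE.
  apply: eq_chd (chdD (chdZ al h0) h0') => x.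
  by rewrite !potR1 !mxE; ring.
rewrite (_ : (fun x => _) = fun x => al * fc x i1 0 + fc' x i1 0); last first.
  by apply/funext => x; rewrite !mxE.
apply: eq_chd (chdD (chdZ al h1) h1') => x.
by rewrite !potR0 !mxE; ring.
Qed.

(** The operator t(theta). *)
Definition dirac_ext (theta : R) : graph R :=
  [set P | dmax P /\ boundary_condition nu mu lam k theta P.1].

Lemma dmin_ext theta : dmin `<=` dirac_ext theta.
Proof.
move=> [f g] fg; split; first exact: dmin_dmax.
have T : has_trace f 0 0 by apply: (@dmin_trace _ m); exists g.
by apply/(bc_ray _ T); rewrite /on_ray mulr0.
Qed.

Lemma ext_trace theta f g : dirac_ext theta (f, g) ->
  exists c0 c1, has_trace f c0 c1 /\ on_ray theta c0 c1.
Proof.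
move=> [/= fg bc]; have [|c0 [c1 T]] := trace_exists (f := f) (m := m) hdelta; first by exists g.
by exists c0, c1; split => //; apply/(bc_ray _ T).
Qed.

(** One inclusion is the vanishing of the form on the line. For the other, an
    element of the adjoint is paired with an element of trace
    (1, rho e^(-2 i theta)), and its own trace must be on the line. *)
Lemma ext_adjoint theta : dirac_ext theta = adjoint (dirac_ext theta).
Proof.
apply/seteqP; split=> [[f g] fg|[f g] fg].
  have [c0 [c1 [T r]]] := ext_trace fg.
  have [[Lf Lg W] _] := fg.
  split => //= f' g' fg'; have [e0 [e1 [T' r']]] := ext_trace fg'.
  by rewrite (lagrange_identity hdelta fg'.1 fg.1 T' T) (trace_form_ray r' r) addr0.
have mg := adjoint_max (@dmin_ext theta) fg; split => //=.
have [|c0 [c1 T]] := trace_exists (f := f) (m := m) hdelta; first by exists g.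
apply/(bc_ray _ T).
have [h [gh hm] Th] := trace_surjective m hdelta 1 (rho%:C * cis (- theta) * cis (- theta)).
have r : on_ray theta 1 (rho%:C * cis (- theta) * cis (- theta)) by rewrite /on_ray mulr1.
have hT : dirac_ext theta (h, gh) by split => //=; apply/(bc_ray _ Th).
apply: (trace_form_eq0_ray r (oner_neq0 _)).
have [_ _ A] := fg; have := A _ _ hT; rewrite (lagrange_identity hdelta hm mg Th T) /=.
by move/eqP; rewrite -subr_eq0 addrAC subrr add0r => /eqP.
Qed.

Lemma ext_selfadjoint theta : selfadjoint (dirac_ext theta).
Proof.
split; last exact: ext_adjoint.
- split.
  + by move=> f g [[Lf Lg _] _].
  + move=> f g f' g' fg Lf' Lg' ff gg; have [c0 [c1 [T r]]] := ext_trace fg.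
    have [[Lf Lg W] _] := fg; split.
      by split => //=; exact: (dirac_weak_ae Lf Lg).
    by apply/(bc_ray _ (trace_ae ff T)).
  + have tz : test_spinor (fun=> 0 : 'cV[R[i]]_2).
      by move=> i; move: (@test_function0 R); congr test_function; apply/funext => x; rewrite mxE.
    apply: dmin_ext; split => /=; try exact: test_spinor_L2.
    exists (fun=> 0); split => //; first exact: eqL2_refl.
    have cz i : (fun x : R => (0 : 'cV[R[i]]_2) i 0) = (fun=> 0).
      by apply/funext => x; rewrite mxE.
    apply/aeW => x _; apply: eq_cV2; rewrite ?dirac_expr0 ?dirac_expr1 cz cderive0 mulmx0 !mxE.
      by rewrite oppr0 addr0.
    by rewrite addr0.
  + move=> al f g f' g' fg fg'; have [c0 [c1 [T r]]] := ext_trace fg.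
    have [c0' [c1' [T' r']]] := ext_trace fg'.
    split; first exact: dmax_linear fg.1 fg'.1.
    by apply/(bc_ray _ (trace_linear al T T')); rewrite /on_ray r r'; ring.
  + by move=> f g g' [fg _] [fg' _]; exact: dirac_max_functional fg fg'.
- move=> f Lf e e0; have [g [h gh] fg] := dmin_dense m nu mu lam k Lf e0.
  by exists g => //; exists h; exact: dmin_ext.
Qed.

Lemma cis_surj (x y : R) : x ^+ 2 + y ^+ 2 = 1 ->
  exists theta : R, 0 <= theta < pi /\ cis (- theta) * cis (- theta) = x +i* y.
Proof.
move=> xy; have x1 : -1 <= x <= 1 by have := sqr_ge0 y; nra.
have ca := acosK x1; have sa := sin_acos x1.
have y2 : 1 - x ^+ 2 = y ^+ 2 by rewrite -xy; ring.
rewrite y2 sqrtr_sqr in sa.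
have a0 := acos_ge0 x1; have ap := acos_lepi x1.
have pi0 := pi_gt0 R.
have dbl (t : R) : cis (- t) * cis (- t) = cos (t + t) +i* - sin (t + t).
  by apply: eq_ReIm; rewrite !ReImE /= cosN sinN ?cosD ?sinD; ring.
have [y0|y0] := leP y 0.
  (* e^(-2 i theta) has imaginary part - sin (2 theta): the lower half of the
     circle takes theta in [0, pi/2], the upper half theta in ]pi/2, pi[. *)
  exists (acos x / 2); split; first by apply/andP; split; lra.
  by rewrite dbl -splitr ca sa ler0_norm// opprK.
have xlt : x < 1 by nra.
have apos : 0 < acos x.
  rewrite lt_neqAle a0 andbT; apply/eqP => h.
  by move: ca; rewrite -h cos0 => h'; move: xlt; rewrite -h' ltxx.
exists (pi - acos x / 2); split; first by apply/andP; split; lra.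
rewrite dbl (_ : pi - acos x / 2 + (pi - acos x / 2) = pi + pi - acos x); last by field.
rewrite cosB sinB cosD sinD cospi sinpi ca sa gtr0_norm//.
by congr (_ +i* _); ring.
Qed.

(** Isotropy reads rho |c0| = |c1|, because p = q rho^2; then c1 / (rho c0) is on
    the unit circle. *)
Lemma isotropic_on_ray c0 c1 : trace_form c0 c1 c0 c1 = 0 -> (c0 != 0) || (c1 != 0) ->
  c0 != 0 /\ exists theta : R, 0 <= theta < pi /\ on_ray theta c0 c1.
Proof.
move=> /eqP; rewrite mulf_eq0 (negbTE form_cst_neq0) /= p_rho => /eqP h nz.
have rn := realC_neq0 (lt0r_neq0 rho_gt0); have qn := realC_neq0 q_neq0.
have {}h : (rho%:C * c0) * conjc (rho%:C * c0) = c1 * conjc c1.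
  apply: (mulfI qn); rewrite cjM realCJ; apply/eqP; rewrite -subr_eq0; apply/eqP.
  by rewrite -[RHS]h; ring.
have c00 : c0 != 0.
  apply: contraTneq nz => c00; rewrite c00 eqxx /= negbK; move: h; rewrite c00 mulr0 mul0r.
  by move/esym/eqP; rewrite mulf_eq0 => /orP[//|c1J]; apply: contraTT c1J => /conjc_neq0.
split => //.
have rc : rho%:C * c0 != 0 by rewrite mulf_neq0.
have [z zE] : exists z, z * (rho%:C * c0) = c1 by exists (c1 / (rho%:C * c0)); rewrite divfK.
have zz : z * conjc z = 1.
  apply: (mulfI rc); apply: (mulIf (conjc_neq0 rc)).
  by rewrite mulr1 h -zE !cjM; ring.
have [|theta [th E]] := @cis_surj (Re z) (Im z).
  by move/(congr1 Re): zz; rewrite !ReImE /= => <-; ring.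
exists theta; split => //; rewrite /on_ray.
rewrite -zE.
have -> : z = cis (- theta) * cis (- theta) by rewrite E; apply: eq_ReIm.
ring.
Qed.

(** The traces of a symmetric operator are pairwise orthogonal. They cannot all
    vanish, for then every element of the domain of h^* would be in the domain of
    the adjoint; so one nonzero isotropic trace exists, and it determines the line
    containing all the others. An inclusion between self-adjoint operators is an
    equality. *)
Lemma selfadjoint_ext (t : graph R) : selfadjoint t -> dmin `<=` t ->
  exists theta : R, 0 <= theta < pi /\ t = dirac_ext theta.
Proof.
move=> [op _ ta] mt.
have tm : t `<=` dmax by rewrite ta; exact: adjoint_max.
have tr f g : t (f, g) -> exists c0 c1, has_trace f c0 c1.
  by move=> fg; apply: (trace_exists hdelta); exists g; exact: tm fg.
have sym f g f' g' : t (f, g) -> t (f', g') -> inner g f' = inner f g'.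
  by move=> fg; rewrite {1}ta => -[_ _ A]; exact: A fg.
have form0 f g f' g' c0 c1 e0 e1 : t (f, g) -> t (f', g') -> has_trace f c0 c1 ->
    has_trace f' e0 e1 -> trace_form c0 c1 e0 e1 = 0.
  move=> fg fg' T T'; have := sym _ _ _ _ fg fg'.
  rewrite (lagrange_identity hdelta (tm _ fg) (tm _ fg') T T').
  by move/eqP; rewrite -subr_eq0 addrAC subrr add0r => /eqP.
have [[f [g [c0 [c1 [fg T nz]]]]]|none] := pselect (exists f g c0 c1,
    [/\ t (f, g), has_trace f c0 c1 & (c0 != 0) || (c1 != 0)]); last first.
  exfalso.
  have [h [gh hm] Th] := trace_surjective m hdelta 1 0.
  apply: (none); exists h, gh, 1, 0; split => //; last by rewrite oner_neq0.
  rewrite ta; have [/= Lh Lgh _] := hm; split => //= f g fg.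
  have [c0 [c1 T]] := tr _ _ fg.
  rewrite (lagrange_identity hdelta (tm _ fg) hm T Th).
  have [c00 c10] : c0 = 0 /\ c1 = 0.
    have [] := boolP ((c0 != 0) || (c1 != 0)); first by move=> nz; exfalso; apply: none; exists f, g, c0, c1.
    by rewrite negb_or !negbK => /andP[/eqP -> /eqP ->].
  by rewrite c00 c10 /boundary_form conjc0 !(mulr0, mul0r) subrr mulr0 addr0.
have [c00 [theta [th r]]] := isotropic_on_ray (form0 _ _ _ _ _ _ _ _ fg fg T T) nz.
exists theta; split => //.
have sub : t `<=` dirac_ext theta.
  move=> [f' g'] fg'; split; first exact: tm.
  have [e0 [e1 T']] := tr _ _ fg'.
  apply/(bc_ray _ T'); apply: (trace_form_eq0_ray r c00).
  exact: form0 fg fg' T T'.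
apply/seteqP; split => //.
rewrite ext_adjoint [X in _ `<=` X]ta => -[f' g'] [Lf Lg A]; split => // f'' g'' fg''.
by apply: A; exact: sub.
Qed.

End Extensions.

Theorem theorem1p3 (R : realType) (m nu mu lam : R) (k : int)
    (hk : k != 0) (hdelta : dirac_delta nu mu lam k < 0) :
  dirac_D nu mu lam k \in unitmx /\
  exists t : R -> graph R,
    [/\ (forall theta : R, 0 <= theta < pi ->
          [/\ selfadjoint (t theta),
              dirac_min m nu mu lam k `<=` t theta &
              t theta `<=` dirac_max m nu mu lam k]),
        (forall theta : R, 0 <= theta < pi -> forall f : spinor R,
          dom (t theta) f <->
          dom (dirac_max m nu mu lam k) f /\
          boundary_condition nu mu lam k theta f) &
        (forall t' : graph R, selfadjoint t' ->
          dirac_min m nu mu lam k `<=` t' ->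
          exists theta : R, 0 <= theta < pi /\ t' = t theta)].
Proof.
split; first exact: dirac_D_unit.
exists (dirac_ext m nu mu lam k); split=> [theta _|theta _ f|t' sa mt].
- by split; [exact: ext_selfadjoint|exact: dmin_ext|move=> P []].
- by split=> [[g [fg bc]]|[[g fg] bc]]; [split => //; exists g|exists g; split].
- exact: selfadjoint_ext.
Qed.
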